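(* Let $R>0$, $g\in\mathcal C^1(R)$, $w:[0,1]\to\mathbb R$ measurable with $\sup_{x\in[0,1]}|w(x)|<\infty$, $\alpha\in(0,1)$. In the Poisson point process model with intensity $\lambda_g(x,y)=n\mathbf 1(y\ge g(x))$ on $[0,1]\times\mathbb R$, let $\hat g^{MLE}(x)=\min_{j\ge1}(Y_j+R|x-X_j|)$, $$\hat\theta_n^{MLE}=\int_0^1\hat g^{MLE}(x)w(x)\,dx-\frac1n\sum_{j\ge1}\mathbf 1\big(\hat g^{MLE}(X_j)=Y_j\big)w(X_j),$$ and assume $\operatorname{Var}(\hat\theta_n^{MLE})\asymp n^{-3/2}$. Then $$\mathcal I_n:=\Big[\hat\theta_n^{MLE}-\hat\sigma_nq_{1-\alpha/2},\ \hat\theta_n^{MLE}+\hat\sigma_nq_{1-\alpha/2}\Big],\qquad \hat\sigma_n^2:=\frac1{n^2}\sum_{j\ge1}\mathbf 1(\hat g^{MLE}(X_j)=Y_j)w(X_j)^2,$$ with $q_{1-\alpha/2}$ the $(1-\alpha/2)$-quantile of $N(0,1)$, is a confidence interval for $\theta=\int_0^1g(x)w(x)\,dx$ with asymptotic coverage $1-\alpha$ as $n\to\infty$.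
   Context: $\mathcal C^{1}(R)=\{f:[0,1]\to\mathbb R \mid |f(y)-f(x)|\le R|y-x|\ \forall x,y\in[0,1]\}$. Under $P_g$ one observes the points $(X_j,Y_j)_{j\ge1}$ of a Poisson point process on $[0,1]\times\mathbb R$ with intensity $\lambda_g$ (depending on $n$). $a_n\asymp b_n$ means that $a_n/b_n$ is bounded and bounded away from $0$. Asymptotic coverage $1-\alpha$ means $P_g(\theta\in\mathcal I_n)\to1-\alpha$. *)

(* Defs.v *)
From mathcomp Require Export all_boot all_order all_algebra.
From mathcomp Require Export all_classical all_reals all_analysis.
From mathcomp Require Export measurable_realfun.

Set Implicit Arguments.
Unset Strict Implicit.
Unset Printing Implicit Defensive.

Import Order.TTheory GRing.Theory Num.Theory.
Import numFieldNormedType.Exports.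

Local Open Scope classical_set_scope.
Local Open Scope ring_scope.

Section PoissonProcess.
Context {d d' : measure_display} {T : measurableType d} {E : measurableType d'}
  {R : realType}.

Definition point_count (Z : nat -> T -> E) (B : set E) (t : T) : \bar R :=
  (\sum_(0 <= j <oo) (\1_B (Z j t))%:E)%E.

(* The Poisson point process on [S] with intensity measure [Lam], enumerated as
   the sequence [Z]; since [Z] has infinitely many terms, this forces [Lam] to
   have infinite total mass. The second argument of the library's
   [poisson_prob] is a dummy. Independence ranges over all families of Borel
   subsets of the extended reals, so it covers subfamilies (take setT). *)
Record is_poisson_process (P : probability T R) (S : set E)
    (Lam : set E -> \bar R) (Z : nat -> T -> E) : Prop := IsPoissonProcess {
  ppp_measurable : forall j, measurable_fun setT (Z j);
  ppp_range : forall j t, S (Z j t);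
  ppp_poisson : forall B, measurable B -> (Lam B < +oo)%E ->
    forall k : nat, P [set t | point_count Z B t = k%:R%:E] =
                    poisson_prob (fine (Lam B)) k [set k];
  ppp_infinite : forall B, measurable B -> Lam B = +oo%E ->
    P [set t | point_count Z B t = +oo%E] = 1%E;
  ppp_independent : forall (m : nat) (B : 'I_m -> set E)
      (A : 'I_m -> set (\bar R)),
    (forall i, measurable (B i)) -> trivIset setT B ->
    (forall i, measurable (A i)) ->
    P [set t | forall i, A i (point_count Z (B i) t)] =
    (\prod_(i < m) P [set t | A i (point_count Z (B i) t)])%E
}.

End PoissonProcess.

Section Boundary.
Context {R : realType}.

(* Functions on [0, 1] are represented by functions on R of which only the
   values on [0, 1] are ever used. *)
Definition lipschitz_class (L : R) : set (R -> R) :=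
  [set g | forall x y, x \in `[0, 1] -> y \in `[0, 1] ->
             `|g y - g x| <= L * `|y - x|].

Definition strip : set (R * R) := `[0, 1] `*` setT.

Definition intensity_measure (lam : R * R -> R) (B : set (R * R)) : \bar R :=
  (\int[lebesgue_measure \x lebesgue_measure]_(z in B `&` strip) (lam z)%:E)%E.

Definition boundary_intensity (n : nat) (g : R -> R) (z : R * R) : R :=
  n%:R * \1_[set u | g u.1 <= u.2] z.

(* [inf] is the minimum whenever the minimum exists, which happens almost
   surely for the processes considered here. *)
Definition mle (L : R) (x y : nat -> R) (s : R) : R :=
  inf (range (fun j => y j + L * `|s - x j|)).

(* The sum over the points lying on the graph of the MLE; almost surely only
   finitely many terms are nonzero. *)
Definition boundary_sum (L : R) (f : R -> R) (x y : nat -> R) : R :=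
  limn (series (fun j => (mle L x y (x j) == y j)%:R * f (x j))).

Definition functional (w g : R -> R) : R :=
  \int[lebesgue_measure]_(s in `[0, 1]) (g s * w s).

Definition theta_mle (n : nat) (L : R) (w : R -> R) (x y : nat -> R) : R :=
  functional w (mle L x y) - n%:R^-1 * boundary_sum L w x y.

Definition sigma_hat (n : nat) (L : R) (w : R -> R) (x y : nat -> R) : R :=
  Num.sqrt ((n%:R ^+ 2)^-1 * boundary_sum L (fun s => w s ^+ 2) x y).

Definition quantile (mu : set R -> \bar R) (p : R) : R :=
  inf [set q | (p%:E <= mu `]-oo, q]%classic)%E].

Definition confidence_interval (n : nat) (L : R) (w : R -> R) (alpha : R)
    (x y : nat -> R) : set R :=
  let q := quantile (normal_prob 0 1) (1 - alpha / 2) in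
  `[theta_mle n L w x y - sigma_hat n L w x y * q,
    theta_mle n L w x y + sigma_hat n L w x y * q].

Definition asymp (a b : nat -> R) : Prop :=
  (exists C, forall n, (0 < n)%N -> `|a n / b n| <= C) /\
  (exists2 c, 0 < c & forall n, (0 < n)%N -> c <= `|a n / b n|).

End Boundary.

(* Main.v *)
(* Write C(z) for the cone {(s,v) : v <= z.2 - L|s - z.1|} below a point z. A
   point of the process lies on the graph of the MLE exactly when no other point
   lies in its cone, and the MLE at s exceeds v exactly when the cone of (s,v) is
   void. Hence, with [open z] the event that the cone of z contains no point,

     n (theta_mle - theta) = - (sum over points z of open z * w(z.1)
                                - n * integral over {g <= v} of open z * w(z.1) dz),

   a compensated Poisson sum with integrand in {0,1} * w, whose predictable
   bracket and whose quadratic variation n^2 sigma_hat^2 have the same mean.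
   In the cone coordinates p = v + L s, q = v - L s the cone is a quadrant, so
   after cutting the plane into thin cells in p and q (and in the value of w),
   occupied independently by the Poisson property, the sum becomes a martingale
   on a finite product of Bernoulli spaces, enumerated lexicographically in
   (p, q). Its bracket concentrates: indicators of void cones at horizontal
   distance r are independent unless a cone has reach r/4, which costs an
   exponentially small probability, and the resulting bound
   n r + sqrt n / r, for r = n^(-1/4), is negligible against the square of the
   mean of the bracket, which is of order at least sqrt n by the hypothesis on the
   variance of the estimator.
   The martingale central limit theorem (Lindeberg replacement along the heat
   flow of the normal distribution function, after truncating the bracket) then
   gives the studentized limit. *)
Require Import Defs.
From HB Require Import structures.
From mathcomp Require Import ring lra zify.

Set Implicit Arguments.
Unset Strict Implicit.
Unset Printing Implicit Defensive.

Import Order.TTheory GRing.Theory Num.Theory.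
Import numFieldNormedType.Exports.

Local Open Scope classical_set_scope.
Local Open Scope ring_scope.

(** * Martingales on finite Bernoulli products *)

(** The variance of the estimator is known only up to constants, so nothing is divided by a
    deterministic rate: each sieve is scaled by the square root of the mean of its own bracket, and
    the normal limit comes with an error depending only on the largest coefficient and on the mean
    deviation of the scaled bracket from 1. This uniformity over all finite Bernoulli products lets
    the grid be refined separately for each [n]; no limit of grids at fixed [n] is taken.

    Discretization fails on a small bad event, where the estimator is not controlled. The lower
    bound on its second moment therefore passes to the sieve only after the square is truncated at a
    level [k], and the precision [kappa] is then taken at most [1 / k].

    A cell below another one in the product order may hold a point outside the cone when the two
    cells share a strip of one cone coordinate. With mesh [1 / N], two points share a strip with
    probability of order [n^2 / N], and the cells sharing a strip with an occupied one have area of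
    order [1 / N] per occupied cell; both vanish as [N] grows at fixed [n]. *)

Section BernoulliProduct.
Variables (R : realType) (K : finType) (p : K -> R).
Hypothesis p01 : forall c, 0 <= p c <= 1.
Implicit Types (b : {ffun K -> bool}) (F G : {ffun K -> bool} -> R) (c : K).

Definition bmass b : R := \prod_c (if b c then p c else 1 - p c).

Definition Ex F : R := \sum_b bmass b * F b.

Lemma bmass_ge0 b : 0 <= bmass b.
Proof.
apply: prodr_ge0 => c _; have /andP[p0 p1] := p01 c.
by case: ifP => // _; rewrite subr_ge0.
Qed.

Lemma Ex_ext F G : F =1 G -> Ex F = Ex G.
Proof. by move=> FG; apply: eq_bigr => b _; rewrite FG. Qed.

Lemma ler_Ex F G : (forall b, F b <= G b) -> Ex F <= Ex G.
Proof. by move=> FG; apply: ler_sum => b _; rewrite ler_wpM2l ?bmass_ge0. Qed.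

Lemma Ex_ge0 F : (forall b, 0 <= F b) -> 0 <= Ex F.
Proof. by move=> F0; apply: sumr_ge0 => b _; rewrite mulr_ge0 ?bmass_ge0. Qed.

Lemma ExD F G : Ex (fun b => F b + G b) = Ex F + Ex G.
Proof. by rewrite /Ex -big_split; apply: eq_bigr => b _; rewrite mulrDr. Qed.

Lemma ExB F G : Ex (fun b => F b - G b) = Ex F - Ex G.
Proof. by rewrite /Ex -sumrB; apply: eq_bigr => b _; rewrite mulrBr. Qed.

Lemma ExZ (k : R) F : Ex (fun b => k * F b) = k * Ex F.
Proof. by rewrite /Ex mulr_sumr; apply: eq_bigr => b _; rewrite mulrCA. Qed.

Lemma Ex_sum (I : Type) (s : seq I) (Q : pred I) (H : I -> {ffun K -> bool} -> R) :
  Ex (fun b => \sum_(i <- s | Q i) H i b) = \sum_(i <- s | Q i) Ex (H i).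
Proof.
rewrite /Ex exchange_big /=; apply: eq_bigr => b _.
by rewrite mulr_sumr.
Qed.

(** Distributivity of product over sum; this is the independence of the coordinates, and with all
    factors 1 it gives total mass 1. *)
Lemma Ex_prod (f : K -> bool -> R) :
  Ex (fun b => \prod_c f c (b c)) =
  \prod_c (p c * f c true + (1 - p c) * f c false).
Proof.
transitivity (\prod_c \sum_(v : bool) (if v then p c else 1 - p c) * f c v).
  rewrite bigA_distr_bigA /=; apply: eq_bigr => b _.
  by rewrite /bmass -big_split.
by apply: eq_bigr => c _; rewrite big_bool.
Qed.

Lemma Ex_cst (k : R) : Ex (fun=> k) = k.
Proof.
have := Ex_prod (fun _ _ => 1); rewrite [RHS]big1; last first.
  by move=> c _; rewrite !mulr1 addrC subrK.
rewrite (@Ex_ext _ (fun=> 1)) => [E1|b]; last by rewrite big1.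
by rewrite (@Ex_ext _ (fun=> k * 1)) ?ExZ ?E1 ?mulr1 // => b; rewrite mulr1.
Qed.

Lemma Ex_norm F : `|Ex F| <= Ex (fun b => `|F b|).
Proof.
rewrite /Ex (le_trans (ler_norm_sum _ _ _)) // ler_sum // => b _.
by rewrite normrM ger0_norm ?bmass_ge0.
Qed.

Definition upd b c (v : bool) : {ffun K -> bool} :=
  [ffun c' => if c' == c then v else b c'].

Lemma updE b c v : upd b c v c = v. Proof. by rewrite ffunE eqxx. Qed.

Lemma upd_neq b c c' v : c' != c -> upd b c v c' = b c'.
Proof. by move=> /negbTE nc; rewrite ffunE nc. Qed.

(** Configurations are paired by flipping coordinate [c]; the two masses in a pair share the factor
    [rest] and are in ratio [p c : 1 - p c]. The integrand on the right is the conditional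
    expectation of [F] given the other coordinates. *)
Lemma Ex_resample c F :
  Ex F = Ex (fun b => p c * F (upd b c true) + (1 - p c) * F (upd b c false)).
Proof.
pose rest b := \prod_(c' | c' != c) (if b c' then p c' else 1 - p c').
have massE b : bmass b = (if b c then p c else 1 - p c) * rest b.
  by rewrite /bmass (bigD1 c).
have rest_upd b v : rest (upd b c v) = rest b.
  by apply: eq_bigr => c' nc; rewrite upd_neq.
pose flip b := upd b c (~~ b c).
have flipK : involutive flip.
  move=> b; apply/ffunP => c'; rewrite !ffunE eqxx.
  by case: eqP => [->|//]; rewrite negbK.
have split_sum (H : {ffun K -> bool} -> R) : \sum_b H b = \sum_(b : {ffun K -> bool} | b c) (H b + H (flip b)).
  rewrite (bigID (fun b : {ffun K -> bool} => b c)) /= big_split /=; congr (_ + _).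
  rewrite (reindex_inj (inv_inj flipK)) /=; apply: eq_bigl => b.
  by rewrite /flip updE negbK.
rewrite /Ex !split_sum; apply: eq_bigr => b bc.
have bt : upd b c true = b.
  by apply/ffunP => c'; rewrite ffunE; case: eqP => // ->; rewrite bc.
have fb : flip b = upd b c false by rewrite /flip bc.
have updupd u v : upd (upd b c u) c v = upd b c v.
  by apply/ffunP => c'; rewrite !ffunE; case: eqP.
rewrite fb !updupd bt !massE bc updE rest_upd; ring.
Qed.

(** Measurability with respect to the other coordinates, without sigma-algebras. *)
Definition indep_of c G := forall b v, G (upd b c v) = G b.

Lemma Ex_center c G : indep_of c G -> Ex (fun b => G b * ((b c)%:R - p c)) = 0.
Proof.
move=> Gc; rewrite (Ex_resample c) -[RHS](Ex_cst 0); apply: Ex_ext => b.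
by rewrite !Gc !updE /=; ring.
Qed.

Lemma Ex_center2 c G : indep_of c G ->
  Ex (fun b => G b * ((b c)%:R - p c) ^+ 2) = Ex (fun b => G b * (p c * (1 - p c))).
Proof.
move=> Gc; rewrite (Ex_resample c) [RHS](Ex_resample c); apply: Ex_ext => b.
by rewrite !Gc !updE /=; ring.
Qed.

Lemma Ex_coord c G : indep_of c G ->
  Ex (fun b => G b * (b c)%:R) = Ex (fun b => G b * p c).
Proof.
move=> Gc; apply/eqP; rewrite -subr_eq0 -ExB -(Ex_center Gc).
by apply/eqP; apply: Ex_ext => b; rewrite mulrBr.
Qed.

Lemma Ex_markov F (k : R) : (forall b, 0 <= F b) -> 0 < k ->
  Ex (fun b => (k <= F b)%R%:R) <= Ex F / k.
Proof.
move=> F0 k0; rewrite ler_pdivlMr // mulrC -ExZ; apply: ler_Ex => b.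
by case: (leP k (F b)) => kF; rewrite ?mulr1 ?mulr0 ?F0.
Qed.

Variable r : K -> nat.
Hypothesis r_inj : injective r.

(** The inequality is not strict: [a c] ignores coordinate [c] itself as well as those of higher
    rank. *)
Definition predictable (a : K -> {ffun K -> bool} -> R) :=
  forall c c', (r c <= r c')%N -> indep_of c' (a c).

Variable a : K -> {ffun K -> bool} -> R.
Hypothesis a_pred : predictable a.

Definition martingale b := \sum_c a c b * ((b c)%:R - p c).
Definition bracket b := \sum_c a c b ^+ 2 * (p c * (1 - p c)).

(** Cross terms vanish: of two increments, the one of higher rank is centred given the rest of the
    product. The diagonal gives the Bernoulli variances. *)
Lemma Ex_martingale_sqr : Ex (fun b => martingale b ^+ 2) = Ex bracket.
Proof.
pose xi c b := a c b * ((b c)%:R - p c).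
have cross c c' : (r c < r c')%N -> Ex (fun b => xi c b * xi c' b) = 0.
  move=> cc'; rewrite -[RHS](@Ex_center c' (fun b => xi c b * a c' b)).
    by apply: Ex_ext => b; rewrite mulrA.
  move=> b v; rewrite /xi (a_pred (ltnW cc')) (a_pred (leqnn _)) upd_neq //.
  by apply: contraTneq cc' => ->; rewrite ltnn.
transitivity (\sum_c \sum_c' Ex (fun b => xi c b * xi c' b)).
  under [RHS]eq_bigr do rewrite -Ex_sum.
  rewrite -Ex_sum; apply: Ex_ext => b.
  by rewrite expr2 /martingale mulr_suml; apply: eq_bigr => c _; rewrite mulr_sumr.
rewrite Ex_sum; apply: eq_bigr => c _; rewrite (bigD1 c) //= [X in _ + X]big1.
  rewrite addr0 -(@Ex_center2 c (fun b => a c b ^+ 2)).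
    by apply: Ex_ext => b; rewrite /xi; ring.
  by move=> b v; rewrite a_pred.
move=> c' cc'; have [lt|lt|/r_inj e] := ltngtP (r c) (r c').
- exact: cross.
- by rewrite -[RHS](cross _ _ lt); apply: Ex_ext => b; rewrite mulrC.
- by rewrite e eqxx in cc'.
Qed.

Section LindebergTelescope.
Variables (phi : R -> R -> R) (A cap C : R).
Hypothesis C0 : 0 <= C.
(** Along a clock [w] advancing by the variance of a centred two-point increment, [phi] is a
    martingale up to [C] times that variance; only clocks up to [cap] are concerned. *)
Hypothesis phi_step : forall s w x q, 0 <= q <= 1 -> `|x| <= A -> 0 <= w ->
  w + x ^+ 2 * (q * (1 - q)) <= cap ->
  `|q * phi (s + x * (1 - q)) (w + x ^+ 2 * (q * (1 - q))) +
    (1 - q) * phi (s + x * (0 - q)) (w + x ^+ 2 * (q * (1 - q))) - phi s w| <=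
  C * (x ^+ 2 * (q * (1 - q))).
Hypothesis aA : forall c b, `|a c b| <= A.
Hypothesis a_cap : forall b, bracket b <= cap.

Let v c b := a c b ^+ 2 * (p c * (1 - p c)).

Let v_ge0 c b : 0 <= v c b.
Proof.
have /andP[p0 p1] := p01 c.
by rewrite mulr_ge0 ?sqr_ge0 // mulr_ge0 // subr_ge0.
Qed.

Let S j b := \sum_(c | (r c < j)%N) a c b * ((b c)%:R - p c).
Let W j b := \sum_(c | (r c < j)%N) v c b.

Let W_le j b : W j b <= bracket b.
Proof.
rewrite /bracket [leRHS](bigID (fun c => (r c < j)%N)) /= lerDl.
by apply: sumr_ge0 => c' _; exact: v_ge0.
Qed.

(** Induction on the rank. Ranks need not be consecutive, so a value taken by no cell leaves both
    partial sums unchanged; otherwise the single cell of rank [j] is averaged out with everything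
    earlier frozen. *)
Let lindeberg_step j :
  `|Ex (fun b => phi (S j b) (W j b)) - phi 0 0| <= C * Ex (W j).
Proof.
elim: j => [|j IH].
  rewrite (@Ex_ext (fun b => phi (S 0 b) (W 0 b)) (fun=> phi 0 0)); last first.
    by move=> b; rewrite /S /W !big_pred0.
  rewrite Ex_cst subrr normr0 mulr_ge0 // Ex_ge0 // => b.
  by apply: sumr_ge0 => c _; exact: v_ge0.
have [[c rc]|no] := pselect (exists c, r c = j); last first.
  have e c : (r c < j.+1)%N = (r c < j)%N.
    rewrite ltnS leq_eqVlt; case: eqP => // rc; by case: no; exists c.
  have SE b : S j.+1 b = S j b by apply: eq_bigl => c; exact: e.
  have WE b : W j.+1 b = W j b by apply: eq_bigl => c; exact: e.
  rewrite (Ex_ext WE).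
  by rewrite (@Ex_ext _ (fun b => phi (S j b) (W j b))) // => b; rewrite SE WE.
have e c' : (r c' < j.+1)%N && (c' != c) = (r c' < j)%N.
  rewrite ltnS leq_eqVlt -rc; have [->|ne] := eqVneq c' c.
    by rewrite eqxx ltnn.
  by rewrite andbT (inj_eq r_inj) (negbTE ne).
have SE b : S j.+1 b = S j b + a c b * ((b c)%:R - p c).
  by rewrite /S (bigD1 c) /= ?rc // (eq_bigl _ _ e) addrC.
have WE b : W j.+1 b = W j b + v c b.
  by rewrite /W (bigD1 c) /= ?rc // (eq_bigl _ _ e) addrC.
have aj c' : (r c' <= j)%N -> indep_of c (a c').
  by move=> lt; apply: a_pred; rewrite rc.
have Sc : indep_of c (S j).
  move=> b u; apply: eq_bigr => c' lt; rewrite aj ?(ltnW lt) // upd_neq //.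
  by apply: contraTneq lt => ->; rewrite rc ltnn.
have vc c' : (r c' <= j)%N -> indep_of c (v c').
  by move=> lt b u; rewrite /v aj.
have Wc : indep_of c (W j).
  by move=> b u; apply: eq_bigr => c' lt; rewrite vc ?(ltnW lt).
have -> : Ex (fun b => phi (S j.+1 b) (W j.+1 b)) - phi 0 0 =
    Ex (fun b => phi (S j.+1 b) (W j.+1 b) - phi (S j b) (W j b)) +
    (Ex (fun b => phi (S j b) (W j b)) - phi 0 0).
  by rewrite ExB; ring.
apply: le_trans (ler_normD _ _) _.
rewrite (@Ex_ext (W j.+1) (fun b => v c b + W j b)); last first.
  by move=> b; rewrite WE addrC.
rewrite (ExD (v c) (W j)) mulrDr lerD // (Ex_resample c) -ExZ (le_trans (Ex_norm _)) //.
apply: ler_Ex => b; rewrite !SE !WE !Sc !Wc !updE !vc ?rc // !aj ?rc //=.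
set L := (X in `|X|).
have -> : L = p c * phi (S j b + a c b * (1 - p c)) (W j b + v c b)
  + (1 - p c) * phi (S j b + a c b * (0 - p c)) (W j b + v c b)
  - phi (S j b) (W j b) by rewrite /L; ring.
apply: phi_step => //; first by apply: sumr_ge0 => c' _; exact: v_ge0.
by rewrite -WE; apply: le_trans (W_le _ _) (a_cap _).
Qed.

(* Lindeberg replacement: [phi S W] changes little in mean at each step, because the
   clock [W] advances by the conditional variance of the increment of [S]. *)
Lemma lindeberg_telescope :
  `|Ex (fun b => phi (martingale b) (bracket b)) - phi 0 0| <= C * cap.
Proof.
pose j := (\max_c r c).+1.
have rj c : (r c < j)%N by rewrite ltnS; apply: leq_bigmax.
have SE b : S j b = martingale b by apply: eq_bigl => c; rewrite rj.
have WE b : W j b = bracket b by apply: eq_bigl => c; rewrite rj.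
have := lindeberg_step j; rewrite (@Ex_ext _ (fun b => phi (martingale b) (bracket b))).
  move=> /le_trans; apply; apply: ler_wpM2l => //.
  by rewrite -[leRHS](Ex_cst cap); apply: ler_Ex => b; rewrite WE a_cap.
by move=> b; rewrite SE WE.
Qed.

End LindebergTelescope.

End BernoulliProduct.

Section PredictableTruncation.
Variables (R : realType) (K : finType) (p : K -> R) (r : K -> nat).
Hypothesis p01 : forall c, 0 <= p c <= 1.
Hypothesis r_inj : injective r.
Variables (a : K -> {ffun K -> bool} -> R) (cap : R).
Hypothesis a_pred : predictable r a.
Hypothesis cap0 : 0 <= cap.

(* Stopping the martingale before its bracket exceeds [cap] keeps it predictable. *)
Definition trunc c (b : {ffun K -> bool}) : R :=
  if \sum_(c' | (r c' <= r c)%N) a c' b ^+ 2 * (p c' * (1 - p c')) <= cap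
  then a c b else 0.

(** The test includes the contribution of [c], yet it is decided before coordinate [c] is revealed,
    because every coefficient in it is predictable. *)
Lemma trunc_predictable : predictable r trunc.
Proof.
move=> c c' cc' b u; rewrite /trunc a_pred //.
congr (if _ <= _ then _ else _); apply: eq_bigr => d dc.
by rewrite (a_pred (leq_trans dc cc')).
Qed.

Lemma trunc_norm c b : `|trunc c b| <= `|a c b|.
Proof. by rewrite /trunc; case: ifP; rewrite ?normr0. Qed.

Let v_ge0 c (x : R) : 0 <= x ^+ 2 * (p c * (1 - p c)).
Proof.
have /andP[p0 p1] := p01 c.
by rewrite mulr_ge0 ?sqr_ge0 // mulr_ge0 // subr_ge0.
Qed.

Lemma trunc_id b : bracket p a b <= cap -> forall c, trunc c b = a c b.
Proof.
move=> le c; rewrite /trunc ifT //; apply: le_trans le.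
rewrite /bracket [leRHS](bigID (fun c' => (r c' <= r c)%N)) /= lerDl.
by apply: sumr_ge0 => c' _; exact: v_ge0.
Qed.

(** The truncated clock [W] never exceeds the full clock [V]. When the test at a rank passes, [V]
    just after it is at most [cap]; when it fails, [W] does not move. *)
Lemma bracket_trunc b : bracket p trunc b <= cap.
Proof.
pose W j := \sum_(c | (r c < j)%N) trunc c b ^+ 2 * (p c * (1 - p c)).
pose V j := \sum_(c | (r c < j)%N) a c b ^+ 2 * (p c * (1 - p c)).
have main j : W j <= V j /\ W j <= cap.
  elim: j => [|j [IH1 IH2]]; first by rewrite /W /V !big_pred0.
  have [[c rc]|no] := pselect (exists c, r c = j); last first.
    have e c : (r c < j.+1)%N = (r c < j)%N.
      rewrite ltnS leq_eqVlt; case: eqP => // rc; by case: no; exists c.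
    by rewrite /W /V !(eq_bigl _ _ e).
  have e c' : (r c' < j.+1)%N && (c' != c) = (r c' < j)%N.
    rewrite ltnS leq_eqVlt -rc; have [->|ne] := eqVneq c' c.
      by rewrite eqxx ltnn.
    by rewrite andbT (inj_eq r_inj) (negbTE ne).
  have WE : W j.+1 = trunc c b ^+ 2 * (p c * (1 - p c)) + W j.
    by rewrite /W (bigD1 c) /= ?rc // (eq_bigl _ _ e).
  have VE : V j.+1 = a c b ^+ 2 * (p c * (1 - p c)) + V j.
    by rewrite /V (bigD1 c) /= ?rc // (eq_bigl _ _ e).
  rewrite WE VE /trunc.
  have -> : \sum_(c' | (r c' <= r c)%N) a c' b ^+ 2 * (p c' * (1 - p c')) = V j.+1.
    by apply: eq_bigl => c'; rewrite rc ltnS.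
  case: ifP => [le|_].
    have H : a c b ^+ 2 * (p c * (1 - p c)) + W j <= V j.+1 by rewrite VE lerD2l.
    by rewrite -VE; split => //; apply: le_trans le.
  rewrite expr0n mul0r add0r; split => //; apply: le_trans IH1 _.
  by rewrite lerDr.
have [_] := main (\max_c r c).+1; apply: le_trans.
rewrite le_eqVlt; apply/orP; left; apply/eqP.
by apply: eq_bigl => c; rewrite ltnS leq_bigmax.
Qed.

End PredictableTruncation.

(** * Normal distribution function and heat flow *)

Section Calculus.
Variable R : realType.
Implicit Types (f df : R -> R) (x y : R).

Lemma scaleRE (a b : R) : a *: b = a * b. Proof. by []. Qed.

Lemma is_derive_within f df x y : (forall z, x <= z <= y -> is_derive z 1 f (df z)) ->
  {within `[x, y], continuous f}.
Proof.
move=> H; apply/continuous_in_subspaceT => z; rewrite mem_setE => zxy.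
have := H z zxy => -[d _].
exact/differentiable_continuous/derivable1_diffP.
Qed.

Lemma lipschitz_of_derive f df x y (M : R) : x <= y ->
  (forall z, x <= z <= y -> is_derive z 1 f (df z)) ->
  (forall z, x <= z <= y -> `|df z| <= M) ->
  `|f y - f x| <= M * (y - x).
Proof.
move=> xy fd dM.
have [|c cxy ->] := @MVT_segment _ f df _ _ xy _ (is_derive_within fd).
  by move=> z /[!in_itv] /andP[/ltW ? /ltW ?]; apply: fd; apply/andP.
rewrite normrM [`|y - x|]ger0_norm ?subr_ge0 // ler_wpM2r ?subr_ge0 //.
by apply: dM; rewrite in_itv in cxy.
Qed.

Lemma lipschitz_of_deriveT f df (M : R) x y :
  (forall z : R, is_derive z 1 f (df z)) -> (forall z, `|df z| <= M) ->
  `|f y - f x| <= M * `|y - x|.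
Proof.
move=> fd dM; have [xy|/ltW yx] := leP x y.
  by rewrite (@ger0_norm _ (y - x)) ?subr_ge0 //; apply: lipschitz_of_derive.
rewrite distrC (distrC y) (@ger0_norm _ (x - y)) ?subr_ge0 //.
exact: lipschitz_of_derive.
Qed.

(** Three successive mean value estimates, which give the constant [M] where integration would give
    [M / 6]. *)
Lemma taylor2 f f1 f2 f3 (M : R) x h :
  (forall z : R, is_derive z 1 f (f1 z)) -> (forall z : R, is_derive z 1 f1 (f2 z)) ->
  (forall z : R, is_derive z 1 f2 (f3 z)) -> (forall z, `|f3 z| <= M) ->
  `|f (x + h) - f x - f1 x * h - f2 x * h ^+ 2 / 2| <= M * `|h| ^+ 3.
Proof.
move=> d1 d2 d3 b3.
have M0 : 0 <= M by apply: le_trans (b3 0).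
have b2 z : `|f2 z - f2 x| <= M * `|z - x| by apply: lipschitz_of_deriveT d3 b3.
(* Mean value inequality on the segment between [x] and [y], whichever is larger. *)
have via (u du : R -> R) (B : R) :
    (forall z : R, is_derive z 1 u (du z)) ->
    (forall z, `|z - x| <= `|h| -> `|du z| <= B) ->
    forall y, `|y - x| <= `|h| -> `|u y - u x| <= B * `|h|.
  move=> ud uB y yh; have B0 : 0 <= B by apply: le_trans (uB x _); rewrite ?subrr ?normr0.
  have [xy|/ltW yx] := leP x y.
    have zB z : x <= z <= y -> `|du z| <= B.
      move=> /andP[xz zy]; apply: uB; apply: le_trans yh.
      by rewrite !ger0_norm ?subr_ge0 ?(le_trans xz) // lerD2r.
    have := lipschitz_of_derive xy (fun z _ => ud z) zB.
    move=> /le_trans; apply; rewrite ler_wpM2l //.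
    by rewrite -[leLHS]ger0_norm ?subr_ge0.
  have zB z : y <= z <= x -> `|du z| <= B.
    move=> /andP[yz zx]; apply: uB; apply: le_trans yh.
    by rewrite distrC (distrC y) !ger0_norm ?subr_ge0 ?(le_trans yz) // lerD2l lerN2.
  rewrite distrC; have := lipschitz_of_derive yx (fun z _ => ud z) zB.
  move=> /le_trans; apply; rewrite ler_wpM2l //.
  by rewrite -[leLHS]ger0_norm ?subr_ge0 // distrC.
pose u1 z := f1 z - f2 x * (z - x).
have dlin (z : R) : is_derive z (1 : R) (fun z : R => z - x) 1.
  have := @is_deriveB _ _ _ id (cst x) z 1 1 0 (is_derive_id _ _) (is_derive_cst _ _ _).
  by rewrite subr0.
have dlinZ (k z : R) : is_derive z (1 : R) (fun z : R => k * (z - x)) k.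
  have := @is_deriveZ _ _ _ (fun z : R => z - x) k z 1 1 (dlin z).
  by rewrite scaleRE mulr1.
have u1d (z : R) : is_derive z (1 : R) u1 (f2 z - f2 x) by exact: is_deriveB.
have u1b z : `|z - x| <= `|h| -> `|u1 z - f1 x| <= M * `|h| ^+ 2.
  move=> zh; have := @via _ _ (M * `|h|) u1d _ z zh.
  rewrite {2}/u1 subrr mulr0 subr0 -mulrA -expr2; apply => y yh.
  by apply: le_trans (b2 y) _; rewrite ler_wpM2l.
pose u0 z := f z - f1 x * (z - x) - f2 x * (z - x) ^+ 2 / 2.
have u0d (z : R) : is_derive z (1 : R) u0 (u1 z - f1 x).
  have d2' : is_derive z (1 : R) (fun z : R => f2 x * (z - x) ^+ 2 / 2) (f2 x * (z - x)).
    have e : (fun z : R => f2 x * (z - x) ^+ 2 / 2) =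
             (f2 x / 2) \*: ((fun z : R => z - x) ^+ 2).
      by apply/funext => y; rewrite !fctE /= scaleRE; field.
    rewrite e.
    have := @is_deriveZ _ _ _ ((fun z : R => z - x) ^+ 2) (f2 x / 2) z 1 _
      (@is_deriveX _ _ _ 2 z 1 _ (dlin z)).
    have -> // : (f2 x / 2) *: ((2%:R * (z - x) ^+ 1) *: (1 : R)) = f2 x * (z - x).
    by rewrite !scaleRE; field.
  have -> : u1 z - f1 x = f1 z - f1 x - f2 x * (z - x) by rewrite /u1; ring.
  by apply: is_deriveB => //; apply: is_deriveB.
have := @via _ _ _ u0d u1b (x + h).
have xh : x + h - x = h by ring.
rewrite /u0 !xh lexx !subrr => /(_ isT).
rewrite expr0n /= !mulr0 mul0r !subr0.
rewrite (_ : M * `|h| ^+ 2 * `|h| = M * `|h| ^+ 3); last by ring.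
by apply: le_trans; rewrite le_eqVlt; apply/orP; left; apply/eqP; congr (`|_|); ring.
Qed.

End Calculus.

Section NormalCdf.
Variable R : realType.
Local Notation mu := (@lebesgue_measure R).
Implicit Types x y u b s : R.

Definition npdf : R -> R := normal_pdf 0 1.
Definition ncdf (x : R) : R := \int[mu]_(t in `]-oo, x]) npdf t.

Lemma npdfE u : npdf u = normal_peak 1 * expR (- (u ^+ 2) / 2).
Proof.
rewrite /npdf normal_pdfE ?oner_eq0 // /normal_fun subr0 expr1n.
by congr (_ * expR (_ / _)); rewrite mulr2n.
Qed.

Lemma npdf_gt0 u : 0 < npdf u.
Proof. by rewrite npdfE mulr_gt0 ?expR_gt0 ?normal_peak_gt0 ?oner_eq0. Qed.

Let intN A : measurable A -> mu.-integrable A (EFin \o npdf).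
Proof.
move=> mA; apply: (integrableS measurableT) => //.
exact: integrable_normal_pdf.
Qed.

Lemma ncdfE x : normal_prob 0 1 `]-oo, x] = (ncdf x)%:E.
Proof.
rewrite /normal_prob /ncdf /Rintegral fineK //.
by apply: integrable_fin_num => //; apply: intN.
Qed.

Lemma is_derive_ncdf x : is_derive x 1 ncdf (npdf x).
Proof.
have x1 : x < x + 1 by rewrite ltrDl.
have cx : {for x, continuous npdf}.
  by apply: continuous_normal_pdf; rewrite oner_eq0.
have ix : mu.-integrable [set` Interval -oo%O (BRight (x + 1))] (EFin \o npdf).
  exact: intN.
have := continuous_FTC1 x1 ix (ltNyr _) cx => -[d e].
apply: DeriveDef; first exact: d.
by rewrite -derive1E; exact: e.
Qed.

Lemma ncdf_ge0 x : 0 <= ncdf x.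
Proof. by rewrite -lee_fin -ncdfE; exact: measure_ge0. Qed.

Lemma ncdf_le1 x : ncdf x <= 1.
Proof. by rewrite -lee_fin -ncdfE; apply: probability_le1. Qed.

Lemma ncdf_le x y : x <= y -> ncdf x <= ncdf y.
Proof.
move=> xy; rewrite -lee_fin -!ncdfE; apply: le_measure; rewrite ?inE //.
by apply: subset_itvl; rewrite bnd_simp.
Qed.

Lemma ncdf_lt x y : x < y -> ncdf x < ncdf y.
Proof.
move=> xy; rewrite -subr_gt0.
have [|c _ ->] := @MVT_segment _ ncdf npdf _ _ (ltW xy) _
  (is_derive_within (fun z _ => is_derive_ncdf z)).
  by move=> *; exact: is_derive_ncdf.
by rewrite mulr_gt0 ?npdf_gt0 ?subr_gt0.
Qed.

Lemma continuous_ncdf : continuous ncdf.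
Proof.
move=> x; have [d _] := is_derive_ncdf x.
exact/differentiable_continuous/derivable1_diffP.
Qed.

(** As a random variable under the normal law, the identity has distribution function [ncdf]; the
    limits at infinity follow from the general theory of distribution functions. *)
Let idTR : measurableTypeR R -> R := idfun.

#[local] HB.instance Definition _ :=
  @isMeasurableFun.Build _ _ _ _ idTR (@measurable_id _ _ setT).

Lemma ncdf_cvgy : ncdf x @[x --> +oo] --> (1 : R).
Proof.
have := @cvg_cdfy1 _ _ _ (normal_prob 0 1) (idTR : {RV (normal_prob 0 1) >-> R}).
rewrite (_ : cdf _ = EFin \o ncdf); first by move/fine_cvg.
by apply/funext => x; rewrite /= -ncdfE.
Qed.

Lemma ncdf_cvgNy : ncdf x @[x --> -oo] --> (0 : R).
Proof.
have := @cvg_cdfNy0 _ _ _ (normal_prob 0 1) (idTR : {RV (normal_prob 0 1) >-> R}).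
rewrite (_ : cdf _ = EFin \o ncdf); first by move/fine_cvg.
by apply/funext => x; rewrite /= -ncdfE.
Qed.

(** The density is even, so [ncdf (- x) + ncdf x] has zero derivative; its limit at infinity is
    1. *)
Lemma ncdfN x : ncdf (- x) = 1 - ncdf x.
Proof.
pose h x := ncdf (- x) + ncdf x.
have hd (z : R) : is_derive z 1 h 0.
  have -> : (0 : R) = npdf (- z) * -1 + npdf z.
    by rewrite !npdfE sqrrN mulrN1 addNr.
  apply: is_deriveD; last exact: is_derive_ncdf.
  by apply: is_derive1_comp; exact: is_derive_ncdf.
have hc y : h y = h x.
  apply/eqP; rewrite -subr_eq0 -normr_le0.
  have := @lipschitz_of_deriveT _ _ _ 0 x y hd; rewrite mul0r; apply => z.
  by rewrite normr0.
have h1 : h y @[y --> +oo] --> (0 + 1 : R).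
  apply: cvgD; last exact: ncdf_cvgy.
  exact: ((cvgNy_compNP _ _).1 ncdf_cvgNy).
have h2 : h y @[y --> +oo] --> h x by under eq_fun do rewrite hc; exact: cvg_cst.
have := cvg_unique _ h1 h2; rewrite add0r /h => e.
by rewrite e // addrK.
Qed.

End NormalCdf.

Section HeatFlow.
Variable R : realType.
Implicit Types (b s t u x q k c : R).
Local Notation npdf := (@npdf R).
Local Notation ncdf := (@ncdf R).
Local Notation c0 := (normal_peak (1 : R)).

Lemma normal_peak1_ge0 : 0 <= c0. Proof. exact: normal_peak_ge0. Qed.

(** The polynomial is [(1 + u^2 / 4)^2], and [1 + v <= exp v] at [v = u^2 / 4] bounds it by
    [exp (u^2 / 2)]. The bounds on derivatives of the density all reduce to this one. *)
Lemma npdf_moment u : (1 + u ^+ 2 / 2 + u ^+ 4 / 16) * npdf u <= c0.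
Proof.
rewrite npdfE mulrCA -[leRHS]mulr1 ler_wpM2l ?normal_peak1_ge0 //.
have -> : - u ^+ 2 / 2 = - (u ^+ 2 / 4 + u ^+ 2 / 4) by field.
rewrite expRN ler_pdivrMr ?expR_gt0 // mul1r expRD.
have -> : 1 + u ^+ 2 / 2 + u ^+ 4 / 16 = (1 + u ^+ 2 / 4) * (1 + u ^+ 2 / 4) by field.
have h : 0 <= 1 + u ^+ 2 / 4 by rewrite addr_ge0 // divr_ge0 // sqr_ge0.
by apply: ler_pM => //; apply: expR_ge1Dx.
Qed.

Definition npdf1 u := - (u * npdf u).
Definition npdf2 u := (u ^+ 2 - 1) * npdf u.

Let n0 u : 0 <= npdf u. Proof. by rewrite ltW // npdf_gt0. Qed.

Let poly_bound (P : R) u : P <= 16 * (1 + u ^+ 2 / 2 + u ^+ 4 / 16) ->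
  P * npdf u <= 16 * c0.
Proof.
move=> H; apply: le_trans (ler_wpM2r (n0 u) H) _.
by rewrite -mulrA ler_wpM2l ?npdf_moment.
Qed.

Lemma npdf1_bound u : `|npdf1 u| <= 16 * c0.
Proof.
rewrite normrN normrM (ger0_norm (n0 u)); apply: poly_bound.
have [u0|u0] := leP 0 u; rewrite ?(ger0_norm u0) ?(ltr0_norm u0); nra.
Qed.

Lemma npdf2_bound u : `|npdf2 u| <= 16 * c0.
Proof.
rewrite normrM (ger0_norm (n0 u)); apply: poly_bound.
rewrite ler_norml; apply/andP; split; nra.
Qed.

(** This product enters the second time derivative of the heat flow. *)
Lemma u_npdf2_bound u : `|u * npdf2 u| <= 16 * c0.
Proof.
rewrite mulrA normrM (ger0_norm (n0 u)); apply: poly_bound.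
have u2 := sqr_ge0 u; have u4 : 0 <= u ^+ 4 by rewrite exprn_even_ge0.
have e : u * (u ^+ 2 - 1) = u ^+ 3 - u by ring.
(* Completed squares dominate the odd powers of [u], of either sign, by even ones. *)
have s1 : 0 <= u ^+ 4 - u ^+ 3 + u ^+ 2 / 4.
  by rewrite (_ : _ + _ = (u ^+ 2 - u / 2) ^+ 2) ?sqr_ge0 //; field.
have s2 : 0 <= u ^+ 4 + u ^+ 3 + u ^+ 2 / 4.
  by rewrite (_ : _ + _ = (u ^+ 2 + u / 2) ^+ 2) ?sqr_ge0 //; field.
have s3 : 0 <= u ^+ 2 - 2 * u + 1.
  by rewrite (_ : _ + _ = (u - 1) ^+ 2) ?sqr_ge0 //; ring.
have s4 : 0 <= u ^+ 2 + 2 * u + 1.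
  by rewrite (_ : _ + _ = (u + 1) ^+ 2) ?sqr_ge0 //; ring.
have b1 : u * (u ^+ 2 - 1) <= 16 * (1 + u ^+ 2 / 2 + u ^+ 4 / 16) by rewrite e; lra.
have b2 : - (u * (u ^+ 2 - 1)) <= 16 * (1 + u ^+ 2 / 2 + u ^+ 4 / 16) by rewrite e; lra.
by rewrite ler_norml b1 andbT lerNl.
Qed.

Lemma is_derive_npdf u : is_derive u 1 npdf (npdf1 u).
Proof.
have -> : npdf = (fun v => c0 * expR (- (v ^+ 2) / 2)).
  by apply/funext => v; rewrite npdfE.
have d2 : is_derive u 1 (fun v : R => - (v ^+ 2) / 2) (- u).
  have -> : (fun v : R => - (v ^+ 2) / 2) = (- 2^-1) \*: (id ^+ 2 : R -> R).
    by apply/funext => v; rewrite !fctE /= scaleRE; field.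
  have -> : - u = (- 2^-1) *: ((2%:R * u ^+ 1) *: (1 : R)) by rewrite !scaleRE; field.
  exact: is_deriveZ.
have d1 := @is_derive1_comp _ _ _ u _ _ (is_derive_expR (- u ^+ 2 / 2)) d2.
have := @is_deriveZ _ _ _ (expR \o (fun v : R => - (v ^+ 2) / 2)) c0 u 1 _ d1.
have -> // : c0 *: (expR (- u ^+ 2 / 2) * - u) = npdf1 u.
by rewrite scaleRE /npdf1 npdfE; ring.
Qed.

Lemma is_derive_npdf1 u : is_derive u 1 npdf1 (npdf2 u).
Proof.
have -> : npdf1 = - (id * npdf) by apply/funext => v; rewrite !fctE.
have -> : npdf2 u = - (u *: npdf1 u + npdf u *: (1 : R)).
  by rewrite !scaleRE /npdf2 /npdf1; ring.
exact/is_deriveN/is_deriveM/is_derive_npdf.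
Qed.

(** The factor [c] makes the shape stable under differentiation, so the lemma can be iterated to
    reach the third derivative. *)
Lemma is_derive_affine b k c s (h dh : R -> R) :
  (forall u, is_derive u 1 h (dh u)) ->
  is_derive s 1 (fun s => h ((b - s) * k) * c) (dh ((b - s) * k) * (- k * c)).
Proof.
move=> hd; have da : is_derive s 1 (fun s => (b - s) * k) (- k).
  have := @is_deriveZ _ _ _ (cst b - id) k s 1 _
    (@is_deriveB _ _ _ (cst b) id s 1 _ _ (is_derive_cst _ _ _) (is_derive_id _ _)).
  rewrite sub0r scaleRE mulrN1.
  by rewrite (_ : k \*: (cst b - id) = (fun s => (b - s) * k)) //; apply/funext => v; rewrite !fctE /= scaleRE mulrC.
have := @is_deriveZ _ _ _ _ c s 1 _ (@is_derive1_comp _ h _ s _ _ (hd _) da).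
rewrite scaleRE (_ : c * (_ * - k) = dh ((b - s) * k) * (- k * c)); last by ring.
by rewrite (_ : c \*: _ = (fun s => h ((b - s) * k) * c)) //; apply/funext => v; rewrite !fctE /= scaleRE mulrC.
Qed.

(* [heat b s t] is the probability that [s] plus a centred normal variable of
   variance [t] is at most [b]. *)
Definition heat b s t := ncdf ((b - s) * (Num.sqrt t)^-1).

(** Expansion in space with the time frozen through [k], the inverse square root of the variance. *)
Lemma heat_taylor b k s h :
  `|ncdf ((b - (s + h)) * k) - ncdf ((b - s) * k) + npdf ((b - s) * k) * k * h
    - npdf1 ((b - s) * k) * k ^+ 2 * h ^+ 2 / 2| <= 16 * c0 * `|k| ^+ 3 * `|h| ^+ 3.
Proof.
pose f1 s := npdf ((b - s) * k) * (- k * 1).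
pose f2 s := npdf1 ((b - s) * k) * (- k * (- k * 1)).
pose f3 s := npdf2 ((b - s) * k) * (- k * (- k * (- k * 1))).
have h1 (z : R) : is_derive z 1 (fun s => ncdf ((b - s) * k) * 1) (f1 z).
  exact/is_derive_affine/is_derive_ncdf.
have h2 (z : R) : is_derive z 1 f1 (f2 z).
  exact/is_derive_affine/is_derive_npdf.
have h3 (z : R) : is_derive z 1 f2 (f3 z).
  exact/is_derive_affine/is_derive_npdf1.
have h4 z : `|f3 z| <= 16 * c0 * `|k| ^+ 3.
  rewrite /f3 normrM ler_pM //; first exact: npdf2_bound.
  by rewrite mulr1 !normrM !normrN !exprS expr0 mulr1.
have := taylor2 s h h1 h2 h3 h4; apply: le_trans.
rewrite le_eqVlt; apply/orP; left; apply/eqP; congr (`|_|).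
by rewrite /f1 /f2; field.
Qed.

Lemma is_derive_rsqrt t : 0 < t ->
  is_derive t 1 (fun t => (Num.sqrt t)^-1) (- 2^-1 * (Num.sqrt t)^-1 ^+ 3).
Proof.
move=> t0; have s0 : Num.sqrt t != 0 by rewrite gt_eqF ?sqrtr_gt0.
have := @is_deriveV _ Num.sqrt t _ 1 s0 (is_derive1_sqrt t0).
rewrite scaleRE.
have -> // : - Num.sqrt t ^- 2 * (2 * Num.sqrt t)^-1 = - 2^-1 * (Num.sqrt t)^-1 ^+ 3.
by field; rewrite s0.
Qed.

(** The heat equation: with [k] the inverse root of [t], [npdf1 u * k^2] is the second space
    derivative, and the time derivative is half of it. *)
Lemma is_derive_heat b s t : 0 < t ->
  is_derive t 1 (heat b s) (2^-1 * (npdf1 ((b - s) * (Num.sqrt t)^-1) * (Num.sqrt t)^-1 ^+ 2)).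
Proof.
move=> t0; pose k := (Num.sqrt t)^-1; pose d := b - s.
have dk := @is_deriveZ _ _ _ _ d t 1 _ (is_derive_rsqrt t0).
have := @is_derive1_comp _ ncdf _ t _ _ (is_derive_ncdf _) dk.
rewrite !scaleRE -/k -/d.
have -> // : npdf (d * k) * (d * (- 2^-1 * k ^+ 3)) = 2^-1 * (npdf1 (d * k) * k ^+ 2).
by rewrite /npdf1; field.
Qed.

Let heat2 b s t := npdf1 ((b - s) * (Num.sqrt t)^-1) * (Num.sqrt t)^-1 ^+ 2.

Lemma is_derive_heat2 b s t : 0 < t ->
  let k := (Num.sqrt t)^-1 in let u := (b - s) * k in
  is_derive t 1 (heat2 b s) (- (npdf1 u + 2^-1 * (u * npdf2 u)) * k ^+ 4).
Proof.
move=> t0 k u; pose d := b - s.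
have kd := is_derive_rsqrt t0; rewrite -/k in kd.
have dk := @is_deriveZ _ _ _ _ d t 1 _ kd.
have d1 := @is_derive1_comp _ npdf1 _ t _ _ (is_derive_npdf1 _) dk.
have d2 := @is_deriveX _ _ (fun t => (Num.sqrt t)^-1) 2 t 1 _ kd.
have := is_deriveM d1 d2; rewrite !scaleRE /=.
have -> // : npdf1 (d * k) * (2 * k ^+ 1 * (- 2^-1 * k ^+ 3)) +
  k ^+ 2 * (npdf2 (d * k) * (d * (- 2^-1 * k ^+ 3))) =
  - (npdf1 u + 2^-1 * (u * npdf2 u)) * k ^+ 4.
by rewrite /u -/d; field.
Qed.

(** The time derivative is half of [heat2], whose own time derivative is at most [24 c0 / t^2],
    rounded up to 32; two mean value estimates follow. *)
Lemma heat_time b s t0 t1 t2 : 0 < t0 -> t0 <= t1 -> t1 <= t2 ->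
  `|heat b s t2 - heat b s t1 - 2^-1 * heat2 b s t1 * (t2 - t1)| <=
  32 * c0 * t0^-1 ^+ 2 * (t2 - t1) ^+ 2.
Proof.
move=> t0p t01 t12; have p z : t1 <= z -> 0 < z.
  by move=> h; apply: lt_le_trans h; apply: lt_le_trans t01.
pose D t := - (npdf1 ((b - s) * (Num.sqrt t)^-1) +
  2^-1 * ((b - s) * (Num.sqrt t)^-1 * npdf2 ((b - s) * (Num.sqrt t)^-1))) *
  (Num.sqrt t)^-1 ^+ 4.
have DB z : t1 <= z -> `|D z| <= 32 * c0 * t0^-1 ^+ 2.
  move=> zt; rewrite /D normrM ler_pM //.
    rewrite normrN (le_trans (ler_normD _ _)) //.
    have := npdf1_bound ((b - s) * (Num.sqrt z)^-1).
    have := u_npdf2_bound ((b - s) * (Num.sqrt z)^-1).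
    have c := normal_peak1_ge0.
    by rewrite (normrM 2^-1) ger0_norm //; lra.
  rewrite ger0_norm ?exprn_ge0 ?invr_ge0 ?sqrtr_ge0 //.
  have -> : (Num.sqrt z)^-1 ^+ 4 = z^-1 ^+ 2.
    by rewrite (exprM _ 2 2) exprVn sqr_sqrtr // ltW // p.
  have z0 := p _ zt; rewrite lerXn2r ?nnegrE ?invr_ge0 ?(ltW z0) ?(ltW t0p) //.
  by rewrite lef_pV2 ?posrE // (le_trans t01).
pose U t := heat b s t - (2^-1 * heat2 b s t1) * t.
have dU z : t1 <= z -> is_derive z 1 U (2^-1 * heat2 b s z - 2^-1 * heat2 b s t1).
  move=> zt; have := is_deriveB (is_derive_heat b s (p _ zt))
    (@is_deriveZ _ _ _ id (2^-1 * heat2 b s t1) z 1 _ (is_derive_id _ _)).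
  by rewrite scaleRE mulr1.
have := @lipschitz_of_derive _ U _ t1 t2 (32 * c0 * t0^-1 ^+ 2 * (t2 - t1)) t12 _ _.
rewrite (_ : 32 * c0 * t0^-1 ^+ 2 * (t2 - t1) * (t2 - t1) = 32 * c0 * t0^-1 ^+ 2 * (t2 - t1) ^+ 2); last by ring.
move=> H.
have -> : heat b s t2 - heat b s t1 - 2^-1 * heat2 b s t1 * (t2 - t1) = U t2 - U t1.
  by rewrite /U; ring.
apply: H => z /andP[z1 z2]; first exact: dU.
rewrite /= -mulrBr normrM ger0_norm //.
have H2 : `|heat2 b s z - heat2 b s t1| <= 32 * c0 * t0^-1 ^+ 2 * (z - t1).
  apply: (@lipschitz_of_derive _ _ D) => // w /andP[w1 w2]; last exact: DB.
  exact: is_derive_heat2 (p _ w1).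
have c : 0 <= 32 * c0 * t0^-1 ^+ 2.
  by rewrite !mulr_ge0 ?normal_peak1_ge0 ?exprn_ge0 ?invr_ge0 ?ltW.
have : 32 * c0 * t0^-1 ^+ 2 * (z - t1) <= 32 * c0 * t0^-1 ^+ 2 * (t2 - t1).
  by rewrite ler_wpM2l // lerD2r.
have := normr_ge0 (heat2 b s z - heat2 b s t1); lra.
Qed.

(** Both values after the jump are expanded around [s] at time [t - v]. The first-order terms cancel
    because the jump is centred; the second-order terms give [v / 2] times the second space
    derivative, which by the heat equation is the first-order change from [t - v] to [t]. What
    remains is bounded by [|x| * v], and the factor [|x|] is the gain from small increments. *)
Lemma heat_step b t0 : 0 < t0 -> exists2 C, 0 <= C & forall s t x q,
  0 <= q <= 1 -> `|x| <= 1 -> t0 <= t - x ^+ 2 * (q * (1 - q)) ->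
  `|q * heat b (s + x * (1 - q)) (t - x ^+ 2 * (q * (1 - q))) +
    (1 - q) * heat b (s + x * (0 - q)) (t - x ^+ 2 * (q * (1 - q))) - heat b s t|
  <= C * `|x| * (x ^+ 2 * (q * (1 - q))).
Proof.
move=> t0p; have cp := normal_peak1_ge0.
pose k0 := (Num.sqrt t0)^-1; have k0p : 0 <= k0 by rewrite invr_ge0 sqrtr_ge0.
exists (16 * c0 * k0 ^+ 3 + 32 * c0 * t0^-1 ^+ 2).
  by rewrite addr_ge0 // !mulr_ge0 ?exprn_ge0 ?invr_ge0 ?(ltW t0p).
move=> s t x q /andP[q0 q1] x1; set v := x ^+ 2 * (q * (1 - q)) => tv.
have v0 : 0 <= v by rewrite mulr_ge0 ?sqr_ge0 // mulr_ge0 // subr_ge0.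
set k := (Num.sqrt (t - v))^-1.
have kk : 0 <= k <= k0.
  rewrite invr_ge0 sqrtr_ge0 /= lef_pV2 ?posrE ?sqrtr_gt0 ?ler_wsqrtr //.
  exact: lt_le_trans tv.
have /andP[kp kk0] := kk.
have T1 := heat_taylor b k s (x * (1 - q)).
have T2 := heat_taylor b k s (x * (0 - q)).
have T3 := @heat_time b s t0 (t - v) t t0p tv (_ : t - v <= t).
move: T3 => /(_ ltac:(by rewrite gerBl)).
rewrite subKr /heat2 /heat -/k.
set f0 := ncdf ((b - s) * k) in T1 T2 *; set f1 := npdf _ in T1 T2.
set f2 := npdf1 _ in T1 T2 *.
set fp := ncdf ((b - (s + x * (1 - q))) * k) in T1 *.
set fm := ncdf ((b - (s + x * (0 - q))) * k) in T2 *.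
set ft := ncdf ((b - s) * (Num.sqrt t)^-1) => T3.
set E1 := (X in `|X|) in T1; set E2 := (X in `|X|) in T2; set E3 := (X in `|X|) in T3.
(* Uses [q (1 - q) + (1 - q) (0 - q) = 0] and [q (1 - q)^2 + (1 - q) q^2 = q (1 - q)]. *)
have -> : q * fp + (1 - q) * fm - ft = q * E1 + (1 - q) * E2 - E3.
  by rewrite /E1 /E2 /E3 /v; field.
apply: le_trans (ler_normB _ _) _.
rewrite [leRHS](_ : _ = 16 * c0 * k0 ^+ 3 * `|x| * v + 32 * c0 * t0^-1 ^+ 2 * `|x| * v); last by ring.
apply: lerD; last first.
  apply: le_trans T3 _; rewrite -[leRHS]mulrA ler_wpM2l ?mulr_ge0 ?exprn_ge0 ?invr_ge0 ?(ltW t0p) //.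
  rewrite expr2 ler_wpM2r // /v.
  have : x ^+ 2 <= `|x|.
    by rewrite -real_normK ?num_real // expr2 -[leRHS]mulr1 ler_wpM2l.
  have x2 := sqr_ge0 x.
  have : q * (1 - q) <= 1 by nra.
  nra.
apply: le_trans (ler_normD _ _) _.
rewrite !normrM (ger0_norm q0) (@ger0_norm _ (1 - q)) ?subr_ge0 // in T1 T2 *.
rewrite (ger0_norm kp) in T1.
rewrite (ger0_norm kp) sub0r normrN (ger0_norm q0) in T2.
have M0 : 0 <= 16 * c0 * k ^+ 3 by rewrite !mulr_ge0 ?exprn_ge0.
apply: (@le_trans _ _ (16 * c0 * k ^+ 3 * `|x| * v)); last first.
  do 2 rewrite ler_wpM2r //.
  by rewrite ler_wpM2l ?mulr_ge0 // lerXn2r ?nnegrE.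
have -> : v = `|x| ^+ 2 * (q * (1 - q)) by rewrite real_normK ?num_real.
have e1 := ler_wpM2l q0 T1.
have q1' : 0 <= 1 - q by rewrite subr_ge0.
have e2 := ler_wpM2l q1' T2.
apply: le_trans (lerD e1 e2) _.
set M := 16 * c0 * k ^+ 3 in M0 *; set y := `|x|.
have -> : q * (M * (y * (1 - q)) ^+ 3) + (1 - q) * (M * (y * q) ^+ 3) =
  (M * y * (y ^+ 2 * (q * (1 - q)))) * ((1 - q) ^+ 2 + q ^+ 2) by ring.
have y0 : 0 <= y by rewrite /y.
rewrite -[leRHS]mulr1 ler_wpM2l //; last by nra.
by repeat apply: mulr_ge0.
Qed.

End HeatFlow.

(** * Normal limit of bounded-increment martingales *)

Lemma ler_normB01 (R : realDomainType) (u v : R) : 0 <= u <= 1 -> 0 <= v <= 1 -> `|u - v| <= 1.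
Proof. by move=> /andP[? ?] /andP[? ?]; rewrite ler_norml; apply/andP; split; lra. Qed.

(** [a1], [a2], [a3], [a4] are the smoothed distribution functions at [b + k], [- (b + k)], [b - k],
    [- (b - k)]; [F], [Fp], [Fm] are the normal values at [b], [b + k], [b - k]; [s] is the
    probability that the smoothing noise exceeds the margin [k]. *)
Lemma normal_sandwich (R : realFieldType) (P a1 a2 a3 a4 F Fp Fm s t eta : R) :
  `|a1 - Fp| <= eta / 16 + eta / 8 -> `|a2 - (1 - Fp)| <= eta / 16 + eta / 8 ->
  `|a3 - Fm| <= eta / 16 + eta / 8 -> `|a4 - (1 - Fm)| <= eta / 16 + eta / 8 ->
  `|Fp - F| <= t -> `|Fm - F| <= t -> t <= eta / 8 -> s <= eta / 16 ->
  P <= a1 - a2 + 2 * s -> a3 - a4 - 2 * s <= P -> `|P - (2 * F - 1)| <= eta.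
Proof.
rewrite !ler_norml => /andP[_ h1] /andP[h2 _] /andP[h3 _] /andP[_ h4] /andP[_ h5] /andP[h6 _].
by move=> h7 h8 h9 h10; apply/andP; split; lra.
Qed.

Lemma ler_sum4 (R : realDomainType) (a b c d : R) : 0 <= a -> 0 <= b -> 0 <= c -> 0 <= d ->
  [/\ a <= a + b + c + d, b <= a + b + c + d, c <= a + b + c + d & d <= a + b + c + d].
Proof. by move=> *; split; lra. Qed.

Section NormalLimit.
Variable R : realType.
Implicit Types (b s t u x y k e q C : R).
Local Notation npdf := (@npdf R).
Local Notation ncdf := (@ncdf R).
Local Notation c0 := (normal_peak (1 : R)).

Lemma ncdf_lipschitz x y : `|ncdf y - ncdf x| <= c0 * `|y - x|.
Proof.
apply: lipschitz_of_deriveT; first exact: is_derive_ncdf.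
move=> z; rewrite ger0_norm ?(ltW (npdf_gt0 _)) //.
by apply: normal_pdf_ub; rewrite oner_eq0.
Qed.

Lemma heat01 b s t : 0 <= heat b s t <= 1.
Proof. by rewrite ncdf_ge0 ncdf_le1. Qed.

Lemma heat_lipschitz b s t0 t t' : 0 < t0 -> t0 <= t -> t0 <= t' ->
  `|heat b s t - heat b s t'| <= 8 * c0 * t0^-1 * `|t - t'|.
Proof.
move=> t0p; wlog tt' : t t' / t <= t'.
  move=> H; have [|/ltW h h1 h2] := leP t t'; first exact: H.
  by rewrite distrC (distrC t); apply: H.
move=> t0t _; rewrite distrC (distrC t) (@ger0_norm _ (t' - t)) ?subr_ge0 //.
have p z : t <= z -> 0 < z by move=> h; rewrite (lt_le_trans t0p) // (le_trans t0t).
apply: (@lipschitz_of_derive _ _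
  (fun t => 2^-1 * (npdf1 ((b - s) * (Num.sqrt t)^-1) * (Num.sqrt t)^-1 ^+ 2))) => //.
  by move=> z /andP[z1 _]; apply: is_derive_heat; apply: p.
move=> z /andP[z1 _]; have z0 := p _ z1.
rewrite exprVn sqr_sqrtr ?(ltW z0) // !normrM (@ger0_norm _ (z^-1)) ?invr_ge0 ?(ltW z0) //.
rewrite (@ger0_norm _ 2^-1) ?invr_ge0 // [leLHS]mulrA ler_pM ?mulr_ge0 ?invr_ge0 ?(ltW z0) //.
  have := npdf1_bound ((b - s) / Num.sqrt z); lra.
by rewrite lef_pV2 ?posrE // (le_trans t0t).
Qed.

(** Probability that [x] plus a centred normal noise of standard deviation [e] falls between [- b]
    and [b]. *)
Definition smoothed b e x := ncdf ((b - x) / e) - ncdf ((- b - x) / e).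

Let cdf_mono e k x : 0 < e -> k <= x -> ncdf (k / e) <= ncdf (x / e).
Proof. by move=> e0 kx; apply: ncdf_le; rewrite ler_pM2r ?invr_gt0. Qed.

Let cdfN e k : ncdf ((- k) / e) = 1 - ncdf (k / e).
Proof. by rewrite mulNr ncdfN. Qed.

(** The margin [k] is lost only if the noise exceeds it on one of the two sides, which costs
    [1 - ncdf (k / e)] each. *)
Lemma smoothed_upper b e k x : 0 < e -> 0 <= b -> 0 <= k ->
  (`|x| <= b)%R%:R <= smoothed (b + k) e x + 2 * (1 - ncdf (k / e)).
Proof.
move=> e0 b0 k0; have h1 := ncdf_le1 (k / e); rewrite /smoothed.
case: (leP `|x| b) => xb.
  rewrite ler_norml in xb; move/andP: xb => [x1 x2].
  have a1 := @cdf_mono e k (b + k - x) e0 ltac:(lra).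
  have a2 := @cdf_mono e (- (b + k) - x) (- k) e0 ltac:(lra).
  by rewrite cdfN in a2; rewrite /=; lra.
have a := @cdf_mono e (- (b + k) - x) (b + k - x) e0 ltac:(lra).
by rewrite /=; lra.
Qed.

Lemma smoothed_lower b e k x : 0 < e ->
  smoothed (b - k) e x - 2 * (1 - ncdf (k / e)) <= (`|x| <= b)%R%:R.
Proof.
move=> e0; have h1 := ncdf_le1 (k / e); rewrite /smoothed.
have g1 := ncdf_le1 ((b - k - x) / e); have g2 := ncdf_ge0 ((- (b - k) - x) / e).
case: (leP `|x| b) => xb; first by rewrite /=; lra.
rewrite lter_normr in xb; move/orP: xb => [xb|xb].
  have a := @cdf_mono e (b - k - x) (- k) e0 ltac:(lra).
  by rewrite cdfN in a; rewrite /=; lra.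
have a := @cdf_mono e k (- (b - k) - x) e0 ltac:(lra).
by rewrite /=; lra.
Qed.

Section OneArray.
Variables (K : finType) (p : K -> R) (r : K -> nat) (a : K -> {ffun K -> bool} -> R).
Hypothesis p01 : forall c, 0 <= p c <= 1.
Hypothesis r_inj : injective r.
Hypothesis a_pred : predictable r a.
Variables (rho : R).
Hypothesis rho1 : rho <= 1.
Hypothesis a_small : forall c o, `|a c o| <= rho.
Hypothesis bracket_near1 : Ex p (fun o => `|bracket p a o - 1|) <= rho.

Let X := martingale p a.

(** The flow is run with total time [1 + e^2], so that a clock near 1 leaves a time near [e^2].
    Truncating the clock at [1 + e^2 / 2] keeps the remaining time away from 0, where the
    derivatives of the flow blow up. *)
Lemma heat_martingale_limit b e C : 0 < e -> 0 <= C ->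
  (forall s t x q, 0 <= q <= 1 -> `|x| <= 1 -> e ^+ 2 / 2 <= t - x ^+ 2 * (q * (1 - q)) ->
    `|q * heat b (s + x * (1 - q)) (t - x ^+ 2 * (q * (1 - q))) +
      (1 - q) * heat b (s + x * (0 - q)) (t - x ^+ 2 * (q * (1 - q))) - heat b s t|
    <= C * `|x| * (x ^+ 2 * (q * (1 - q)))) ->
  `|Ex p (fun o => heat b (X o) (e ^+ 2)) - heat b 0 (1 + e ^+ 2)| <=
  (C * (1 + e ^+ 2) + (8 * c0 * 2 + 2) * (e ^+ 2)^-1) * rho.
Proof.
move=> e0 C0 Hstep; have e20 : 0 < e ^+ 2 by rewrite exprn_gt0.
have rho0 : 0 <= rho.
  by apply: le_trans bracket_near1; apply: Ex_ge0 => // o.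
pose cap := 1 + e ^+ 2 / 2.
have cap0 : 0 <= cap by rewrite addr_ge0 // divr_ge0 // ltW.
pose a' := trunc p r a cap.
pose phi s w := heat b s (1 + e ^+ 2 - w).
have L : `|Ex p (fun o => phi (martingale p a' o) (bracket p a' o)) - phi 0 0|
    <= C * rho * cap.
  apply: (@lindeberg_telescope _ _ p p01 r r_inj a' _ phi rho cap).
  - exact: trunc_predictable.
  - by rewrite mulr_ge0.
  - move=> s w x q q01 xr w0 wcap; rewrite /phi opprD addrA.
    apply: le_trans (Hstep _ _ _ _ q01 (le_trans xr rho1) _) _.
      by move: wcap; rewrite /cap; lra.
    have v0 : 0 <= x ^+ 2 * (q * (1 - q)).
      by move/andP: q01 => [q0 q1]; rewrite mulr_ge0 ?sqr_ge0 // mulr_ge0 // subr_ge0.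
    by rewrite ler_wpM2r // ler_wpM2l.
  - by move=> c o; apply: le_trans (trunc_norm _ _ _ _ _ _) (a_small _ _).
  - by move=> o; apply: bracket_trunc.
(* The first term is the Lipschitz constant of the flow in time, for the error in the clock; the
   second is Markov's inequality for the event that the bracket exceeds [cap]. *)
pose B := 8 * c0 * (e ^+ 2 / 2)^-1 + (e ^+ 2 / 2)^-1.
have cp := normal_peak1_ge0 R.
have D : `|Ex p (fun o => heat b (X o) (e ^+ 2)) -
          Ex p (fun o => phi (martingale p a' o) (bracket p a' o))| <= B * rho.
  rewrite -ExB; apply: le_trans (Ex_norm p01 _) _.
  apply: (@le_trans _ _ (B * Ex p (fun o => `|bracket p a o - 1|))); last first.
    by rewrite ler_wpM2l // addr_ge0 // ?mulr_ge0 ?invr_ge0 ?divr_ge0 // ltW.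
  rewrite -ExZ; apply: ler_Ex => // o.
  have [le|gt] := leP (bracket p a o) cap.
    have -> : martingale p a' o = X o.
      by apply: eq_bigr => c _; rewrite /a' (trunc_id r p01 le).
    have -> : bracket p a' o = bracket p a o.
      by apply: eq_bigr => c _; rewrite /a' (trunc_id r p01 le).
    rewrite /phi; have t0 : 0 < e ^+ 2 / 2 by rewrite divr_gt0.
    apply: le_trans (heat_lipschitz _ _ t0 _ _) _; [lra|by move: le; rewrite /cap; lra|].
    rewrite (_ : e ^+ 2 - (1 + e ^+ 2 - bracket p a o) = bracket p a o - 1); last by ring.
    by rewrite ler_wpM2r // lerDl invr_ge0 ltW.
  have h1 := heat01 b (X o) (e ^+ 2).
  have h2 := heat01 b (martingale p a' o) (1 + e ^+ 2 - bracket p a' o).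
  apply: (@le_trans _ _ 1).
    exact: ler_normB01.
  have g : e ^+ 2 / 2 <= `|bracket p a o - 1|.
    by rewrite ler_normr; move: gt; rewrite /cap => gt; apply/orP; left; lra.
  apply: (@le_trans _ _ ((e ^+ 2 / 2)^-1 * (e ^+ 2 / 2))).
    by rewrite mulVf // gt_eqF ?divr_gt0.
  rewrite /B mulrDl; apply: (@le_trans _ _ ((e ^+ 2 / 2)^-1 * `|bracket p a o - 1|)).
    by rewrite ler_wpM2l // invr_ge0 divr_ge0 // ltW.
  by rewrite lerDr !mulr_ge0 // invr_ge0 divr_ge0 // ltW.
have -> : Ex p (fun o => heat b (X o) (e ^+ 2)) - heat b 0 (1 + e ^+ 2) =
  (Ex p (fun o => heat b (X o) (e ^+ 2)) -
          Ex p (fun o => phi (martingale p a' o) (bracket p a' o))) +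
  (Ex p (fun o => phi (martingale p a' o) (bracket p a' o)) - phi 0 0).
  by rewrite /phi subr0 addrA subrK.
apply: le_trans (ler_normD _ _) _; apply: le_trans (lerD D L) _.
have : C * rho * cap <= C * (1 + e ^+ 2) * rho.
  rewrite -!mulrA ler_wpM2l // mulrC ler_wpM2r // /cap; lra.
have -> : B * rho = (8 * c0 * 2 + 2) * (e ^+ 2)^-1 * rho.
  by rewrite /B; field; rewrite gt_eqF.
by rewrite mulrDl; lra.
Qed.

End OneArray.

Lemma rsqrt_near1 e : 0 < e -> 1 - e ^+ 2 <= (Num.sqrt (1 + e ^+ 2))^-1 <= 1.
Proof.
move=> e0; have e2 : 0 < e ^+ 2 by rewrite exprn_gt0.
have s1 : 1 <= Num.sqrt (1 + e ^+ 2).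
  by rewrite -[leLHS]sqrtr1 ler_wsqrtr // lerDl ltW.
have s2 : Num.sqrt (1 + e ^+ 2) <= 1 + e ^+ 2.
  have := sqr_sqrtr (_ : 0 <= 1 + e ^+ 2) => /(_ ltac:(lra)); nra.
have s0 : 0 < Num.sqrt (1 + e ^+ 2) by lra.
rewrite invf_le1 // s1 andbT -[leRHS]mul1r ler_pdivlMr //.
nra.
Qed.

(** [rho] is fixed before the product space, so the statement applies to arrays whose cells, ranks
    and probabilities all vary. The indicator of [|x| <= b] is squeezed between smoothed indicators
    at [b - k] and [b + k]. *)
Theorem martingale_normal_limit b eta : 0 < b -> 0 < eta ->
  exists2 rho, 0 < rho & forall (K : finType) (p : K -> R) (r : K -> nat)
    (a : K -> {ffun K -> bool} -> R),
  (forall c, 0 <= p c <= 1) -> injective r -> predictable r a ->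
  (forall c o, `|a c o| <= rho) ->
  Ex p (fun o => `|bracket p a o - 1|) <= rho ->
  `|Ex p (fun o => (`|martingale p a o| <= b)%R%:R) - (2 * ncdf b - 1)| <= eta.
Proof.
move=> b0 eta0; have cp := normal_peak1_ge0 R.
have cp1 : 0 < c0 + 1 by rewrite ltr_wpDl.
(* Over this margin [ncdf] varies by at most [eta / 8], and [b - k] stays positive. *)
pose k := Num.min (b / 2) (eta / (8 * (c0 + 1))).
have k0 : 0 < k by rewrite lt_min !divr_gt0 // mulr_gt0.
have kb : k <= b / 2 by rewrite ge_min lexx.
have bp : `|b + k| <= 2 * b by rewrite ger0_norm; lra.
have bm : `|b - k| <= 2 * b by rewrite ger0_norm; lra.
have keta : c0 * k <= eta / 8.
  apply: (@le_trans _ _ ((c0 + 1) * k)); first by rewrite ler_wpM2r ?lerDl // ltW.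
  rewrite -ler_pdivlMl // (_ : _^-1 * _ = eta / (8 * (c0 + 1))) ?ge_min ?lexx ?orbT //.
  by field; rewrite gt_eqF.
(* The noise must be small against the margin [k], and [e^2] small enough to replace the variance
   [1 + e^2] by 1. *)
have [e e0 [ek eb]] : exists2 e, 0 < e & 1 - ncdf (k / e) <= eta / 16 /\
    c0 * (2 * b) * e ^+ 2 <= eta / 8.
  have [M [_ HM]] : \forall x \near +oo, 1 - ncdf x <= eta / 16.
    have /cvgr_dist_le := @ncdf_cvgy R => /(_ (eta / 16) ltac:(lra)).
    by apply: filterS => x; rewrite ler_norml => /andP[].
  have M1 : 0 < `|M| + 1 by rewrite ltr_wpDl.
  have D0 : 0 < 16 * ((c0 + 1) * b) by rewrite !mulr_gt0.
  pose e := Num.min (k / (`|M| + 1)) (Num.min 1 (eta / (16 * ((c0 + 1) * b)))).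
  have e0 : 0 < e by rewrite !lt_min ltr01 !divr_gt0.
  exists e => //; split.
    apply: HM; rewrite ltr_pdivlMr //.
    apply: (@le_lt_trans _ _ (`|M| * e)); first by rewrite ler_wpM2r ?ler_norm // ltW.
    apply: (@lt_le_trans _ _ ((`|M| + 1) * e)); first by rewrite ltr_pM2r // ltrDl.
    by rewrite -ler_pdivlMl // mulrC ge_min lexx.
  have e1 : e <= 1 by rewrite !ge_min lexx orbT.
  have e2 : e <= eta / (16 * ((c0 + 1) * b)) by rewrite !ge_min lexx !orbT.
  apply: (@le_trans _ _ ((c0 + 1) * (2 * b) * e)).
    have : e ^+ 2 <= e by rewrite expr2 ler_piMr // ltW.
    have : 0 <= c0 * (2 * b) by rewrite mulr_ge0 // mulr_ge0 // ltW.
    have : 0 <= (2 * b) by rewrite mulr_ge0 // ltW.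
    nra.
  rewrite -ler_pdivlMl ?mulr_gt0 //.
  rewrite (_ : _^-1 * _ = eta / (16 * ((c0 + 1) * b))) //.
  by field; rewrite !gt_eqF.
have e20 : 0 < e ^+ 2 / 2 by rewrite divr_gt0 // exprn_gt0.
have [Cup Cup0 Hup] := @heat_step _ (b + k) _ e20.
have [Cun Cun0 Hun] := @heat_step _ (- (b + k)) _ e20.
have [Clp Clp0 Hlp] := @heat_step _ (b - k) _ e20.
have [Cln Cln0 Hln] := @heat_step _ (- (b - k)) _ e20.
(* One constant serves the four levels at which the flow is used. *)
pose C := Cup + Cun + Clp + Cln.
have [Wup Wun Wlp Wln] := ler_sum4 Cup0 Cun0 Clp0 Cln0.
have C0 : 0 <= C by rewrite !addr_ge0.
have weaken bb C' : 0 <= C' -> C' <= C ->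
   (forall s t x q, 0 <= q <= 1 -> `|x| <= 1 -> e ^+ 2 / 2 <= t - x ^+ 2 * (q * (1 - q)) ->
    `|q * heat bb (s + x * (1 - q)) (t - x ^+ 2 * (q * (1 - q))) +
      (1 - q) * heat bb (s + x * (0 - q)) (t - x ^+ 2 * (q * (1 - q))) - heat bb s t|
    <= C' * `|x| * (x ^+ 2 * (q * (1 - q)))) ->
  (forall s t x q, 0 <= q <= 1 -> `|x| <= 1 -> e ^+ 2 / 2 <= t - x ^+ 2 * (q * (1 - q)) ->
    `|q * heat bb (s + x * (1 - q)) (t - x ^+ 2 * (q * (1 - q))) +
      (1 - q) * heat bb (s + x * (0 - q)) (t - x ^+ 2 * (q * (1 - q))) - heat bb s t|
    <= C * `|x| * (x ^+ 2 * (q * (1 - q)))).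
  move=> C'0 CC H s t x q q01 x1 ht; apply: le_trans (H _ _ _ _ q01 x1 ht) _.
  have v0 : 0 <= x ^+ 2 * (q * (1 - q)).
    by move/andP: q01 => [q0 q1]; rewrite mulr_ge0 ?sqr_ge0 // mulr_ge0 // subr_ge0.
  by do 2 rewrite ler_wpM2r //.
have {}Hup := weaken _ _ Cup0 Wup Hup.
have {}Hun := weaken _ _ Cun0 Wun Hun.
have {}Hlp := weaken _ _ Clp0 Wlp Hlp.
have {}Hln := weaken _ _ Cln0 Wln Hln.
pose M := C * (1 + e ^+ 2) + (8 * c0 * 2 + 2) * (e ^+ 2)^-1.
have M0 : 0 <= M.
  by rewrite addr_ge0 // mulr_ge0 // ?addr_ge0 ?invr_ge0 ?sqr_ge0 // !mulr_ge0.
pose rho := Num.min 1 (eta / (16 * (M + 1))).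
have rho0 : 0 < rho by rewrite lt_min ltr01 divr_gt0 // mulr_gt0 // ltr_wpDl.
have rho1 : rho <= 1 by rewrite ge_min lexx.
have Mrho : M * rho <= eta / 16.
  have M1 : 0 < M + 1 by rewrite ltr_wpDl.
  apply: (@le_trans _ _ ((M + 1) * rho)); first by rewrite ler_wpM2r ?lerDl // ltW.
  rewrite -ler_pdivlMl // (_ : _^-1 * _ = eta / (16 * (M + 1))) ?ge_min ?lexx ?orbT //.
  by field; rewrite gt_eqF.
exists rho => // K p r a p01 r_inj a_pred a_small near1.
have lim bb : (forall s t x q, 0 <= q <= 1 -> `|x| <= 1 -> e ^+ 2 / 2 <= t - x ^+ 2 * (q * (1 - q)) ->
    `|q * heat bb (s + x * (1 - q)) (t - x ^+ 2 * (q * (1 - q))) +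
      (1 - q) * heat bb (s + x * (0 - q)) (t - x ^+ 2 * (q * (1 - q))) - heat bb s t|
    <= C * `|x| * (x ^+ 2 * (q * (1 - q)))) -> `|bb| <= 2 * b ->
   `|Ex p (fun o => ncdf ((bb - martingale p a o) / e)) - ncdf bb| <= eta / 16 + eta / 8.
  move=> H bb2; have := heat_martingale_limit p01 r_inj a_pred rho1 a_small near1 e0 C0 H.
  rewrite -/M; set h0 := heat bb 0 _ => H1.
  have H2 : `|h0 - ncdf bb| <= eta / 8.
    rewrite /h0 /heat subr0; apply: le_trans (ncdf_lipschitz _ _) _.
    apply: le_trans eb; rewrite -mulrA ler_wpM2l //.
    rewrite (_ : _ - bb = bb * ((Num.sqrt (1 + e ^+ 2))^-1 - 1)); last by ring.
    rewrite normrM ler_pM //.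
    have /andP[s1 s2] := rsqrt_near1 e0.
    by rewrite ler_norml; have := sqr_ge0 e; lra.
  rewrite (_ : Ex p (fun o => ncdf ((bb - martingale p a o) / e)) =
     Ex p (fun o => heat bb (martingale p a o) (e ^+ 2))); last first.
    by apply: Ex_ext => o; rewrite /heat sqrtr_sqr gtr0_norm.
  have -> : forall z, z - ncdf bb = (z - h0) + (h0 - ncdf bb) by move=> z; ring.
  apply: le_trans (ler_normD _ _) _; apply: lerD => //.
  exact: le_trans Mrho.
have {}Hup := lim _ Hup bp.
have {}Hun := lim _ Hun ltac:(by rewrite normrN).
have {}Hlp := lim _ Hlp bm.
have {}Hln := lim _ Hln ltac:(by rewrite normrN).
have up : Ex p (fun o => (`|martingale p a o| <= b)%R%:R) <=
    Ex p (fun o => smoothed (b + k) e (martingale p a o)) + 2 * (1 - ncdf (k / e)).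
  rewrite -[X in _ + X](Ex_cst p) -ExD; apply: ler_Ex => // o.
  by apply: smoothed_upper => //; exact: ltW.
have lo : Ex p (fun o => smoothed (b - k) e (martingale p a o)) - 2 * (1 - ncdf (k / e))
    <= Ex p (fun o => (`|martingale p a o| <= b)%R%:R).
  rewrite -[X in _ - X](Ex_cst p) -ExB; apply: ler_Ex => // o.
  exact: smoothed_lower.
rewrite /smoothed ExB in up; rewrite /smoothed ExB in lo.
rewrite ncdfN in Hun; rewrite ncdfN in Hln.
have Lp := ncdf_lipschitz b (b + k); have Ln := ncdf_lipschitz b (b - k).
rewrite addrAC subrr add0r (ger0_norm (ltW k0)) in Lp.
rewrite addrAC subrr add0r normrN (ger0_norm (ltW k0)) in Ln.
exact: normal_sandwich Hup Hun Hlp Hln Lp Ln keta ek up lo.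
Qed.

End NormalLimit.

(** * Sieves *)

(* A cell is [opened] when no cell below it is occupied; as [cbelow] decreases the
   rank, this is predictable when the cells are revealed in increasing rank. *)
Record sieve (R : realType) := Sieve {
  cell : finType;
  cprob : cell -> R;
  crank : cell -> nat;
  cbelow : cell -> {set cell};
  cweight : cell -> R;
  cprob01 : forall c, 0 <= cprob c <= 1;
  crank_inj : injective crank;
  cbelow_rank : forall c c', c' \in cbelow c -> (crank c' < crank c)%N
}.

Section SieveTheory.
Variables (R : realType) (S : sieve R).
Local Notation config := {ffun cell S -> bool}.
Implicit Types (c : cell S) (o : config).
Local Notation p := (@cprob R S).
Local Notation w := (@cweight R S).

Definition opened c o : bool := [forall c' in cbelow c, ~~ o c'].

Definition scoef c o : R := (opened c o)%:R * w c.

Definition smart : config -> R := martingale p scoef.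
Definition sbrac : config -> R := bracket p scoef.
(** The occupation itself is summed, uncentred: only this quantity is observable. *)
Definition squad o : R := \sum_c (opened c o)%:R * w c ^+ 2 * (o c)%:R.

Lemma opened_indep c c' : (crank c <= crank c')%N ->
  forall o v, opened c (upd o c' v) = opened c o.
Proof.
move=> cc' o v; apply: eq_forallb_in => d /cbelow_rank dc.
by rewrite upd_neq //; apply: contraTneq dc => ->; rewrite -leqNgt.
Qed.

Lemma scoef_predictable : predictable (@crank R S) scoef.
Proof. by move=> c c' cc' o v; rewrite /scoef opened_indep. Qed.

Lemma opened_sqr c o : ((opened c o)%:R : R) ^+ 2 = (opened c o)%:R.
Proof. by case: opened; rewrite ?expr1n ?expr0n. Qed.

Let p0 c : 0 <= p c. Proof. by have /andP[] := cprob01 c. Qed.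
Let p1 c : 0 <= 1 - p c. Proof. by rewrite subr_ge0; have /andP[] := cprob01 c. Qed.

Lemma Ex_smart_sqr : Ex p (fun o => smart o ^+ 2) = Ex p sbrac.
Proof.
apply: Ex_martingale_sqr; [exact: crank_inj|exact: scoef_predictable].
Qed.

(** Since [p = p (1 - p) + p^2], [squad] is the bracket, plus a martingale with coefficients
    [opened * w^2], plus a remainder of at most [kappa]. The martingale has variance at most [M^2]
    times the mean bracket; the factor 3 comes from squaring a sum of three terms. *)
Lemma squad_dev (M kappa : R) : (forall c, `|w c| <= M) ->
  \sum_c w c ^+ 2 * p c ^+ 2 <= kappa -> kappa <= 1 ->
  Ex p (fun o => (squad o - Ex p sbrac) ^+ 2) <=
  3 * (M ^+ 2 * Ex p sbrac + 1 + Ex p (fun o => (sbrac o - Ex p sbrac) ^+ 2)).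
Proof.
move=> wM small kappa1; set s2 := Ex p sbrac.
pose a c o := (opened c o)%:R * w c ^+ 2.
pose comp o := \sum_c (opened c o)%:R * w c ^+ 2 * p c ^+ 2.
have a_pred : predictable (@crank R S) a by move=> c c' cc' o v; rewrite /a opened_indep.
have E1 : Ex p (fun o => martingale p a o ^+ 2) <= M ^+ 2 * s2.
  rewrite (Ex_martingale_sqr _ (@crank_inj R S) a_pred).
  rewrite -ExZ; apply: ler_Ex => [|o]; first exact: cprob01.
  rewrite mulr_sumr; apply: ler_sum => c _.
  rewrite /a /scoef !exprMn opened_sqr [leRHS]mulrA ler_wpM2r ?mulr_ge0 ?p0 ?p1 //.
  rewrite [leRHS]mulrCA ler_wpM2l // ler_wpM2r ?sqr_ge0 //.
  by rewrite -real_normK ?num_real // lerXn2r ?nnegrE // (le_trans _ (wM c)).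
have decomp o : squad o - s2 = martingale p a o + comp o + (sbrac o - s2).
  rewrite addrA; congr (_ - _).
  rewrite /squad /martingale /comp /sbrac /bracket -!big_split /=.
  apply: eq_bigr => c _; rewrite /a /scoef exprMn opened_sqr; ring.
have comp0 o : 0 <= comp o by apply: sumr_ge0 => c _; rewrite mulr_ge0 ?sqr_ge0 // mulr_ge0 ?sqr_ge0.
have comp1 o : comp o <= 1.
  apply: le_trans kappa1; apply: le_trans small; apply: ler_sum => c _.
  by rewrite ler_wpM2r ?sqr_ge0 // ler_piMl ?sqr_ge0 // lern1 leq_b1.
apply: (@le_trans _ _ (Ex p (fun o => 3 * (martingale p a o ^+ 2 + 1 + (sbrac o - s2) ^+ 2)))).
  apply: ler_Ex => [|o]; first exact: cprob01.
  rewrite decomp; set x := martingale _ _ _; set y := comp o; set z := _ - s2.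
  have y2 : y ^+ 2 <= 1 by rewrite expr_le1 ?comp0 ?comp1.
  have := sqr_ge0 (x - y); have := sqr_ge0 (x - z); have := sqr_ge0 (y - z).
  rewrite !sqrrB !sqrrD; nra.
rewrite ExZ !ExD Ex_cst.
by rewrite ler_wpM2l // !lerD.
Qed.

End SieveTheory.

(** * Transfer between a probability space and a sieve *)

Section Interface.
Context {R : realType} {d : measure_display} {T : measurableType d}.
Variable P : probability T R.
Implicit Types (S : sieve R).

Record sieve_law S (beta : T -> {ffun cell S -> bool}) : Prop := SieveLaw {
  beta_measurable : forall o, measurable [set t | beta t = o];
  beta_mass : forall o, P [set t | beta t = o] = (bmass (@cprob R S) o)%:E
}.

Section Law.
Variables (S : sieve R) (beta : T -> {ffun cell S -> bool}).
Hypothesis law : sieve_law beta.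

Lemma beta_preimage (A : pred {ffun cell S -> bool}) :
  [set t | A (beta t)] = \big[setU/set0]_(o | A o) [set t | beta t = o].
Proof.
apply/seteqP; split => [t At|t].
  by rewrite /= in At; rewrite (bigD1 (beta t)) //=; left.
elim/big_rec: _ => [//|o B Ao IH [/= bo|/IH //]].
by rewrite /= bo.
Qed.

Lemma beta_event_measurable (A : pred {ffun cell S -> bool}) :
  measurable [set t | A (beta t)].
Proof.
rewrite beta_preimage; apply: bigsetU_measurable => o _.
exact: beta_measurable law o.
Qed.

Lemma beta_integral (F : {ffun cell S -> bool} -> R) : (forall o, 0 <= F o) ->
  (\int[P]_t (F (beta t))%:E = (Ex (@cprob R S) F)%:E)%E.
Proof.
move=> F0.
have mb o : measurable [set t | beta t = o] by exact: beta_measurable law o.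
transitivity (\int[P]_t (\sum_o (F o)%:E * (\1_[set t | beta t = o] t)%:E))%E.
  apply: eq_integral => t _; rewrite (bigD1 (beta t)) //= big1 ?adde0.
    by rewrite indicE mem_set // mule1.
  by move=> o ob; rewrite indicE memNset ?mule0 //= => e; rewrite e eqxx in ob.
rewrite ge0_integral_sum //; last 2 first.
- by move=> o; apply/measurable_EFinP/measurable_funM.
- by move=> o t _; rewrite mule_ge0 ?lee_fin.
transitivity (\sum_o (bmass (@cprob R S) o * F o)%:E)%E; last by rewrite sumEFin.
apply: eq_bigr => o _.
rewrite ge0_integralZl //; last 2 first.
- by apply/measurable_EFinP; apply: measurable_indic; exact: mb.
- by rewrite lee_fin.
rewrite integral_indic // setIT [X in (_ * X)%E = _](beta_mass law).
by rewrite mulrC EFinM.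
Qed.

Lemma beta_event (A : pred {ffun cell S -> bool}) :
  P [set t | A (beta t)] = (Ex (@cprob R S) (fun o => (A o)%:R))%:E.
Proof.
rewrite -beta_integral //; rewrite -(setIT [set t | _]).
rewrite -integral_indic //; last exact: beta_event_measurable.
apply: eq_integral => t _; rewrite indicE; congr (_%:R%:E).
by case: (boolP (A (beta t))) => h; [rewrite mem_set|rewrite memNset //; apply/negP].
Qed.

End Law.

(** [Z] stands for [n] times the error of the estimator, which is close to minus the sieve
    martingale, and [Q] for [n^2] times its estimated variance. Nothing is asked of [Z] and [Q]
    outside [G]. *)
Record approximation S (beta : T -> {ffun cell S -> bool}) (G : set T)
    (Z Q : T -> R) (kappa : R) : Prop := Approximation {
  approx_law : sieve_law beta;
  approx_good : measurable G;
  approx_bad : (P (~` G) <= kappa%:E)%E;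
  approx_mart : forall t, G t -> `|Z t + smart (beta t)| <= kappa;
  approx_quad : forall t, G t -> `|Q t - squad (beta t)| <= kappa;
  approx_comp : \sum_c cweight c ^+ 2 * @cprob R S c ^+ 2 <= kappa
}.

Section OneLevel.
Variables (Z Q : T -> R).
Hypothesis mZ : measurable_fun setT Z.
Hypothesis mQ : measurable_fun setT Q.

(** Monotone convergence. The truncated square is bounded, so that the bad event of an approximation
    contributes at most [k * kappa] to its mean. *)
Lemma truncated_second_moment (c : R) :
  (c%:E < \int[P]_t (Z t ^+ 2)%:E)%E ->
  exists2 k : nat, (0 < k)%N & (c%:E < \int[P]_t (Num.min (Z t ^+ 2) k%:R)%:E)%E.
Proof.
move=> cZ.
pose f k t := (Num.min (Z t ^+ 2) k%:R)%:E.
have mf k : measurable_fun setT (f k).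
  apply/measurable_EFinP; apply: measurable_minr => //.
  exact: measurable_funX.
have f0 k t : (0 <= f k t)%E by rewrite lee_fin le_min sqr_ge0 /=.
have ndf t : nondecreasing_seq (f ^~ t).
  by move=> a b ab; rewrite lee_fin le_min !ge_min lexx /= ler_nat ab orbT.
have flim t : limn (f ^~ t) = (Z t ^+ 2)%:E.
  apply/cvg_lim => //; apply: cvg_near_cst.
  near=> k; rewrite /f; congr (_%:E); apply/eqP; rewrite eq_minl //.
  by near: k; exact: nbhs_infty_ger.
have := @cvg_monotone_convergence _ _ _ P setT measurableT f
  (fun k => mf k) (fun k t _ => f0 k t) (fun t _ => ndf t).
rewrite (_ : (fun x => limn (f ^~ x)) = (fun t => (Z t ^+ 2)%:E)); last first.
  by apply/funext => t; rewrite flim.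
move=> cv.
have [N _ HN] : \forall k \near \oo, (c%:E < \int[P]_t f k t)%E.
  have := cv _ (open_nbhs_nbhs (conj (@open_ereal_gt_ereal _ c%:E) cZ)).
  by [].
exists N.+1 => //; exact: HN (leqnSn N).
Unshelve. all: by end_near. Qed.

(** On [G], [|Z + smart| <= 1] gives [Z^2 <= 2 smart^2 + 2]; off [G] the truncated square
    contributes at most [k * kappa <= 1]. The mean of [smart^2] is the mean bracket. *)
Lemma bracket_lower_bound (c : R) (k : nat) S beta G kappa :
  (c%:E < \int[P]_t (Num.min (Z t ^+ 2) k%:R)%:E)%E ->
  @approximation S beta G Z Q kappa -> 0 <= kappa <= 1 -> k%:R * kappa <= 1 ->
  c <= 2 * Ex (@cprob R S) (@sbrac R S) + 3.
Proof.
move=> cZ ap /andP[kappa0 kappa1] kk; have law := approx_law ap.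
have mG := approx_good ap.
have mGc : measurable (~` G) by exact: measurableC.
rewrite -lee_fin; apply: le_trans (ltW cZ) _.
rewrite -Ex_smart_sqr.
pose F o := 2 * smart (o : {ffun cell S -> bool}) ^+ 2 + 2.
have F0 o : 0 <= F o by rewrite addr_ge0 // mulr_ge0 // sqr_ge0.
have -> : 2 * Ex (@cprob R S) (fun o => smart o ^+ 2) + 3 = Ex (@cprob R S) F + 1.
  rewrite /F ExD ExZ Ex_cst; ring.
have mF : measurable_fun setT (fun t => (F (beta t))%:E).
  have -> : (fun t => (F (beta t))%:E) =
    (fun t => \sum_o (F o)%:E * (\1_[set t | beta t = o] t)%:E)%E.
    apply/funext => t; rewrite (bigD1 (beta t)) //= big1 ?adde0.
      by rewrite indicE mem_set // mule1.
    by move=> o ob; rewrite indicE memNset ?mule0 //= => e; rewrite e eqxx in ob.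
  apply: emeasurable_sum => o; apply/measurable_EFinP/measurable_funM => //.
  by apply: measurable_indic; exact: beta_measurable law o.
have mI : measurable_fun setT (fun t => (k%:R * \1_(~` G) t : R)%:E).
  by apply/measurable_EFinP/measurable_funM => //; exact: measurable_indic.
apply: (@le_trans _ _ (\int[P]_t ((F (beta t))%:E + (k%:R * \1_(~` G) t)%:E))%E).
  apply: ge0_le_integral => //.
  - by move=> t _; rewrite lee_fin le_min sqr_ge0 /=.
  - by apply/measurable_EFinP; apply: measurable_minr => //; exact: measurable_funX.
  - exact: emeasurable_funD.
  move=> t _; rewrite -EFinD lee_fin indicE.
  have [Gt|nGt] := pselect (G t).
    rewrite memNset ?mulr0 ?addr0; last by move=> /(_ Gt).
    rewrite ge_min; apply/orP; left; have := approx_mart ap Gt.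
    set x := smart _ => h; have : `|Z t + x| <= 1 by apply: le_trans kappa1.
    rewrite ler_norml /F -/x => /andP[h1 h2].
    by have := sqr_ge0 (Z t + 2 * x); nra.
  rewrite mem_set // mulr1 ge_min; apply/orP; right.
  by rewrite lerDr.
rewrite ge0_integralD //; last by move=> t _; rewrite lee_fin.
rewrite (beta_integral law) // EFinD leeD2l //.
under eq_integral do rewrite EFinM.
rewrite ge0_integralZl //; last first.
  by apply/measurable_EFinP; exact: measurable_indic.
rewrite integral_indic // setIT.
apply: (@le_trans _ _ (k%:R%:E * kappa%:E)%E); last by rewrite -EFinM lee_fin.
by rewrite lee_wpmul2l ?lee_fin //; exact: approx_bad ap.
Qed.

End OneLevel.

End Interface.

(** * Studentized coverage for a single sieve *)

Section Studentized.
Variable R : realType.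
Implicit Types (q eta M x y z s theta : R).
Local Notation c0 := (normal_peak (1 : R)).
Local Notation ncdf := (@ncdf R).

(** [s] is large enough to absorb the errors: [kappa <= theta s^2 / 2] in the variance and
    [kappa <= q theta s / 4] in the martingale. Hence [sqrt Qt <= (1 + 3 theta / 4) s], and the last
    quarter of [theta] pays for [z + x]. *)
Lemma cover_upper q theta s x z Qt Qs kappa : 0 < q -> 0 < theta <= 4^-1 -> 0 < s ->
  0 <= kappa <= 1 -> 2 / theta <= s ^+ 2 -> 4 / (q * theta) <= s ->
  `|z + x| <= kappa -> `|Qt - Qs| <= kappa -> `|Qs - s ^+ 2| <= theta * s ^+ 2 ->
  `|z| <= q * Num.sqrt Qt -> `|x| <= q * (1 + theta) * s.
Proof.
move=> q0 /andP[th0 th1] s0 /andP[k0 k1] h1 h2 zx QQ Qs2 zq.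
have s2 : 0 < s ^+ 2 by rewrite exprn_gt0.
rewrite ler_pdivrMr // in h1; rewrite ler_pdivrMr ?mulr_gt0 // in h2.
have Qle : Qt <= ((1 + 3 / 4 * theta) * s) ^+ 2.
  move: QQ Qs2; rewrite !ler_norml => /andP[_ a] /andP[_ b].
  rewrite exprMn; have : (1 + 3 / 2 * theta) * s ^+ 2 <= (1 + 3 / 4 * theta) ^+ 2 * s ^+ 2.
    by rewrite ler_wpM2r ?ltW //; have := sqr_ge0 theta; nra.
  lra.
have sq : Num.sqrt Qt <= (1 + 3 / 4 * theta) * s.
  have p : 0 <= (1 + 3 / 4 * theta) * s by rewrite mulr_ge0 // ?ltW //; lra.
  by rewrite -[leRHS]ger0_norm // -sqrtr_sqr ler_wsqrtr.
have xz : `|x| <= `|z| + kappa.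
  have -> : x = (z + x) - z by ring.
  by apply: le_trans (ler_normB _ _) _; rewrite addrC lerD2l.
have := ler_wpM2l (ltW q0) sq; lra.
Qed.

(** The root is bounded below by [sqrt (1 - a) >= 1 - a] with [a = 3 theta / 2], which loses more
    than in the upper bound: hence [1 - 2 theta]. *)
Lemma cover_lower q theta s x z Qt Qs kappa : 0 < q -> 0 < theta <= 4^-1 -> 0 < s ->
  0 <= kappa <= 1 -> 2 / theta <= s ^+ 2 -> 4 / (q * theta) <= s ->
  `|z + x| <= kappa -> `|Qt - Qs| <= kappa -> `|Qs - s ^+ 2| <= theta * s ^+ 2 ->
  `|x| <= q * (1 - 2 * theta) * s -> `|z| <= q * Num.sqrt Qt.
Proof.
move=> q0 /andP[th0 th1] s0 /andP[k0 k1] h1 h2 zx QQ Qs2 zq.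
have s2 : 0 < s ^+ 2 by rewrite exprn_gt0.
rewrite ler_pdivrMr // in h1; rewrite ler_pdivrMr ?mulr_gt0 // in h2.
have Qge : ((1 - 3 / 2 * theta) * s) ^+ 2 <= Qt.
  move: QQ Qs2; rewrite !ler_norml => /andP[a _] /andP[b _].
  rewrite exprMn; have : (1 - 3 / 2 * theta) ^+ 2 * s ^+ 2 <= (1 - 3 / 2 * theta) * s ^+ 2.
    by rewrite ler_wpM2r ?ltW //; nra.
  lra.
have sq : (1 - 3 / 2 * theta) * s <= Num.sqrt Qt.
  have p : 0 <= (1 - 3 / 2 * theta) * s by rewrite mulr_ge0 // ?ltW //; lra.
  by rewrite -[leLHS]ger0_norm // -sqrtr_sqr ler_wsqrtr.
have xz : `|z| <= `|x| + kappa.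
  have -> : z = (z + x) - x by ring.
  by apply: le_trans (ler_normB _ _) _; rewrite addrC lerD2l.
have := ler_wpM2l (ltW q0) sq; lra.
Qed.

(** The thresholds depend only on [q], [eta] and [M]. The budget [4 eta] is spent on the normal
    limit, on the event [off], on the bad event, and on moving the level [q] by a factor close to
    1. *)
Lemma studentized_coverage q eta M : 0 < q -> 0 < eta -> 0 <= M ->
  exists S0 e0 : R, [/\ 0 < S0, 0 < e0 & forall d (T : measurableType d)
    (P : probability T R) (S : sieve R) beta G (Z Q : T -> R) kappa,
    measurable_fun setT Z -> measurable_fun setT Q ->
    @approximation _ _ _ P S beta G Z Q kappa -> 0 <= kappa <= 1 -> kappa <= eta ->
    (forall c, `|@cweight _ S c| <= M) ->
    S0 <= Ex (@cprob R S) (@sbrac R S) ->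
    Ex (@cprob R S) (fun o => (sbrac o - Ex (@cprob R S) (@sbrac R S)) ^+ 2) <=
      e0 * (Ex (@cprob R S) (@sbrac R S)) ^+ 2 ->
    `|fine (P [set t | `|Z t| <= q * Num.sqrt (Q t)]) - (2 * ncdf q - 1)| <= 4 * eta].
Proof.
move=> q0 eta0 M0; have cp := normal_peak1_ge0 R.
have cp1 : 0 < c0 + 1 by rewrite ltr_wpDl.
(* Relative precision asked of the estimated standard deviation; moving [q] by [2 theta q] changes
   [ncdf] by at most [eta / 2]. *)
pose theta := Num.min 4^-1 (eta / (4 * ((c0 + 1) * q))).
have cq0 : 0 < 4 * ((c0 + 1) * q) by rewrite !mulr_gt0.
have th0 : 0 < theta by rewrite lt_min invr_gt0 ltr0n divr_gt0.
have th1 : theta <= 4^-1 by rewrite ge_min lexx.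
have th2 : c0 * (2 * theta * q) <= eta / 2.
  have : theta <= eta / (4 * ((c0 + 1) * q)) by rewrite ge_min lexx orbT.
  rewrite ler_pdivlMr ?mulr_gt0 // => h.
  have : 0 <= theta * q by rewrite mulr_ge0 // ltW.
  lra.
have th01 : 0 < theta <= 4^-1 by rewrite th0.
have bp0 : 0 < q * (1 + theta) by rewrite mulr_gt0 // ltr_wpDl.
have bm0 : 0 < q * (1 - 2 * theta) by rewrite mulr_gt0 //; lra.
have [rp rp0 Hp] := martingale_normal_limit bp0 eta0.
have [rm rm0 Hm] := martingale_normal_limit bm0 eta0.
pose rho := Num.min rp rm.
have rho0 : 0 < rho by rewrite lt_min rp0.
have rhop : rho <= rp by rewrite ge_min lexx.
have rhom : rho <= rm by rewrite ge_min lexx orbT.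
have t2 : 0 < theta ^+ 2 * eta by rewrite mulr_gt0 // exprn_gt0.
(* In order: a mean bracket of at least 1, coefficients below [rho] after division by [s], the two
   thresholds of the coverage inclusions, and two of the three terms in Chebyshev's bound for
   [squad]. The third term and the concentration of the bracket are left to [e0]. *)
pose S0 := 1 + (M / rho) ^+ 2 + 2 / theta + (4 / (q * theta)) ^+ 2 +
           9 * M ^+ 2 / (theta ^+ 2 * eta) + 9 / (theta ^+ 2 * eta).
pose e0 := Num.min (rho ^+ 2) (theta ^+ 2 * eta / 9).
have A1 : 0 <= (M / rho) ^+ 2 by apply: sqr_ge0.
have A2 : 0 <= 2 / theta by rewrite divr_ge0 // ltW.
have A3 : 0 <= (4 / (q * theta)) ^+ 2 by apply: sqr_ge0.
have A4 : 0 <= 9 * M ^+ 2 / (theta ^+ 2 * eta).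
  by rewrite divr_ge0 ?(ltW t2) // mulr_ge0 // sqr_ge0.
have A5 : 0 <= 9 / (theta ^+ 2 * eta) by rewrite divr_ge0 ?(ltW t2).
exists S0, e0; split.
- by rewrite /S0; clear -A1 A2 A3 A4 A5; lra.
- by rewrite lt_min exprn_gt0 //= divr_gt0.
move=> d T P S beta G Z Q kappa mZ mQ ap /andP[k0 k1] keta wM.
set s2 := Ex _ _ => hS0 hvar.
have law := approx_law ap.
have B1 : 1 <= s2 by clear -hS0 A1 A2 A3 A4 A5; rewrite /S0 in hS0; lra.
have B2 : (M / rho) ^+ 2 <= s2 by clear -hS0 A1 A2 A3 A4 A5; rewrite /S0 in hS0; lra.
have B3 : 2 / theta <= s2 by clear -hS0 A1 A2 A3 A4 A5; rewrite /S0 in hS0; lra.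
have B4 : (4 / (q * theta)) ^+ 2 <= s2 by clear -hS0 A1 A2 A3 A4 A5; rewrite /S0 in hS0; lra.
have B5 : 9 * M ^+ 2 / (theta ^+ 2 * eta) <= s2.
  by clear -hS0 A1 A2 A3 A4 A5; rewrite /S0 in hS0; lra.
have B6 : 9 / (theta ^+ 2 * eta) <= s2 by clear -hS0 A1 A2 A3 A4 A5; rewrite /S0 in hS0; lra.
have s2p : 0 < s2 by rewrite (lt_le_trans ltr01).
pose s := Num.sqrt s2.
have sp : 0 < s by rewrite sqrtr_gt0.
have ss : s ^+ 2 = s2 by rewrite sqr_sqrtr // ltW.
have sqle x : 0 <= x -> x ^+ 2 <= s2 -> x <= s.
  by move=> x0 h; rewrite -(ger0_norm x0) -sqrtr_sqr ler_wsqrtr.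
have Ms : M / rho <= s by apply: sqle => //; rewrite divr_ge0 // ltW.
have qs : 4 / (q * theta) <= s.
  by apply: sqle => //; rewrite divr_ge0 // mulr_ge0 // ltW.
have p01 := @cprob01 R S; have rinj := @crank_inj R S.
pose a c o := s^-1 * @scoef R S c o.
have a_pred : predictable (@crank R S) a.
  by move=> c c' cc' o v; rewrite /a scoef_predictable.
have a_small c o : `|a c o| <= rho.
  rewrite normrM ger0_norm ?invr_ge0 ?(ltW sp) // mulrC ler_pdivrMr //.
  apply: (@le_trans _ _ M).
    rewrite normrM; case: opened; first by rewrite normr1 mul1r.
    by rewrite normr0 mul0r.
  by rewrite mulrC -ler_pdivrMr.
have martE o : martingale (@cprob R S) a o = smart o / s.
  by rewrite /smart /martingale mulr_suml; apply: eq_bigr => c _; rewrite /a; ring.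
have bracE o : bracket (@cprob R S) a o = sbrac o / s2.
  rewrite /sbrac /bracket mulr_suml; apply: eq_bigr => c _.
  by rewrite /a -ss; field; rewrite gt_eqF.
have near1 : Ex (@cprob R S) (fun o => `|bracket (@cprob R S) a o - 1|) <= rho.
  (* [|y| <= rho / 2 + y^2 / (2 rho)] trades the mean absolute deviation of the bracket for its
     variance. *)
  apply: (@le_trans _ _ (Ex (@cprob R S) (fun o => rho / 2 + (2 * rho * s2 ^+ 2)^-1 * (sbrac o - s2) ^+ 2))).
    apply: ler_Ex => // o; rewrite bracE; set V := sbrac o.
    have -> : V / s2 - 1 = (V - s2) / s2 by field; rewrite gt_eqF.
    have -> : (2 * rho * s2 ^+ 2)^-1 * (V - s2) ^+ 2 = (2 * rho)^-1 * ((V - s2) / s2) ^+ 2.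
      by field; rewrite !gt_eqF.
    set y := (V - s2) / s2; rewrite -[y ^+ 2]real_normK ?num_real //.
    set n := `|y|; rewrite -(ler_pM2l (_ : 0 < 2 * rho)) ?mulr_gt0 //.
    have -> : 2 * rho * (rho / 2 + (2 * rho)^-1 * n ^+ 2) = rho ^+ 2 + n ^+ 2.
      by field; rewrite gt_eqF.
    by have := sqr_ge0 (rho - n); clear; nra.
  rewrite ExD Ex_cst ExZ.
  have : (2 * rho * s2 ^+ 2)^-1 * Ex (@cprob R S) (fun o => (sbrac o - s2) ^+ 2) <= rho / 2.
    rewrite ler_pdivrMl ?mulr_gt0 ?exprn_gt0 //; apply: le_trans hvar _.
    have : e0 * s2 ^+ 2 <= rho ^+ 2 * s2 ^+ 2.
      by rewrite ler_wpM2r ?sqr_ge0 // ge_min lexx.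
    by move=> /le_trans; apply; rewrite le_eqVlt; apply/orP; left; apply/eqP; field.
  by clear; lra.
have Lp := Hp _ _ _ _ p01 rinj a_pred (fun c o => le_trans (a_small c o) rhop)
  (le_trans near1 rhop).
have Lm := Hm _ _ _ _ p01 rinj a_pred (fun c o => le_trans (a_small c o) rhom)
  (le_trans near1 rhom).
pose off (o : {ffun cell S -> bool}) := theta * s2 < `|squad o - s2|.
have Poff : Ex (@cprob R S) (fun o => (off o)%:R) <= eta.
  have D := squad_dev wM (approx_comp ap) k1; rewrite -/s2 in D.
  have ts : 0 < (theta * s2) ^+ 2 by rewrite exprn_gt0 // mulr_gt0.
  apply: (@le_trans _ _ (((theta * s2) ^+ 2)^-1 *
      Ex (@cprob R S) (fun o => (squad o - s2) ^+ 2))).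
    rewrite -ExZ; apply: ler_Ex => // o; rewrite ler_pdivlMl //.
    rewrite /off; case: (ltP (theta * s2) `|squad o - s2|) => h.
      rewrite mulr1 -[leRHS]real_normK ?num_real // lerXn2r ?nnegrE ?(ltW h) //.
      by rewrite mulr_ge0 // ltW.
    by rewrite mulr0 sqr_ge0.
  rewrite ler_pdivrMl //; apply: le_trans D _.
  rewrite ler_pdivrMr // in B5; rewrite ler_pdivrMr // in B6.
  have H3 : Ex (@cprob R S) (fun o => (sbrac o - s2) ^+ 2) <= theta ^+ 2 * eta / 9 * s2 ^+ 2.
    apply: le_trans hvar _; rewrite ler_wpM2r ?sqr_ge0 // ge_min lexx orbT //.
  have H1 : 9 * M ^+ 2 * s2 <= s2 * (theta ^+ 2 * eta) * s2.
    by rewrite ler_wpM2r // ltW.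
  have H2 : 9 <= s2 * (theta ^+ 2 * eta) * s2.
    apply: le_trans B6 _; rewrite -[leLHS]mulr1 ler_wpM2l // mulr_ge0 ?(ltW t2) //.
    exact: ltW.
  have -> : (theta * s2) ^+ 2 * eta = s2 * (theta ^+ 2 * eta) * s2 by ring.
  have E3 : theta ^+ 2 * eta / 9 * s2 ^+ 2 = s2 * (theta ^+ 2 * eta) * s2 / 9 by field.
  rewrite E3 in H3; move: H1 H2 H3; clear.
  set U := s2 * _ * s2; set W := Ex _ _; rewrite -(mulrA 9).
  set J := M ^+ 2 * s2; lra.
pose cov := [set t | `|Z t| <= q * Num.sqrt (Q t)].
have mcov : measurable cov.
  rewrite -[cov]setTI; apply: measurable_fun_le => //.
    exact: measurableT_comp.
  apply: measurable_funM => //; apply: measurableT_comp mQ.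
  exact: continuous_measurable_fun (@sqrt_continuous R).
pose inb b (o : {ffun cell S -> bool}) := `|martingale (@cprob R S) a o| <= b.
have mG := approx_good ap; have mGc : measurable (~` G) by exact: measurableC.
have mev A := @beta_event_measurable _ _ _ _ S beta law A.
have Pfin A : P A \is a fin_num -> P A = (fine (P A))%:E by move=> /fineK ->.
have covfin : P cov = (fine (P cov))%:E.
  by rewrite fineK // fin_num_measure.
have xE o b : `|martingale (@cprob R S) a o| <= b = (`|smart o| <= b * s).
  by rewrite martE normrM (@ger0_norm _ s^-1) ?invr_ge0 ?(ltW sp) // ler_pdivrMr.
have up : fine (P cov) <= Ex (@cprob R S) (fun o => (inb (q * (1 + theta)) o)%:R) + 2 * eta.
  rewrite -lee_fin -covfin.
  apply: (@le_trans _ _ (P ([set t | inb (q * (1 + theta)) (beta t)] `|`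
      ([set t | off (beta t)] `|` ~` G)))).
    apply: le_measure; rewrite ?inE //; first by do 2 apply: measurableU => //.
    move=> t tc; have [Gt|nGt] := pselect (G t); last by right; right.
    have [toff|ton] := boolP (off (beta t)); first by right; left.
    left; rewrite /= /inb xE; rewrite -leNgt in ton.
    apply: (@cover_upper q theta s _ (Z t) (Q t) (squad (beta t)) kappa) => //.
    - by rewrite k0.
    - by rewrite ss.
    - have := approx_mart ap Gt; exact.
    - have := approx_quad ap Gt; exact.
    - by rewrite ss.
  apply: le_trans (measureU2 _ _ _) _ => //; first exact: measurableU.
  rewrite [X in (X + _ <= _)%E](beta_event law) EFinD leeD2l //.
  apply: le_trans (measureU2 _ _ _) _ => //.
  rewrite [X in (X + _ <= _)%E](beta_event law) (_ : 2 * eta = eta + eta); last by ring.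
  rewrite EFinD leeD ?lee_fin //; apply: le_trans (approx_bad ap) _.
  by rewrite lee_fin.
have lo : Ex (@cprob R S) (fun o => (inb (q * (1 - 2 * theta)) o)%:R) <= fine (P cov) + 2 * eta.
  rewrite -lee_fin EFinD -covfin -(beta_event law).
  apply: (@le_trans _ _ (P (cov `|` ([set t | off (beta t)] `|` ~` G)))).
    apply: le_measure; rewrite ?inE //; first by do 2 apply: measurableU => //.
    move=> t tc; have [Gt|nGt] := pselect (G t); last by right; right.
    have [toff|ton] := boolP (off (beta t)); first by right; left.
    left; rewrite /= /inb xE in tc; rewrite -leNgt in ton.
    apply: (@cover_lower q theta s (smart (beta t)) (Z t) (Q t) (squad (beta t)) kappa) => //.
    - by rewrite k0.
    - by rewrite ss.
    - have := approx_mart ap Gt; exact.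
    - have := approx_quad ap Gt; exact.
    - by rewrite ss.
  apply: le_trans (measureU2 _ _ _) _ => //; first exact: measurableU.
  rewrite leeD2l //.
  apply: le_trans (measureU2 _ _ _) _ => //.
  rewrite [X in (X + _ <= _)%E](beta_event law) (_ : 2 * eta = eta + eta); last by ring.
  rewrite EFinD leeD ?lee_fin //; apply: le_trans (approx_bad ap) _.
  by rewrite lee_fin.
have Np := ncdf_lipschitz q (q * (1 + theta)).
have Nm := ncdf_lipschitz q (q * (1 - 2 * theta)).
have ep : q * (1 + theta) - q = theta * q by ring.
have em : q * (1 - 2 * theta) - q = - (2 * theta * q) by ring.
have qt0 : 0 <= theta * q by rewrite mulr_ge0 // ltW.
rewrite ep (ger0_norm qt0) in Np.
have qt2 : 0 <= 2 * theta * q by rewrite -mulrA mulr_ge0.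
rewrite em normrN (ger0_norm qt2) in Nm.
rewrite -/cov.
have c1 : c0 * (theta * q) <= c0 * (2 * theta * q).
  by rewrite ler_wpM2l // -mulrA; move: qt0; clear; lra.
move: Np Nm Lp Lm up lo th2 c1; rewrite /inb; clear.
set x1 := ncdf (q * (1 + theta)); set x2 := ncdf (q * (1 - 2 * theta)).
set y1 := Ex _ _; set y2 := Ex _ _; set f := fine _.
set k1 := c0 * (theta * q); set k2 := c0 * (2 * theta * q).
rewrite !ler_norml => /andP[? ?] /andP[? ?] /andP[? ?] /andP[? ?] ? ? ? ?.
by apply/andP; split; lra.
Qed.

End Studentized.

(** * Limit along a sequence of experiments *)

Section StudentizedLimit.
Variable R : realType.

(** For each [n] the truncation level is chosen before [kappa], and [kappa] before the sieve. The
    mean bracket is at least of order [n^(1/2)], and its variance, at most of order [n^(3/4)], is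
    negligible against [n]. *)
Theorem studentized_limit (d : nat -> measure_display)
    (T : forall n, measurableType (d n)) (P : forall n, probability (T n) R)
    (Z Q : forall n, T n -> R) (M c C q : R) :
  0 <= M -> 0 < c -> 0 <= C -> 0 < q ->
  (forall n, (0 < n)%N -> measurable_fun setT (Z n)) ->
  (forall n, (0 < n)%N -> measurable_fun setT (Q n)) ->
  (forall n, (0 < n)%N ->
    ((c * Num.sqrt n%:R)%:E <= \int[P n]_t (Z n t ^+ 2)%:E)%E) ->
  (forall n kappa, (0 < n)%N -> 0 < kappa -> exists (S : sieve R)
      (beta : T n -> {ffun cell S -> bool}) (G : set (T n)),
    [/\ approximation (P n) beta G (Z n) (Q n) kappa,
        forall c, `|@cweight _ S c| <= M &
        Ex (@cprob R S) (fun o => (sbrac o - Ex (@cprob R S) (@sbrac R S)) ^+ 2) <=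
          C * (Num.sqrt n%:R * Num.sqrt (Num.sqrt n%:R))]) ->
  P n [set t | `|Z n t| <= q * Num.sqrt (Q n t)] @[n --> \oo] -->
    (2 * ncdf q - 1)%:E.
Proof.
move=> M0 c0 C0 q0 mZ mQ second approx.
have fin n : (0 < n)%N -> P n [set t | `|Z n t| <= q * Num.sqrt (Q n t)] \is a fin_num.
  move=> n0; apply: fin_num_measure; rewrite -[X in measurable X]setTI.
  apply: measurable_fun_le => //; first by apply: measurableT_comp => //; exact: mZ.
  apply: measurable_funM => //; apply: measurableT_comp (mQ _ n0).
  exact: continuous_measurable_fun (@sqrt_continuous R).
apply/fine_cvgP; split; first by exists 1%N => // n /= n0; exact: fin.
apply/cvgrPdist_le => eta eta0.
have eta4 : 0 < eta / 4 by rewrite divr_gt0.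
have [S0 [e0 [S0p e0p H]]] := studentized_coverage q0 eta4 M0.
(* Lower bound for [u = n^(1/4)]. Besides [u >= 1], the terms ensure in turn that the mean bracket
   is at least [c u^2 / 8], that it exceeds [S0], and that the variance is at most [e0] times its
   square. *)
pose B := 1 + 12 / c + 8 * S0 / c + 64 * C / (e0 * c ^+ 2).
have b1 : 0 <= 12 / c by rewrite divr_ge0 // ltW.
have b2 : 0 <= 8 * S0 / c by rewrite divr_ge0 ?(ltW c0) // mulr_ge0 // ltW.
have b3 : 0 <= 64 * C / (e0 * c ^+ 2).
  by rewrite divr_ge0 ?mulr_ge0 ?sqr_ge0 // ltW.
near=> n.
have n0 : (0 < n)%N by near: n; exact: nbhs_infty_gt.
have nB : B ^+ 4 <= n%:R by near: n; exact: nbhs_infty_ger.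
pose u := Num.sqrt (Num.sqrt n%:R) : R.
have uu : u ^+ 2 = Num.sqrt n%:R by rewrite sqr_sqrtr // sqrtr_ge0.
have uB : B <= u.
  have B0 : 0 <= B by rewrite /B; move: b1 b2 b3; clear; lra.
  rewrite -(ger0_norm B0) -sqrtr_sqr ler_wsqrtr //.
  rewrite -[B ^+ 2]ger0_norm ?sqr_ge0 // -sqrtr_sqr ler_wsqrtr //.
  by rewrite -exprM.
have u1 : 1 <= u by move: uB b1 b2 b3; rewrite /B; clear; lra.
have u12 : 12 <= c * u.
  by rewrite -ler_pdivrMl // mulrC; move: uB b1 b2 b3; rewrite /B; clear; lra.
have uS : 8 * S0 <= c * u.
  by rewrite -ler_pdivrMl // mulrC; move: uB b1 b2 b3; rewrite /B; clear; lra.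
have uC : 64 * C <= e0 * c ^+ 2 * u.
  rewrite -ler_pdivrMl ?mulr_gt0 ?exprn_gt0 // mulrC.
  by move: uB b1 b2 b3; rewrite /B; clear; lra.
have u2 : c * u <= c * u ^+ 2 by rewrite ler_wpM2l ?(ltW c0) // expr2 ler_peMl // (le_trans ler01).
have cn : ((c * u ^+ 2 / 2)%:E < \int[P n]_t (Z n t ^+ 2)%:E)%E.
  apply: lt_le_trans (second _ n0); rewrite lte_fin -uu.
  by move: u12 u2; clear; lra.
have [k k0 ck] := truncated_second_moment (mZ _ n0) cn.
pose kappa := Num.min k%:R^-1 (Num.min 1 (eta / 4)) : R.
have kR : (0 : R) < k%:R by rewrite ltr0n.
have kap0 : 0 < kappa by rewrite !lt_min invr_gt0 kR ltr01.
have [S [beta [G [ap wM hvar]]]] := approx _ _ n0 kap0.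
have kap1 : 0 <= kappa <= 1 by rewrite (ltW kap0) /= !ge_min lexx orbT.
have kk : k%:R * kappa <= 1.
  by rewrite -ler_pdivlMl // mulr1 ge_min lexx.
have low := bracket_lower_bound (mZ _ n0) ck ap kap1 kk.
set s2 := Ex _ _ in low hvar.
have s2low : c * u ^+ 2 / 8 <= s2 by move: low u12 u2; clear; lra.
have s2S : S0 <= s2 by move: s2low uS u2; clear; lra.
have s2V : Ex (@cprob R S) (fun o => (sbrac o - s2) ^+ 2) <= e0 * s2 ^+ 2.
  apply: le_trans hvar _; rewrite -/u -uu.
  apply: (@le_trans _ _ (e0 * (c * u ^+ 2 / 8) ^+ 2)); last first.
    rewrite ler_wpM2l ?(ltW e0p) // lerXn2r ?nnegrE //.
      by rewrite divr_ge0 // mulr_ge0 ?sqr_ge0 // ltW.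
    by apply: le_trans s2low; rewrite divr_ge0 // mulr_ge0 ?sqr_ge0 // ltW.
  have u3 : 0 <= u ^+ 3 by rewrite exprn_ge0 // (le_trans ler01).
  have := ler_wpM2r u3 uC.
  have -> : e0 * (c * u ^+ 2 / 8) ^+ 2 = e0 * c ^+ 2 * u * u ^+ 3 / 64 by field.
  have -> : C * (u ^+ 2 * u) = C * u ^+ 3 by ring.
  by clear; lra.
have := H _ _ _ _ _ _ _ _ _ (mZ _ n0) (mQ _ n0) ap kap1 _ wM s2S s2V.
rewrite distrC (_ : 4 * (eta / 4) = eta); last by field.
by apply; rewrite !ge_min lexx !orbT.
Unshelve. all: by end_near. Qed.

End StudentizedLimit.

(** * Areas of planar regions *)

Section ComparisonSets.
Context {d : measure_display} {T : measurableType d} {R : realType}.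
Implicit Types (f g : T -> R).

Lemma measurable_leset f g : measurable_fun setT f -> measurable_fun setT g ->
  measurable [set x | f x <= g x].
Proof.
by move=> mf mg; rewrite -[X in measurable X]setTI; apply: measurable_fun_le.
Qed.

Lemma measurable_ltset f g : measurable_fun setT f -> measurable_fun setT g ->
  measurable [set x | f x < g x].
Proof.
move=> mf mg; have -> : [set x | f x < g x] = ~` [set x | g x <= f x].
  by apply/seteqP; split => x /=; rewrite ltNge => /negP.
by apply: measurableC; apply: measurable_leset.
Qed.

End ComparisonSets.

Section Area.
Variable R : realType.
Local Notation mu := (@lebesgue_measure R).
Local Notation mu2 := (mu \x mu)%E.
Implicit Types (f : R -> R) (J : set R) (B W : set (R * R)).

(** Half-open at the top, so that layers stacked on one another are disjoint. *)
Definition region f1 f2 J : set (R * R) := [set z | J z.1 /\ f1 z.1 <= z.2 < f2 z.1].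

Lemma measurable_region f1 f2 J : measurable J ->
  measurable_fun setT f1 -> measurable_fun setT f2 -> measurable (region f1 f2 J).
Proof.
move=> mJ m1 m2.
have -> : region f1 f2 J = (fst @^-1` J) `&` ([set z | f1 z.1 <= z.2] `&` [set z | z.2 < f2 z.1]).
  apply/seteqP; split => z; first by move=> [? /andP[]].
  by move=> [? [? ?]]; split => //; apply/andP.
apply: measurableI.
  by rewrite -[X in measurable X]setTI; apply: measurable_fst.
apply: measurableI.
  by apply: measurable_leset => //; exact: measurableT_comp.
by apply: measurable_ltset => //; exact: measurableT_comp.
Qed.

Lemma mu2_region f1 f2 J : measurable J ->
  measurable_fun setT f1 -> measurable_fun setT f2 ->
  (forall x, J x -> f1 x <= f2 x) ->
  mu2 (region f1 f2 J) = (\int[mu]_(x in J) (f2 x - f1 x)%:E)%E.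
Proof.
move=> mJ m1 m2 f12; rewrite /product_measure1 [RHS]integral_mkcond.
apply: eq_integral => x _; rewrite /= patchE.
case: ifPn => [/set_mem Jx|/negP nJx].
  have -> : xsection (region f1 f2 J) x = `[f1 x, f2 x[%classic.
    apply/seteqP; split => y; rewrite /xsection /= inE /region /= in_itv /=.
      by move=> [].
    by move=> h; split.
  rewrite lebesgue_measure_itv /= lte_fin.
  by case: ltP => // h; have -> : f2 x - f1 x = 0 by have := f12 _ Jx; lra.
have -> : xsection (region f1 f2 J) x = set0; last by rewrite measure0.
rewrite -subset0 => y; rewrite /xsection /= inE /region /= => -[Jx _].
by apply: nJx; rewrite inE.
Qed.

Lemma mu2_region_cst f J (tau : R) : measurable J -> measurable_fun setT f ->
  0 <= tau -> mu2 (region f (fun x => f x + tau) J) = (tau%:E * mu J)%E.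
Proof.
move=> mJ mf tau0; rewrite mu2_region //; [|by apply: measurable_funD|by move=> x _; rewrite lerDl].
rewrite -integral_cst //; apply: eq_integral => x _.
by rewrite addrAC subrr add0r.
Qed.

(** Restricting to a window of finite measure makes areas real numbers. *)
Definition area W B : R := fine (mu2 (B `&` W)).

Variable W : set (R * R).
Hypothesis mW : measurable W.
Hypothesis finW : (mu2 W < +oo)%E.

Let finI B : measurable B -> mu2 (B `&` W) \is a fin_num.
Proof.
move=> mB; rewrite ge0_fin_numE ?measure_ge0 //; apply: le_lt_trans finW.
by apply: le_measure; rewrite ?inE //; exact: measurableI.
Qed.

Lemma areaE B : measurable B -> mu2 (B `&` W) = (area W B)%:E.
Proof. by move=> mB; rewrite fineK // finI. Qed.

Lemma area_ge0 B : 0 <= area W B.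
Proof. by rewrite fine_ge0 // measure_ge0. Qed.

Lemma le_area A B : measurable A -> measurable B -> A `&` W `<=` B -> area W A <= area W B.
Proof.
move=> mA mB AB; rewrite -lee_fin -!areaE //.
apply: le_measure; rewrite ?inE; [exact: measurableI|exact: measurableI|].
by move=> z [Az Wz]; split => //; apply: AB.
Qed.

Lemma area_setU A B : measurable A -> measurable B -> area W (A `|` B) <= area W A + area W B.
Proof.
move=> mA mB; rewrite -lee_fin EFinD -!areaE //; last exact: measurableU.
by rewrite setIUl; apply: measureU2; exact: measurableI.
Qed.

Lemma bigsetUP (V I : Type) (r : seq I) (Q : pred I) (F : I -> set V) z :
  (\big[setU/set0]_(i <- r | Q i) F i) z -> exists2 i, Q i & F i z.
Proof.
elim/big_rec: _ => [//|i B Qi IH [Fz|/IH //]].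
by exists i.
Qed.

Lemma bigsetU_sup (V : Type) (I : finType) (Q : pred I) (F : I -> set V) i :
  Q i -> F i `<=` \big[setU/set0]_(i | Q i) F i.
Proof. by move=> Qi z Fz; rewrite (bigD1 i) //=; left. Qed.

Lemma measurable_bigsetU (I : finType) (Q : pred I) (F : I -> set (R * R)) :
  (forall i, measurable (F i)) -> measurable (\big[setU/set0]_(i | Q i) F i).
Proof. by move=> mF; apply: bigsetU_measurable. Qed.

Lemma area_bigsetU (I : finType) (Q : pred I) (F : I -> set (R * R)) :
  (forall i, measurable (F i)) -> trivIset setT F ->
  area W (\big[setU/set0]_(i | Q i) F i) = \sum_(i | Q i) area W (F i).
Proof.
move=> mF tF; have := index_enum_uniq I.
elim: (index_enum I) => [|i r IH] /=.
  by rewrite !big_nil /area set0I measure0.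
move=> /andP[ir ur]; rewrite !big_cons; case: ifP => Qi; last exact: IH.
have mr : measurable (\big[setU/set0]_(j <- r | Q j) F j) by apply: bigsetU_measurable.
apply: EFin_inj; rewrite EFinD -(IH ur) -!areaE //; last exact: measurableU.
rewrite setIUl measureU; [by []|by apply: measurableI; [exact: mF|]|by apply: measurableI|].
rewrite -subset0 => z [[Fz _] [rz _]].
have [j jr Fj] : exists2 j, j \in r & F j z.
  move: rz; clear; elim: r => [|j r IH]; first by rewrite big_nil.
  rewrite big_cons; case: ifP => Qj; last by move=> /IH[k kr Fk]; exists k; rewrite ?inE ?kr ?orbT.
  by case=> [Fj|/IH[k kr Fk]]; [exists j; rewrite ?inE ?eqxx|exists k; rewrite ?inE ?kr ?orbT].
have e : i = j by apply: (tF i j) => //; exists z.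
by rewrite e jr in ir.
Qed.

Lemma area_partition (I : finType) (F : I -> set (R * R)) B : measurable B ->
  (forall i, measurable (F i)) -> trivIset setT F ->
  (forall z, B z -> W z -> exists i, F i z) ->
  area W B = \sum_i area W (B `&` F i).
Proof.
move=> mB mF tF cov; rewrite -(@area_bigsetU _ predT); last 2 first.
- by move=> i; exact: measurableI.
- by move=> i j _ _ [z [[_ zi] [_ zj]]]; apply: (tF i j) => //; exists z.
rewrite /area; congr (fine (mu2 _)); apply/seteqP; split => z [].
  move=> Bz Wz; split => //; have [i Fz] := cov _ Bz Wz.
  by rewrite (bigD1 i) //=; left.
move=> bz Wz; have [i _ [Bz _]] := bigsetUP bz; by [].
Qed.

End Area.

(** * Grid in cone coordinates *)

Section Grid.
Variable R : realType.
Local Notation mu := (@lebesgue_measure R).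
Local Notation mu2 := (mu \x mu)%E.
Variables (L : R) (g w : R -> R) (M Qb N N2 : nat).
Hypothesis L0 : 0 < L.
Hypothesis g_lip : forall x y, `|g y - g x| <= L * `|y - x|.
Hypothesis mw : measurable_fun setT w.
Hypothesis wM : forall x, `|w x| <= M%:R.
Hypothesis N0 : (0 < N)%N.
Hypothesis N20 : (0 < N2)%N.
Hypothesis Qg : forall x, 0 <= x <= 1 -> L - Qb%:R <= g x.

Implicit Types (z : R * R) (u x y t : R) (J : set R).

(** Both cone coordinates range over [[-Qb, Qb[] with mesh [1 / N]. *)
Definition gm := (2 * Qb * N)%N.
(** The extra level takes the value [w = M], cells being half-open. *)
Definition gl := (2 * M * N2).+1.
Definition gcell := ('I_gm * 'I_gm * 'I_gl)%type.
Implicit Types (c : gcell).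

Definition ucell u (i : nat) := i%:R <= u < i.+1%:R.
(* The cone order [y' + L|x' - x| < y] is the product order of [(pu, qu)]; [wu]
   discretizes the weight, which is only measurable. *)
Definition pu z : R := (z.2 + L * z.1 + Qb%:R) * N%:R.
Definition qu z : R := (z.2 - L * z.1 + Qb%:R) * N%:R.
Definition wu z : R := (w z.1 + M%:R) * N2%:R.

Definition gbox : set (R * R) :=
  [set z | [/\ 0 <= z.1 <= 1, 0 <= pu z < gm%:R & 0 <= qu z < gm%:R]].
Definition epi : set (R * R) := [set z | g z.1 <= z.2].
Definition gwin := gbox `&` epi.
Definition cellset c : set (R * R) :=
  [set z | [/\ 0 <= z.1 <= 1, ucell (pu z) c.1.1, ucell (qu z) c.1.2 & ucell (wu z) c.2]].
Definition pstrip (i : 'I_gm) : set (R * R) := [set z | gbox z /\ ucell (pu z) i].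
Definition qstrip (i : 'I_gm) : set (R * R) := [set z | gbox z /\ ucell (qu z) i].
(* Cells differing only in the weight index cover the same square of cone
   coordinates, so neither is below the other. *)
Definition gbelow c : {set gcell} :=
  [set c' : gcell | [&& (c'.1.1 <= c.1.1)%N, (c'.1.2 <= c.1.2)%N & c'.1 != c.1]].
Definition grank c : nat := ((c.1.1 * gm + c.1.2) * gl + c.2)%N.
Definition gweight c : R := - M%:R + c.2%:R / N2%:R.

Lemma ucell_inj u i j : ucell u i -> ucell u j -> i = j.
Proof.
move=> /andP[i1 i2] /andP[j1 j2].
have h1 := le_lt_trans i1 j2; have h2 := le_lt_trans j1 i2.
by rewrite !ltr_nat in h1 h2; clear -h1 h2; lia.
Qed.

Lemma ucell_truncn u : 0 <= u -> ucell u (Num.truncn u).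
Proof. by move=> u0; apply: truncn_itv. Qed.

Lemma ucell_ord u k : 0 <= u < k%:R -> exists i : 'I_k, ucell u i.
Proof.
move=> /andP[u0 uk]; have := ucell_truncn u0; set i := Num.truncn u => ui.
have ik : (i < k)%N by move/andP: ui => [h _]; rewrite -(ltr_nat R); exact: le_lt_trans uk.
by exists (Ordinal ik).
Qed.

Lemma wu_cell z : exists a : 'I_gl, ucell (wu z) a.
Proof.
apply: ucell_ord; have := wM z.1; rewrite ler_norml => /andP[h1 h2].
have n2 : (0 : R) < N2%:R by rewrite ltr0n.
apply/andP; split; first by rewrite mulr_ge0 ?(ltW n2) //; lra.
rewrite /gl -natr1 natrM natrM ltr_pwDr // ler_wpM2r ?(ltW n2) //.
by lra.
Qed.

Lemma gbox_cell z : gbox z -> exists c, cellset c z.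
Proof.
case=> z01 zp zq; have [i ip] := ucell_ord zp; have [k kq] := ucell_ord zq.
by have [a aw] := wu_cell z; exists (i, k, a).
Qed.

Lemma cellset_inj c c' z : cellset c z -> cellset c' z -> c = c'.
Proof.
case: c c' => [[i k] a] [[i' k'] a'] [_ h1 h2 h3] [_ h1' h2' h3']; rewrite /= in h1 h2 h3 h1' h2' h3'.
have e1 : i = i' by apply/val_inj/(ucell_inj h1 h1').
have e2 : k = k' by apply/val_inj/(ucell_inj h2 h2').
have e3 : a = a' by apply/val_inj/(ucell_inj h3 h3').
by rewrite e1 e2 e3.
Qed.

Lemma cellset_box c : cellset c `<=` gbox.
Proof.
have aux u (i : 'I_gm) : ucell u i -> 0 <= u < gm%:R.
  move=> /andP[h1 h2]; rewrite (le_trans _ h1) ?ler0n //= (lt_le_trans h2) //.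
  by rewrite ler_nat.
by move=> z [z01 h1 h2 _]; split => //; [exact: aux h1|exact: aux h2].
Qed.

Lemma trivIset_cellset : trivIset setT cellset.
Proof. by move=> c c' _ _ [z [zc zc']]; exact: cellset_inj zc zc'. Qed.

Let mfst : measurable_fun setT (fun z : R * R => z.1).
Proof. exact: measurable_fst. Qed.
Let msnd : measurable_fun setT (fun z : R * R => z.2).
Proof. exact: measurable_snd. Qed.

Lemma measurable_pu : measurable_fun setT pu.
Proof.
apply: measurable_funM => //; apply: measurable_funD => //.
by apply: measurable_funD => //; apply: measurable_funM.
Qed.

Lemma measurable_qu : measurable_fun setT qu.
Proof.
apply: measurable_funM => //; apply: measurable_funD => //.
by apply: measurable_funB => //; apply: measurable_funM.
Qed.

Lemma measurable_wu : measurable_fun setT wu.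
Proof.
apply: measurable_funM => //; apply: measurable_funD => //.
exact: measurableT_comp mw mfst.
Qed.

Lemma measurable_g : measurable_fun setT g.
Proof.
apply: continuous_measurable_fun => x; apply/cvgrPdist_le => e e0.
near=> y; apply: le_trans (g_lip _ _) _.
rewrite -ler_pdivlMl // mulrC.
near: y; apply: cvgr_dist_le; [exact: cvg_id|by rewrite divr_gt0].
Unshelve. all: by end_near. Qed.

Lemma measurable_ucell (f : R * R -> R) i : measurable_fun setT f ->
  measurable [set z | ucell (f z) i].
Proof.
move=> mf; have -> : [set z | ucell (f z) i] = [set z | i%:R <= f z] `&` [set z | f z < i.+1%:R].
  by apply/seteqP; split => z /=; [move/andP|move=> h; apply/andP].
by apply: measurableI; [apply: measurable_leset|apply: measurable_ltset].
Qed.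

Lemma measurable_itv2 (f : R * R -> R) (a b : R) : measurable_fun setT f ->
  measurable [set z | a <= f z < b].
Proof.
move=> mf; have -> : [set z | a <= f z < b] = [set z | a <= f z] `&` [set z | f z < b].
  by apply/seteqP; split => z /=; [move/andP|move=> h; apply/andP].
by apply: measurableI; [apply: measurable_leset|apply: measurable_ltset].
Qed.

Lemma measurable_01 : measurable [set z : R * R | 0 <= z.1 <= 1].
Proof.
have -> : [set z : R * R | 0 <= z.1 <= 1] = [set z | 0 <= z.1] `&` [set z | z.1 <= 1].
  by apply/seteqP; split => z /=; [move/andP|move=> h; apply/andP].
by apply: measurableI; apply: measurable_leset.
Qed.

Lemma measurable_cellset c : measurable (cellset c).
Proof.
have -> : cellset c = [set z | 0 <= z.1 <= 1] `&` ([set z | ucell (pu z) c.1.1] `&`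
    ([set z | ucell (qu z) c.1.2] `&` [set z | ucell (wu z) c.2])).
  by apply/seteqP; split => z; [by case=> ? ? ? ?; do !split|by move=> [? [? [? ?]]]; split].
apply: measurableI; first exact: measurable_01.
apply: measurableI; first exact: (measurable_ucell _ measurable_pu).
by apply: measurableI; [exact: (measurable_ucell _ measurable_qu)|exact: (measurable_ucell _ measurable_wu)].
Qed.

Lemma measurable_gbox : measurable gbox.
Proof.
have -> : gbox = [set z | 0 <= z.1 <= 1] `&` ([set z | 0 <= pu z < gm%:R] `&`
    [set z | 0 <= qu z < gm%:R]).
  by apply/seteqP; split => z; [case|move=> [? [? ?]]; split].
apply: measurableI; first exact: measurable_01.
by apply: measurableI; [exact: (measurable_itv2 _ _ measurable_pu)|exact: (measurable_itv2 _ _ measurable_qu)].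
Qed.

Lemma measurable_epi : measurable epi.
Proof.
apply: measurable_leset => //; exact: measurableT_comp measurable_g mfst.
Qed.

Lemma measurable_gwin : measurable gwin.
Proof. by apply: measurableI; [exact: measurable_gbox|exact: measurable_epi]. Qed.

Lemma measurable_pstrip i : measurable (pstrip i).
Proof. by apply: measurableI; [exact: measurable_gbox|exact: (measurable_ucell _ measurable_pu)]. Qed.

Lemma measurable_qstrip i : measurable (qstrip i).
Proof. by apply: measurableI; [exact: measurable_gbox|exact: (measurable_ucell _ measurable_qu)]. Qed.

Let Np : (0 : R) < N%:R. Proof. by rewrite ltr0n. Qed.

Lemma gmE : gm%:R = 2 * Qb%:R * N%:R :> R.
Proof. by rewrite /gm !natrM. Qed.

Lemma gbox_bounds z : gbox z -> - Qb%:R <= z.2 < Qb%:R.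
Proof.
case=> _; rewrite gmE /pu /qu ltr_pM2r // ltr_pM2r // !pmulr_lge0 //.
by move=> /andP[? ?] /andP[? ?]; apply/andP; split; lra.
Qed.

Lemma mu_unit : mu [set x | 0 <= x <= 1] = 1%E.
Proof.
have -> : [set x : R | 0 <= x <= 1] = `[0, 1]%classic.
  by apply/seteqP; split => x /=; rewrite in_itv.
by rewrite lebesgue_measure_itv /= lte_fin ltr01 oppr0 adde0.
Qed.

Lemma measurable_unit : measurable [set x : R | 0 <= x <= 1].
Proof.
have -> : [set x : R | 0 <= x <= 1] = `[0, 1]%classic.
  by apply/seteqP; split => x /=; rewrite in_itv.
exact: measurable_itv.
Qed.

Let mu2_le_region (f : R -> R) (tau : R) B : measurable_fun setT f -> 0 <= tau ->
  measurable B -> B `<=` region f (fun x => f x + tau) [set x | 0 <= x <= 1] ->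
  (mu2 B <= tau%:E)%E.
Proof.
move=> mf tau0 mB sub.
have := mu2_region_cst measurable_unit mf tau0; rewrite mu_unit mule1 => <-.
apply: le_measure; rewrite ?inE //.
by apply: measurable_region => //; [exact: measurable_unit|exact: measurable_funD].
Qed.

Lemma mu2_gbox : (mu2 gbox <= (2 * Qb%:R)%:E)%E.
Proof.
apply: (@mu2_le_region (cst (- Qb%:R))) => //.
  exact: measurable_gbox.
move=> z zb; split; first by case: zb.
by move: (gbox_bounds zb); rewrite /=; lra.
Qed.

Lemma mu2_gwin : (mu2 gwin < +oo)%E.
Proof.
apply: (@le_lt_trans _ _ (2 * Qb%:R)%:E); last by rewrite ltry.
apply: le_trans mu2_gbox; apply: le_measure; rewrite ?inE.
- exact: measurable_gwin.
- exact: measurable_gbox.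
- exact: subIsetl.
Qed.

Definition garea B := area gwin B.

Lemma garea_ge0 B : 0 <= garea B. Proof. exact: area_ge0. Qed.

Lemma garea_le_mu2 B (k : R) : measurable B -> (mu2 B <= k%:E)%E -> garea B <= k.
Proof.
move=> mB Bk; rewrite -lee_fin /garea -areaE //; [|exact: measurable_gwin|exact: mu2_gwin].
apply: le_trans Bk; apply: le_measure; rewrite ?inE //.
by apply: measurableI => //; exact: measurable_gwin.
Qed.

Lemma garea_box : garea gbox <= 2 * Qb%:R.
Proof. by apply: garea_le_mu2; [exact: measurable_gbox|exact: mu2_gbox]. Qed.

(** The strip lies between two lines of slope [- L] at vertical distance [1 / N], over an interval
    of length 1. *)
Lemma garea_pstrip i : garea (pstrip i) <= N%:R^-1.
Proof.
apply: garea_le_mu2; first exact: measurable_pstrip.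
apply: (@mu2_le_region (fun x => (i%:R / N%:R - Qb%:R) - L * x)).
- by apply: measurable_funB => //; apply: measurable_funM.
- by rewrite invr_ge0 ltW.
- exact: measurable_pstrip.
move=> z [[z01 _ _]]; rewrite /ucell /pu -natr1 => /andP[h1 h2]; split => //.
rewrite -ler_pdivrMr // in h1; rewrite -ltr_pdivlMr // mulrDl mul1r in h2.
by apply/andP; split; lra.
Qed.

Lemma garea_qstrip i : garea (qstrip i) <= N%:R^-1.
Proof.
apply: garea_le_mu2; first exact: measurable_qstrip.
apply: (@mu2_le_region (fun x => (i%:R / N%:R - Qb%:R) + L * x)).
- by apply: measurable_funD => //; apply: measurable_funM.
- by rewrite invr_ge0 ltW.
- exact: measurable_qstrip.
move=> z [[z01 _ _]]; rewrite /ucell /qu -natr1 => /andP[h1 h2]; split => //.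
rewrite -ler_pdivrMr // in h1; rewrite -ltr_pdivlMr // mulrDl mul1r in h2.
by apply/andP; split; lra.
Qed.

Lemma cellset_pstrip c : cellset c `<=` pstrip c.1.1.
Proof. by move=> z zc; split; [exact: cellset_box zc|case: zc]. Qed.

Lemma cellset_qstrip c : cellset c `<=` qstrip c.1.2.
Proof. by move=> z zc; split; [exact: cellset_box zc|case: zc]. Qed.

Lemma le_garea A B : measurable A -> measurable B -> A `&` gwin `<=` B -> garea A <= garea B.
Proof. by apply: le_area; [exact: measurable_gwin|exact: mu2_gwin]. Qed.

Lemma garea_cell c : garea (cellset c) <= N%:R^-1.
Proof.
apply: le_trans (garea_pstrip c.1.1); apply: le_garea.
- exact: measurable_cellset.
- exact: measurable_pstrip.
- by move=> z [zc _]; exact: cellset_pstrip.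
Qed.

Lemma sum_garea_cell : \sum_c garea (cellset c) <= 2 * Qb%:R.
Proof.
apply: le_trans garea_box; rewrite /garea.
rewrite -(@area_bigsetU _ _ measurable_gwin mu2_gwin _ predT); last 2 first.
- exact: measurable_cellset.
- exact: trivIset_cellset.
apply: le_garea.
- apply: measurable_bigsetU => c; exact: measurable_cellset.
- exact: measurable_gbox.
- by move=> z [_ []].
Qed.

Lemma grank_inj : injective grank.
Proof.
move=> [[i k] a] [[i' k'] a'] /= e.
have aux (x y x' y' d : nat) : (y < d)%N -> (y' < d)%N ->
    (x * d + y = x' * d + y')%N -> x = x' /\ y = y'.
  move=> yd yd' h; have xx : x = x'.
    have := congr1 (divn^~ d) h; rewrite !divnMDl ?(leq_ltn_trans _ yd) //.
    by rewrite !divn_small // !addn0.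
  by split => //; move: h; rewrite xx => /addnI.
have [e1 e2] := aux _ _ _ _ _ (ltn_ord a) (ltn_ord a') e.
have [e3 e4] := aux _ _ _ _ _ (ltn_ord k) (ltn_ord k') e1.
have -> : i = i' by exact: val_inj.
have -> : k = k' by exact: val_inj.
by have -> : a = a' by exact: val_inj.
Qed.

(** The lexicographic order extends the product order; the weight index only breaks ties. *)
Lemma gbelow_rank c c' : c' \in gbelow c -> (grank c' < grank c)%N.
Proof.
case: c c' => [[i k] a] [[i' k'] a']; rewrite inE /= => /and3P[ii kk ne].
have lt : (i' * gm + k' < i * gm + k)%N.
  have [e|] := eqVneq i' i.
    rewrite e ltn_add2l ltn_neqAle kk andbT.
    by apply: contraNneq ne => e2; rewrite e (val_inj e2).
  move=> ne'; have lti : (i' < i)%N by rewrite ltn_neqAle ii andbT.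
  have : (i'.+1 * gm <= i * gm)%N by rewrite leq_mul2r lti orbT.
  have := ltn_ord k'; clear; lia.
rewrite /grank /=; have : ((i' * gm + k').+1 * gl <= (i * gm + k) * gl)%N.
  by rewrite leq_mul2r lt orbT.
have := ltn_ord a'; clear; lia.
Qed.

Lemma gweight_close c z : cellset c z -> `|w z.1 - gweight c| <= N2%:R^-1.
Proof.
have n2 : (0 : R) < N2%:R by rewrite ltr0n.
case=> _ _ _; rewrite /ucell /wu -natr1 => /andP[h1 h2].
rewrite -ler_pdivrMr // in h1; rewrite -ltr_pdivlMr // mulrDl mul1r in h2.
by rewrite /gweight ler_norml; apply/andP; split; move: h1 h2; lra.
Qed.

Lemma gweight_bound c : `|gweight c| <= M%:R.
Proof.
have n2 : (0 : R) < N2%:R by rewrite ltr0n.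
have : (c.2 : nat)%:R <= 2 * M%:R * N2%:R :> R.
  by rewrite -!natrM ler_nat -ltnS; exact: ltn_ord.
rewrite -ler_pdivrMr // => h.
have : 0 <= (c.2 : nat)%:R / N2%:R :> R by rewrite divr_ge0.
by rewrite /gweight ler_norml => h0; apply/andP; split; lra.
Qed.

(** The layer of height [tau] above [g] over [J] lies in the open cone of [z]. A point of that cone
    lies in a cell below [c] unless it shares the [p]-strip or the [q]-strip of [c], each of area at
    most [1 / N]. *)
Lemma below_area c z J tau : cellset c z -> measurable J ->
  (forall s, J s -> 0 <= s <= 1) -> 0 <= tau ->
  (forall s, J s -> g s + tau <= z.2 - L * `|s - z.1|) ->
  (tau%:E * mu J <= (\sum_(c' in gbelow c) garea (cellset c') + 2 / N%:R)%:E)%E.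
Proof.
move=> zc mJ J01 tau0 H.
have mg := measurable_g.
have mgt : measurable_fun setT (fun x => g x + tau) by apply: measurable_funD.
have mreg := measurable_region mJ mg mgt.
have zb := cellset_box zc; case: (zb) => z01 zp zq.
have cone s v : J s -> v < g s + tau -> v + L * s < z.2 + L * z.1 /\ v - L * s < z.2 - L * z.1.
  move=> Js vs; have h := H _ Js.
  have h1 : L * (s - z.1) <= L * `|s - z.1| by rewrite ler_wpM2l ?ler_norm // (ltW L0).
  have h2 : L * (z.1 - s) <= L * `|s - z.1| by rewrite distrC ler_wpM2l ?ler_norm // (ltW L0).
  by split; lra.
have regwin : region g (fun x => g x + tau) J `<=` gwin.
  move=> [s v] [Js /= /andP[v1 v2]]; have [c1 c2] := cone _ _ Js v2.
  have s01 := J01 _ Js; have gs := Qg s01.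
  have Ls : L * s <= L by rewrite ler_piMr ?(ltW L0) //; case/andP: s01.
  have Ls0 : 0 <= L * s by rewrite mulr_ge0 ?(ltW L0) //; case/andP: s01.
  move: zp zq => /andP[_ zp] /andP[_ zq].
  split => //; split => //; rewrite /pu /qu /=; apply/andP; split.
  - by rewrite mulr_ge0 ?(ltW Np) //; lra.
  - by apply: lt_trans zp; rewrite ltr_pM2r // ltrD2r.
  - by rewrite mulr_ge0 ?(ltW Np) //; lra.
  - by apply: lt_trans zq; rewrite ltr_pM2r // ltrD2r.
rewrite -(mu2_region_cst mJ mg tau0).
rewrite -(setIidl regwin) areaE //; [|exact: measurable_gwin|exact: mu2_gwin].
rewrite lee_fin; set U := \big[setU/set0]_(c' | c' \in gbelow c) cellset c'.
have mU : measurable U by apply: measurable_bigsetU => c'; exact: measurable_cellset.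
have mp := measurable_pstrip c.1.1; have mq := measurable_qstrip c.1.2.
have mUp : measurable (pstrip c.1.1 `|` qstrip c.1.2) by exact: measurableU.
apply: (@le_trans _ _ (garea (U `|` (pstrip c.1.1 `|` qstrip c.1.2)))).
  apply: le_garea => //; first exact: measurableU.
  move=> [s v] [[Js /= /andP[v1 v2]] [vb _]]; have [c1 c2] := cone _ _ Js v2.
  have [c' c'v] := gbox_cell vb; case: (zc) => _ zi zk _; case: (c'v) => _ vi vk _.
  have [e1|ne1] := eqVneq c'.1.1 c.1.1; first by right; left; split => //; rewrite -e1.
  have [e2|ne2] := eqVneq c'.1.2 c.1.2; first by right; right; split => //; rewrite -e2.
  left; apply: (@bigsetU_sup _ _ _ _ c') => //; rewrite inE.
  have mono (u u' : R) (i i' : nat) : u' < u -> ucell u i -> ucell u' i' -> (i' <= i)%N.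
    move=> uu /andP[_ a] /andP[b _]; rewrite -ltnS -(ltr_nat R).
    exact: le_lt_trans b (lt_trans uu a).
  rewrite (mono _ _ _ _ _ zi vi) /=; last by rewrite /pu ltr_pM2r // ltrD2r.
  rewrite (mono _ _ _ _ _ zk vk) /=; last by rewrite /qu ltr_pM2r // ltrD2r.
  by apply: contra ne1 => /eqP ->.
apply: le_trans (area_setU measurable_gwin mu2_gwin mU mUp) _.
rewrite area_bigsetU; [|exact: measurable_gwin|exact: mu2_gwin|exact: measurable_cellset|exact: trivIset_cellset].
rewrite lerD2l; apply: le_trans (area_setU measurable_gwin mu2_gwin mp mq) _.
have -> : 2 / N%:R = N%:R^-1 + N%:R^-1 :> R by ring.
by apply: lerD; [exact: garea_pstrip|exact: garea_qstrip].
Qed.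

End Grid.

(** * Variance of the bracket *)

Section VoidProbabilities.
Variables (R : realType) (K : finType) (lam : K -> R).
Hypothesis lam0 : forall c, 0 <= lam c.
Implicit Types (A B : {set K}) (o : {ffun K -> bool}).

(** Probability that a Poisson variable of mean [lam c] is not 0. *)
Definition hit_prob c := 1 - expR (- lam c).

Lemma hit_prob01 c : 0 <= hit_prob c <= 1.
Proof.
rewrite /hit_prob subr_ge0 gerBl expR_ge0 andbT.
by rewrite -[leRHS]expR0 ler_expR oppr_le0.
Qed.

Lemma hit_prob_le c : hit_prob c <= lam c.
Proof. by rewrite /hit_prob; have := expR_ge1Dx (- lam c); lra. Qed.

(** Second-order cost of replacing an intensity by an occupation probability. *)
Lemma lam_sub_hit_prob c : lam c - hit_prob c <= lam c ^+ 2.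
Proof.
rewrite /hit_prob expRN; have l0 := lam0 c; have := expR_ge1Dx (lam c).
set e := expR _ => he; have e0 : 0 < e by apply: lt_le_trans he; rewrite ltr_pwDl.
have : e^-1 <= (1 + lam c)^-1 by rewrite lef_pV2 ?posrE // ltr_pwDl.
have : (1 + lam c)^-1 <= 1 - lam c + lam c ^+ 2.
  by rewrite -[leLHS]mul1r ler_pdivrMr ?ltr_pwDl //; nra.
lra.
Qed.

Definition voidb A o : bool := [forall c in A, ~~ o c].

Definition mass A : R := \sum_(c in A) lam c.

Lemma mass_ge0 A : 0 <= mass A. Proof. exact: sumr_ge0. Qed.

Lemma Ex_void A : Ex hit_prob (fun o => (voidb A o)%:R) = expR (- mass A).
Proof.
pose f c v : R := if c \in A then (~~ v)%:R else 1.
have e o : (voidb A o)%:R = \prod_c f c (o c).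
  have [/forall_inP h|] := boolP (voidb A o).
    by rewrite big1 // => c _; rewrite /f; case: ifP => // /h ->.
  rewrite /voidb negb_forall_in => /exists_inP[c cA oc].
  by rewrite (bigD1 c) //= /f cA (negbTE oc) mul0r.
rewrite (Ex_ext _ e) Ex_prod /mass -sumrN expR_sum [RHS]big_mkcond /=.
apply: eq_bigr => c _; rewrite /f /hit_prob; case: ifP => _ /=; ring.
Qed.

Lemma voidbU A B o : (voidb A o)%:R * (voidb B o)%:R = (voidb (A :|: B) o)%:R :> R.
Proof.
rewrite -natrM mulnb; congr (nat_of_bool _)%:R; apply/andP/forall_inP.
  by move=> [/forall_inP hA /forall_inP hB] c /setUP[/hA|/hB].
by move=> h; split; apply/forall_inP => c cA; apply: h; rewrite inE cA ?orbT.
Qed.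

Lemma massU A B : mass (A :|: B) + mass (A :&: B) = mass A + mass B.
Proof.
rewrite /mass ![\sum_(c in _) _]big_mkcond -!big_split; apply: eq_bigr => c _ /=.
by rewrite !inE; case: (c \in A); case: (c \in B); rewrite /= ?addr0 ?add0r.
Qed.

Lemma le_mass A B : {subset A <= B} -> mass A <= mass B.
Proof.
move=> AB; rewrite /mass ![\sum_(c in _) _]big_mkcond; apply: ler_sum => c _.
by case: ifP => [/AB ->//|_]; case: ifP.
Qed.

(** Sets sharing no mass have independent void events. Otherwise the union has mass at least the
    average of the two; the halved exponents turn the bound into a product, so that double sums
    factorize. *)
Lemma void_covariance A B :
  Ex hit_prob (fun o => (voidb A o)%:R * (voidb B o)%:R) - expR (- mass A) * expR (- mass B)
  <= if 0 < mass (A :&: B) then expR (- (mass A / 2)) * expR (- (mass B / 2)) else 0.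
Proof.
rewrite (Ex_ext _ (voidbU A B)) Ex_void -!expRD.
have mU := massU A B; have mI := mass_ge0 (A :&: B).
case: ltP => h.
  have mA : mass A <= mass (A :|: B) by apply: le_mass => c; rewrite inE => ->.
  have mB : mass B <= mass (A :|: B) by apply: le_mass => c; rewrite inE orbC => ->.
  apply: (@le_trans _ _ (expR (- mass (A :|: B)))); first by rewrite gerBl expR_ge0.
  by rewrite ler_expR; lra.
have -> : mass (A :|: B) = mass A + mass B by lra.
by rewrite opprD subrr.
Qed.

Variables (D : K -> {set K}) (a : K -> R) (k : R).
Hypothesis k0 : 0 <= k.
Hypothesis a0 : forall c, 0 <= a c <= k * lam c.
Variables (near : rel K) (reach : pred K) (A1 A2 A3 : R).
Hypothesis overlap : forall c c', 0 < lam c -> 0 < lam c' -> 0 < mass (D c :&: D c') ->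
  [|| near c c', reach c | reach c'].
Let u c := lam c * expR (- (mass (D c) / 2)).
Hypothesis A20 : 0 <= A2.
Hypothesis sumA1 : \sum_c u c <= A1.
Hypothesis sumA2 : forall c, 0 < lam c -> \sum_(c' | near c c') u c' <= A2.
Hypothesis sumA3 : \sum_(c | reach c) u c <= A3.

(** Only pairs of sets sharing mass have positive covariance bounds. Near pairs contribute
    [A1 * A2], and pairs with a far-reaching member [A3 * A1], once for each of the two members. *)
Lemma void_variance (V : {ffun K -> bool} -> R) :
  (forall o, V o = \sum_c a c * (voidb (D c) o)%:R) ->
  Ex hit_prob (fun o => (V o - Ex hit_prob V) ^+ 2) <= k ^+ 2 * (A1 * A2 + 2 * (A3 * A1)).
Proof.
move=> VE; have u0 c : 0 <= u c by rewrite mulr_ge0 // expR_ge0.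
have EV : Ex hit_prob V = \sum_c a c * expR (- mass (D c)).
  by rewrite (Ex_ext _ VE) Ex_sum; apply: eq_bigr => c _; rewrite ExZ Ex_void.
have -> : Ex hit_prob (fun o => (V o - Ex hit_prob V) ^+ 2) =
    \sum_c \sum_c' a c * a c' * (Ex hit_prob (fun o => (voidb (D c) o)%:R * (voidb (D c') o)%:R)
      - expR (- mass (D c)) * expR (- mass (D c'))).
  have -> : Ex hit_prob (fun o => (V o - Ex hit_prob V) ^+ 2) =
      Ex hit_prob (fun o => V o * V o) - Ex hit_prob V * Ex hit_prob V.
    set m := Ex hit_prob V.
    rewrite (@Ex_ext _ _ _ _ (fun o => V o * V o + ((- 2 * m) * V o + m ^+ 2))) => [|o]; last by ring.
    by rewrite !ExD ExZ Ex_cst -/m; ring.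
  rewrite [X in Ex hit_prob X](_ : _ = fun o => \sum_c \sum_c' a c * a c' * ((voidb (D c) o)%:R * (voidb (D c') o)%:R)); last first.
    apply/funext => o; rewrite !VE mulr_suml; apply: eq_bigr => c _.
    by rewrite mulr_sumr; apply: eq_bigr => c' _; ring.
  rewrite Ex_sum EV mulr_suml -sumrB; apply: eq_bigr => c _.
  rewrite Ex_sum mulr_sumr -sumrB; apply: eq_bigr => c' _.
  by rewrite ExZ; ring.
apply: (@le_trans _ _ (\sum_c \sum_c' k ^+ 2 * (u c * u c' *
    ((0 < lam c)%R && near c c')%:R + u c * u c' * (reach c)%:R + u c * u c' * (reach c')%:R))).
  apply: ler_sum => c _; apply: ler_sum => c' _.
  have /andP[ac0 ac1] := a0 c; have /andP[ac0' ac1'] := a0 c'.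
  set b1 : R := _%:R; set b2 : R := _%:R; set b3 : R := _%:R.
  have uu : 0 <= u c * u c' by rewrite mulr_ge0.
  have b0 : 0 <= u c * u c' * b1 + u c * u c' * b2 + u c * u c' * b3.
    by rewrite !addr_ge0 // mulr_ge0.
  have rhs0 : 0 <= k ^+ 2 * (u c * u c' * b1 + u c * u c' * b2 + u c * u c' * b3).
    by rewrite mulr_ge0 // sqr_ge0.
  have aa : 0 <= a c * a c' by rewrite mulr_ge0.
  apply: (le_trans (ler_wpM2l aa (void_covariance _ _))).
  case: ltP => h; last by rewrite mulr0.
  (* The overlap hypothesis concerns cells of positive intensity; the others have coefficient 0. *)
  have zero d : lam d = 0 -> a d = 0.
    move=> e; have /andP[x y] := a0 d; rewrite e mulr0 in y.
    by apply/eqP; rewrite eq_le x y.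
  have [lc|lc] := ltP 0 (lam c); last first.
    by rewrite (zero c) ?mul0r //; apply/eqP; rewrite eq_le lc lam0.
  have [lc'|lc'] := ltP 0 (lam c'); last first.
    by rewrite (zero c') ?mulr0 ?mul0r //; apply/eqP; rewrite eq_le lc' lam0.
  have b1' : 1 <= b1 + b2 + b3.
    rewrite /b1 /b2 /b3 lc /=; have := overlap lc lc' h.
    by case: near; case: (reach c); case: (reach c') => //=; lra.
  apply: (@le_trans _ _ ((k * lam c) * (k * lam c') *
      (expR (- (mass (D c) / 2)) * expR (- (mass (D c') / 2))))).
    by rewrite ler_wpM2r ?mulr_ge0 ?expR_ge0 // ler_pM.
  have -> : (k * lam c) * (k * lam c') * (expR (- (mass (D c) / 2)) * expR (- (mass (D c') / 2)))
    = k ^+ 2 * (u c * u c' * 1) by rewrite /u; ring.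
  rewrite ler_wpM2l ?sqr_ge0 // -!mulrDr ler_wpM2l //.
under eq_bigr do rewrite -mulr_sumr.
rewrite -mulr_sumr ler_wpM2l ?sqr_ge0 //.
under eq_bigr do rewrite !big_split /=.
rewrite !big_split /=.
have S1 : 0 <= \sum_c u c by apply: sumr_ge0.
have S3 : 0 <= \sum_(c | reach c) u c by apply: sumr_ge0.
have R1 : \sum_c \sum_c' u c * u c' * ((0 < lam c)%R && near c c')%:R <= A1 * A2.
  apply: (@le_trans _ _ (\sum_c u c * A2)); last by rewrite -mulr_suml ler_wpM2r.
  apply: ler_sum => c _; have [lc|lc] := ltP 0 (lam c); last first.
    rewrite big1 => [|c' _]; first by rewrite mulr_ge0.
    by rewrite mulr0.
  rewrite (eq_bigr (fun c' => u c * (if near c c' then u c' else 0))); last first.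
    by move=> c' _; rewrite /=; case: near; rewrite ?mulr1 ?mulr0.
  by rewrite -mulr_sumr -big_mkcond ler_wpM2l // sumA2.
have R2 : \sum_c \sum_c' u c * u c' * (reach c)%:R <= A3 * A1.
  rewrite (eq_bigr (fun c => (if reach c then u c else 0) * \sum_c' u c')); last first.
    move=> c _; rewrite mulr_sumr; apply: eq_bigr => c' _.
    by case: reach; rewrite ?mulr1 ?mulr0 ?mul0r.
  by rewrite -mulr_suml -big_mkcond ler_pM.
have R3 : \sum_c \sum_c' u c * u c' * (reach c')%:R <= A3 * A1.
  rewrite exchange_big; apply: le_trans R2.
  by apply: ler_sum => c _; apply: ler_sum => c' _; rewrite (mulrC (u c)).
by rewrite mulr2n mulrDl mul1r addrA !lerD.
Qed.

End VoidProbabilities.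

(** Strengthened to [2 (1 - exp (- k))], the bound passes through the induction thanks to
    [exp (- 1) <= 1 / 2]. *)
Lemma sum_expRN_le2 (R : realType) (k : nat) : \sum_(i < k) expR (- (i%:R : R)) <= 2.
Proof.
suff : \sum_(i < k) expR (- (i%:R : R)) <= 2 * (1 - expR (- k%:R)).
  by move=> h; apply: le_trans h _; have := expR_ge0 (- (k%:R : R)); lra.
elim: k => [|k IH]; first by rewrite big_ord0 oppr0 expR0 subrr mulr0.
rewrite big_ord_recr /= -[k.+1%:R]natr1 opprD expRD.
have e1 : expR (- 1) <= 2^-1 :> R.
  rewrite expRN lef_pV2 ?posrE ?expR_gt0 //.
  by have := expR_ge1Dx (1 : R); lra.
have := expR_ge0 (- (k%:R : R)); nra.
Qed.

(** * Exponential decay of void probabilities on the grid *)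

Section GridVariance.
Variable R : realType.
Local Notation mu := (@lebesgue_measure R).
Local Notation mu2 := (mu \x mu)%E.
Variables (L : R) (g w : R -> R) (M Qb N N2 n : nat).
Hypothesis L0 : 0 < L.
Hypothesis g_lip : forall x y, `|g y - g x| <= L * `|y - x|.
Hypothesis mw : measurable_fun setT w.
Hypothesis wM : forall x, `|w x| <= M%:R.
Hypothesis N0 : (0 < N)%N.
Hypothesis N20 : (0 < N2)%N.
Hypothesis Qg : forall x, 0 <= x <= 1 -> L - Qb%:R <= g x.
Hypothesis n0 : (0 < n)%N.
Hypothesis nN : (2 * n <= N)%N.

Local Notation K := (gcell M Qb N N2).
Local Notation cs := (@cellset R L w M Qb N N2).
Local Notation W := (gwin L g Qb N).
Local Notation ar := (garea L g Qb N).
Local Notation bel := (@gbelow M Qb N N2).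
Implicit Types (c : K) (z : R * R) (J : set R).

Definition glam c : R := n%:R * ar (cs c).

Let mW : measurable W. Proof. exact: measurable_gwin. Qed.
Let fW : (mu2 W < +oo)%E. Proof. exact: mu2_gwin. Qed.
Let mcs c : measurable (cs c). Proof. exact: measurable_cellset. Qed.
Let tcs : trivIset setT cs. Proof. exact: trivIset_cellset. Qed.
Let Np : (0 : R) < N%:R. Proof. by rewrite ltr0n. Qed.
Let np : (0 : R) < n%:R. Proof. by rewrite ltr0n. Qed.
Let nN1 : 2 * n%:R / N%:R <= 1 :> R.
Proof. by rewrite ler_pdivrMr // mul1r -natrM ler_nat. Qed.

Lemma glam_ge0 c : 0 <= glam c.
Proof. by rewrite mulr_ge0 // garea_ge0. Qed.

Lemma cellset_empty c : (forall z, cs c z -> ~ W z) -> ar (cs c) = 0.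
Proof.
move=> h; rewrite /garea /area (_ : cs c `&` W = set0) ?measure0 //.
by rewrite -subset0 => z [zc zW]; exact: h zc zW.
Qed.

Lemma glam_gt0_point c : 0 < glam c -> exists z, (cs c `&` W) z.
Proof.
apply: contraPP => /forallNP h; rewrite /glam cellset_empty ?mulr0 ?ltxx //.
by move=> z zc zW; apply: (h z).
Qed.

(** The region above [f] is cut into layers of height [tau], each of area at most [tau * j]. A cell
    meeting layer [k] has [F c <= A exp (- k)], so splitting the area of each cell among the layers
    leaves a geometric sum, at most 2. *)
Lemma level_sum (F : K -> R) (f : R -> R) J (j A tau B : R) :
  0 <= A -> 0 < tau -> measurable J -> (mu J <= j%:E)%E -> measurable_fun setT f ->
  (forall c, 0 <= F c) ->
  (forall c z, F c != 0 -> cs c z -> W z -> [/\ J z.1, f z.1 <= z.2 & - B <= f z.1]) ->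
  (forall c z (k : nat), cs c z -> W z -> f z.1 + k%:R * tau <= z.2 -> F c <= A * expR (- k%:R)) ->
  \sum_c ar (cs c) * F c <= 2 * A * tau * j.
Proof.
move=> A0 tau0 mJ muJ mf F0 FJ Fk.
pose kmax := (Num.truncn ((Qb%:R + B) / tau)).+1.
pose lev (k : 'I_kmax) := region (fun x => f x + k%:R * tau) (fun x => f x + k%:R * tau + tau) J.
have mfk (k : 'I_kmax) : measurable_fun setT (fun x => f x + k%:R * tau).
  exact: measurable_funD.
have mlev k : measurable (lev k).
  apply: measurable_region => //; exact: measurable_funD.
have tlev : trivIset setT lev.
  move=> k k' _ _ [z [[_ /andP[a1 a2]] [_ /andP[b1 b2]]]]; apply: val_inj => /=.
  apply: (@ucell_inj R ((z.2 - f z.1) / tau)); rewrite /ucell ler_pdivlMr // ltr_pdivrMr // -natr1.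
    by apply/andP; split; lra.
  by apply/andP; split; lra.
have j0 : 0 <= j by rewrite -lee_fin; apply: le_trans muJ.
have arlev k : ar (lev k) <= tau * j.
  apply: garea_le_mu2 => //; first exact: mlev.
  have e := mu2_region_cst mJ (mfk k) (ltW tau0).
  apply: (@le_trans _ _ (tau%:E * mu J)%E).
    by rewrite le_eqVlt; apply/orP; left; apply/eqP; exact: e.
  by rewrite EFinM lee_wpmul2l // lee_fin ltW.
have step c : ar (cs c) * F c <= \sum_k ar (cs c `&` lev k) * (A * expR (- k%:R)).
  have [Fc0|Fc] := eqVneq (F c) 0.
    rewrite Fc0 mulr0; apply: sumr_ge0 => k _.
    by rewrite mulr_ge0 ?garea_ge0 // mulr_ge0 // expR_ge0.
  rewrite {1}/garea (area_partition mW fW (mcs c) mlev tlev); last first.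
    move=> z zc zW; have [Jz fz Bz] := FJ _ _ Fc zc zW.
    have zQ : z.2 < Qb%:R by case: zW => zb _; have /andP[] := gbox_bounds N0 zb.
    have y0 : 0 <= (z.2 - f z.1) / tau by rewrite divr_ge0 ?subr_ge0 ?(ltW tau0).
    have /andP[t1 t2] := truncn_itv y0; set k := Num.truncn _ in t1 t2.
    have kk : (k < kmax)%N.
      rewrite ltnS; apply: le_truncn; rewrite ler_pM2r ?invr_gt0 //; lra.
    exists (Ordinal kk); split => //=.
    move: t1 t2; rewrite ler_pdivlMr // ltr_pdivrMr // -natr1 => t1 t2.
    by apply/andP; split; lra.
  rewrite mulr_suml; apply: ler_sum => k _.
  have [[z [[zc zl] zW]]|no] := pselect (exists z, (cs c `&` lev k `&` W) z).
    rewrite ler_wpM2l ?area_ge0 //; apply: (Fk _ z) => //.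
    by case: zl => _ /andP[].
  rewrite /garea /area (_ : cs c `&` lev k `&` W = set0) ?measure0 ?mul0r //.
  by rewrite -subset0 => z hz; apply: no; exists z.
apply: le_trans (ler_sum _ (fun c _ => step c)) _.
rewrite exchange_big /=.
have sumk k : \sum_c ar (cs c `&` lev k) * (A * expR (- k%:R)) <= tau * j * A * expR (- k%:R).
  rewrite -mulr_suml -[leRHS]mulrA ler_wpM2r ?mulr_ge0 ?expR_ge0 //.
  apply: le_trans (arlev k); rewrite /garea.
  rewrite -(@area_bigsetU _ _ mW fW _ predT); last 2 first.
  - by move=> c; exact: measurableI.
  - by move=> c c' _ _ [z [[zc _] [zc' _]]]; apply: (tcs (i := c) (j := c')) => //; exists z.
  apply: le_area => //.
    by apply: measurable_bigsetU => c; exact: measurableI.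
  by move=> z [bz _]; have [c _ []] := bigsetUP bz.
apply: le_trans (ler_sum _ (fun k _ => sumk k)) _.
rewrite -mulr_sumr; have -> : 2 * A * tau * j = tau * j * A * 2 by ring.
by rewrite ler_wpM2l ?sum_expRN_le2 // !mulr_ge0 // ltW.
Qed.

(** The cells below [c] miss at most area [2 / N] of the layer under the cone, that is, intensity at
    most [2 n / N <= 1]. *)
Lemma mass_lower c z (a b tau : R) : cs c z -> a <= b -> 0 <= a -> b <= 1 -> 0 <= tau ->
  (forall s, a <= s <= b -> g s + tau <= z.2 - L * `|s - z.1|) ->
  n%:R * tau * (b - a) - 1 <= mass glam (bel c).
Proof.
move=> zc ab a0 b1 tau0 H.
have := @below_area _ _ _ _ _ _ _ _ L0 g_lip mw wM N0 N20 Qg c z `[a, b]%classic tau zc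
  (measurable_itv _) _ tau0 _.
rewrite lebesgue_measure_itv /= lte_fin.
have -> : (if a < b then (b%:E - a%:E)%E else 0%E) = (b - a)%:E.
  case: ltP => // ba; congr (_%:E); have -> : b = a by apply/eqP; rewrite eq_le ab ba.
  by rewrite subrr.
rewrite -EFinM lee_fin => h.
have {h} : tau * (b - a) <= \sum_(c' in bel c) ar (cs c') + 2 / N%:R.
  apply: h => s; rewrite in_itv /= => /andP[s1 s2]; last by apply: H; rewrite s1.
  by rewrite (le_trans a0 s1) (le_trans s2 b1).
set S := \sum_(c' in bel c) _ => h; rewrite /mass /glam -mulr_sumr -/S.
have := ler_wpM2l (ltW np) h.
have -> : n%:R * (S + 2 / N%:R) = n%:R * S + 2 * n%:R / N%:R by ring.
by rewrite mulrA; move: nN1; lra.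
Qed.

(** The cone of a point at height [t] above [g] contains a layer of height [t / 2] and width [h].
    The resulting intensity, quadratic in [t] for small [t], is bounded below by a linear function
    of [t], as exponential layers require. *)
Lemma mass_base c z : cs c z -> W z ->
  Num.sqrt n%:R * (z.2 - g z.1) / 4 - 2 * L - 1 <= mass glam (bel c).
Proof.
move=> zc [zb zg]; case: (zb) => /andP[z0 z1] _ _.
set t := z.2 - g z.1; have t0 : 0 <= t by rewrite subr_ge0.
pose s := Num.sqrt n%:R : R; rewrite -/s.
have s1 : 1 <= s by rewrite -[leLHS]sqrtr1 ler_wsqrtr // ler1n.
have ss : s ^+ 2 = n%:R by rewrite sqr_sqrtr // ltW.
(* Over a distance [h] the cone descends and [g] rises by at most [L h] each, together at most
   [t / 2]. As [h <= 1 / 2], one of the two sides of [z.1] stays within the unit interval. *)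
pose h := Num.min (t / (4 * L)) 2^-1.
have L4 : 0 < 4 * L by rewrite mulr_gt0.
have h0 : 0 <= h by rewrite le_min divr_ge0 ?(ltW L4) //= invr_ge0.
have h1 : h <= 2^-1 by rewrite ge_min lexx orbT.
have ht : h * (4 * L) <= t by rewrite -ler_pdivlMr // ge_min lexx.
have close x : `|x - z.1| <= h -> g x + t / 2 <= z.2 - L * `|x - z.1|.
  move=> xz; have := g_lip z.1 x; have := ler_wpM2l (ltW L0) xz.
  by rewrite ler_norml /t in ht *; lra.
have key : n%:R * (t / 2) * h - 1 <= mass glam (bel c).
  have [zh|zh] := leP z.1 2^-1.
    have -> : h = (z.1 + h) - z.1 by rewrite addrAC subrr add0r.
    apply: (mass_lower zc) => //; rewrite ?lerDl ?divr_ge0 //; first by lra.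
    move=> x /andP[x1 x2]; apply: close.
    by rewrite ger0_norm ?subr_ge0 //; lra.
  have -> : h = z.1 - (z.1 - h) by rewrite opprB addrC subrK.
  apply: (mass_lower zc) => //; rewrite ?gerBl ?divr_ge0 //; first by lra.
  move=> x /andP[x1 x2]; apply: close.
  by rewrite distrC ger0_norm ?subr_ge0 //; lra.
apply: le_trans key; rewrite lerD2r -ss.
have st0 : 0 <= s * t by rewrite mulr_ge0 // (le_trans ler01).
have [hE|hE] := leP (t / (4 * L)) 2^-1.
  have -> : h = t / (4 * L) by rewrite /h min_l.
  have -> : s ^+ 2 * (t / 2) * (t / (4 * L)) = (s * t) ^+ 2 / (8 * L) by field; rewrite gt_eqF.
  apply: (@le_trans _ _ (s * t - 2 * L)); first by lra.
  rewrite ler_pdivlMr ?mulr_gt0 //.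
  have := sqr_ge0 (s * t - 4 * L); rewrite !expr2; lra.
have -> : h = 2^-1 by rewrite /h min_r // ltW.
have : s * t <= s ^+ 2 * t by rewrite ler_wpM2r // expr2 ler_peMl // (le_trans ler01).
lra.
Qed.

(** Indices are compared weakly, so a point of a lower cell may exceed [z] by one mesh width in
    either cone coordinate. *)
Lemma cellset_below_cone c c' z z' : c' \in bel c -> cs c z -> cs c' z' ->
  z'.2 + L * z'.1 <= z.2 + L * z.1 + N%:R^-1 /\
  z'.2 - L * z'.1 <= z.2 - L * z.1 + N%:R^-1.
Proof.
rewrite inE => /and3P[ii kk _] [_ zi zk _] [_ zi' zk' _].
have aux (u u' : R) (i i' : nat) : (i' <= i)%N -> ucell (u * N%:R) i -> ucell (u' * N%:R) i' ->
    u' <= u + N%:R^-1.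
  move=> hi /andP[h1 _] /andP[_ h2].
  have h3 : i'.+1%:R <= i%:R + 1 :> R by rewrite natr1 ler_nat.
  have h4 : u' * N%:R <= u * N%:R + 1 by lra.
  rewrite -(ler_pM2r Np) mulrDl mulVf ?gt_eqF //.
have := aux _ _ _ _ ii zi zi'; have := aux _ _ _ _ kk zk zk'.
by move=> h1 h2; split; lra.
Qed.

(** The abscissa is the difference of the two cone coordinates divided by [2 L]. *)
Lemma cellset_width c z z' : cs c z -> cs c z' -> `|z.1 - z'.1| <= (L * N%:R)^-1.
Proof.
move=> [_ /andP[a1 a2] /andP[b1 b2] _] [_ /andP[a1' a2'] /andP[b1' b2'] _].
rewrite -natr1 in a2 a2' b2 b2'.
have LN : 0 < L * N%:R by rewrite mulr_gt0.
rewrite -(ler_pM2l LN) divff ?gt_eqF //.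
rewrite -[X in X * _]ger0_norm ?(ltW LN) // -normrM.
have -> : L * N%:R * (z.1 - z'.1) = ((pu L Qb N z - pu L Qb N z') - (qu L Qb N z - qu L Qb N z')) / 2.
  by rewrite /pu /qu; field.
by rewrite ler_norml; apply/andP; split; lra.
Qed.

Section Reach.
Variable rho : R.
Hypothesis rho0 : 0 < rho.
Hypothesis rho1 : rho <= 1.

(* [sgn] is [-1] on the left side and [1] on the right side of the cell. *)
Definition reach_base (sgn : R) (x : R) : R := g (x + sgn * rho) + L * rho - N%:R^-1.

(** What a cone reaching sideways to distance [rho] implies for the height and for the mass below,
    in the form used by the layer sum; it is asked of all points of the cell in the window because
    layers cut through cells. *)
Definition side_reach (sgn : R) c : bool :=
  `[< forall z, cs c z -> W z -> reach_base sgn z.1 <= z.2 /\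
      n%:R * rho * (z.2 - reach_base sgn z.1 - N%:R^-1) - 1 <= mass glam (bel c) >].

(** A point of the epigraph at least [rho] to the left, in a lower cell, forces the cone of [z]
    above [g] at [m], up to [1 / N], because [g] is [L]-Lipschitz. The excess of the cone over [g]
    does not decrease from [m] to [z.1], so a layer of width [rho] fits below. *)
Lemma reach_left c c' z z' : c' \in bel c -> cs c z -> W z -> cs c' z' -> W z' ->
  z'.1 + rho <= z.1 -> reach_base (- 1) z.1 <= z.2 /\
    n%:R * rho * (z.2 - reach_base (- 1) z.1 - N%:R^-1) - 1 <= mass glam (bel c).
Proof.
move=> cc' zc zW zc' zW' far; have [h1 h2] := cellset_below_cone cc' zc zc'.
case: (zW) => -[/andP[z0 z1] _ _] zg; case: (zW') => -[/andP[z0' z1'] _ _] zg'.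
rewrite /epi /= in zg zg'; rewrite /reach_base mulN1r; set m := z.1 - rho.
have gm' : g m - g z'.1 <= L * (m - z'.1).
  have := g_lip z'.1 m; rewrite (@ger0_norm _ (m - z'.1)); last by rewrite /m; lra.
  exact: le_trans (ler_norm _).
have fz : g m + L * rho - N%:R^-1 <= z.2 by move: gm'; rewrite /m; lra.
split => //; set tau := z.2 - _ - _.
have tauE : tau = z.2 - (g m + L * rho) by rewrite /tau; ring.
have [tau0|tau0] := leP 0 tau; last first.
  apply: (@le_trans _ _ 0); last by apply: mass_ge0; exact: glam_ge0.
  by have : n%:R * rho * tau <= 0; [rewrite mulr_ge0_le0 ?mulr_ge0 ?(ltW rho0) // ltW|lra].
have -> : n%:R * rho * tau = n%:R * tau * (z.1 - m) by rewrite /m; ring.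
apply: (mass_lower zc) => //; rewrite ?lerBlDr ?lerDl ?(ltW rho0) //; first by rewrite /m; lra.
move=> s /andP[s1 s2]; rewrite distrC ger0_norm ?subr_ge0 //.
have : g s - g m <= L * (s - m).
  have := g_lip m s; rewrite (@ger0_norm _ (s - m)) ?subr_ge0 //.
  exact: le_trans (ler_norm _).
rewrite tauE /m; lra.
Qed.

Lemma reach_right c c' z z' : c' \in bel c -> cs c z -> W z -> cs c' z' -> W z' ->
  z.1 + rho <= z'.1 -> reach_base 1 z.1 <= z.2 /\
    n%:R * rho * (z.2 - reach_base 1 z.1 - N%:R^-1) - 1 <= mass glam (bel c).
Proof.
move=> cc' zc zW zc' zW' far; have [h1 h2] := cellset_below_cone cc' zc zc'.
case: (zW) => -[/andP[z0 z1] _ _] zg; case: (zW') => -[/andP[z0' z1'] _ _] zg'.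
rewrite /epi /= in zg zg'; rewrite /reach_base mul1r; set m := z.1 + rho.
have gm' : g m - g z'.1 <= L * (z'.1 - m).
  have := g_lip z'.1 m; rewrite distrC (distrC m) (@ger0_norm _ (z'.1 - m)); last by rewrite /m; lra.
  by rewrite distrC; exact: le_trans (ler_norm _).
have fz : g m + L * rho - N%:R^-1 <= z.2 by move: gm'; rewrite /m; lra.
split => //; set tau := z.2 - _ - _.
have tauE : tau = z.2 - (g m + L * rho) by rewrite /tau; ring.
have [tau0|tau0] := leP 0 tau; last first.
  apply: (@le_trans _ _ 0); last by apply: mass_ge0; exact: glam_ge0.
  by have : n%:R * rho * tau <= 0; [rewrite mulr_ge0_le0 ?mulr_ge0 ?(ltW rho0) // ltW|lra].
have -> : n%:R * rho * tau = n%:R * tau * (m - z.1) by rewrite /m; ring.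
apply: (mass_lower zc) => //; rewrite ?lerDl ?(ltW rho0) //; first by rewrite /m; lra.
move=> s /andP[s1 s2]; rewrite ger0_norm ?subr_ge0 //.
have : g s - g m <= L * (m - s).
  have := g_lip m s; rewrite (distrC s) (@ger0_norm _ (m - s)) ?subr_ge0 //.
  exact: le_trans (ler_norm _).
rewrite tauE /m; lra.
Qed.

Let u c := glam c * expR (- (mass glam (bel c) / 2)).

(** Layers of height [2 / (n rho)] above [reach_base] each damp the sum by [exp (- 1)]. Their width
    is 1 and [n] cancels, which leaves a bound in [1 / rho] alone. *)
Lemma side_reach_sum sgn : `|sgn| = 1 -> \sum_(c | side_reach sgn c) u c <= 4 * expR 1 / rho.
Proof.
move=> sgn1; pose F c := if side_reach sgn c then expR (- (mass glam (bel c) / 2)) else 0.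
rewrite big_mkcond /= (eq_bigr (fun c => n%:R * (ar (cs c) * F c))); last first.
  by move=> c _; rewrite /F /u /glam; case: ifP; rewrite ?mulrA ?mulr0.
have nr : 0 < n%:R * rho by rewrite mulr_gt0.
have nr1 : n%:R * rho / N%:R <= 1.
  apply: le_trans nN1; rewrite ler_pM2r ?invr_gt0 //.
  by have : n%:R * rho <= n%:R; [rewrite ler_piMr // ltW|move: np; lra].
rewrite -mulr_sumr.
have := @level_sum F (reach_base sgn) [set x | 0 <= x <= 1] 1 (expR 1) (2 / (n%:R * rho)) (Qb%:R + 1).
have mu1 : measurable [set x : R | 0 <= x <= 1] by exact: measurable_unit.
rewrite expR_ge0 mu_unit lexx divr_gt0 // => /(_ isT isT mu1 isT) H.
have {}H : \sum_c ar (cs c) * F c <= 2 * expR 1 * (2 / (n%:R * rho)) * 1.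
  apply: H.
  - rewrite /reach_base; apply: measurable_funB => //; apply: measurable_funD => //.
    by apply: measurableT_comp; [exact: measurable_g L0 g_lip|exact: measurable_funD].
  - by move=> c; rewrite /F; case: ifP; rewrite ?expR_ge0.
  - move=> c z; rewrite /F; case: ifPn => [/asboolP h _|_ /eqP //] zc zW.
    have [a b] := h _ zc zW; case: (zW) => -[z01 _ _] _; split => //.
    have := Qg z01; have := g_lip z.1 (z.1 + sgn * rho).
    rewrite addrAC subrr add0r normrM sgn1 mul1r (ger0_norm (ltW rho0)) ler_norml => /andP[p1 p2].
    have : N%:R^-1 <= 1 :> R by rewrite invf_le1 // ler1n.
    by rewrite /reach_base; move: L0; lra.
  - move=> c z k zc zW hk; rewrite /F; case: ifPn => [/asboolP h|_]; last by rewrite mulr_ge0 ?expR_ge0.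
    have [_ b] := h _ zc zW; rewrite -expRD ler_expR.
    have : n%:R * rho * (k%:R * (2 / (n%:R * rho)) - N%:R^-1) <=
           n%:R * rho * (z.2 - reach_base sgn z.1 - N%:R^-1).
      by rewrite ler_pM2l //; lra.
    have -> : n%:R * rho * (k%:R * (2 / (n%:R * rho)) - N%:R^-1) = 2 * k%:R - n%:R * rho / N%:R.
      by field; rewrite !gt_eqF.
    lra.
apply: le_trans (ler_wpM2l (ltW np) H) _.
by rewrite le_eqVlt; apply/orP; left; apply/eqP; field; rewrite !gt_eqF.
Qed.

End Reach.

Local Notation C1 := (expR (L + 2^-1)).
Let u c := glam c * expR (- (mass glam (bel c) / 2)).

(** Layers of height [8 / sqrt n] above [g]: by [mass_base], the lower bound for half the mass below
    grows by 1 per layer, after a loss of [L + 1 / 2]. *)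
Lemma base_sum (Q : pred K) (J : set R) (j : R) : measurable J -> (mu J <= j%:E)%E ->
  (forall c z, Q c -> cs c z -> W z -> J z.1) ->
  \sum_(c | Q c) u c <= 16 * C1 * Num.sqrt n%:R * j.
Proof.
move=> mJ muJ QJ; pose F c := if Q c then expR (- (mass glam (bel c) / 2)) else 0.
rewrite big_mkcond /= (eq_bigr (fun c => n%:R * (ar (cs c) * F c))); last first.
  by move=> c _; rewrite /F /u /glam; case: ifP; rewrite ?mulrA ?mulr0.
rewrite -mulr_sumr; pose s := Num.sqrt n%:R : R; rewrite -/s.
have s0 : 0 < s by rewrite sqrtr_gt0.
have ss : s ^+ 2 = n%:R by rewrite sqr_sqrtr // ltW.
have H : \sum_c ar (cs c) * F c <= 2 * C1 * (8 / s) * j.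
  apply: (@level_sum F g J j C1 (8 / s) Qb%:R) => //.
  - by rewrite divr_gt0.
  - exact: measurable_g L0 g_lip.
  - by move=> c; rewrite /F; case: ifP; rewrite ?expR_ge0.
  - move=> c z; rewrite /F; case: ifPn => [h _|_ /eqP //] zc zW; split => //.
    + exact: QJ h zc zW.
    + by case: zW.
    + by case: zW => -[z01 _ _] _; have := Qg z01; move: L0; lra.
  - move=> c z k zc zW hk; rewrite /F; case: ifPn => [_|_]; last by rewrite mulr_ge0 ?expR_ge0.
    rewrite -expRD ler_expR; have := mass_base zc zW; rewrite -/s.
    have : s * (k%:R * (8 / s)) <= s * (z.2 - g z.1) by rewrite ler_pM2l //; lra.
    have -> : s * (k%:R * (8 / s)) = 8 * k%:R by field; rewrite gt_eqF.
    lra.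
apply: le_trans (ler_wpM2l (ltW np) H) _.
by rewrite -ss le_eqVlt; apply/orP; left; apply/eqP; field; rewrite !gt_eqF.
Qed.

End GridVariance.

(** * The sieve of the grid and the variance of its bracket *)

Section GridSieve.
Variable R : realType.
Local Notation mu := (@lebesgue_measure R).
Variables (L : R) (g w : R -> R) (M Qb N N2 n : nat).

Lemma glam_nonneg (c : gcell M Qb N N2) : 0 <= glam L g w n c.
Proof. by rewrite /glam mulr_ge0 // garea_ge0. Qed.

Definition gsieve : sieve R := @Sieve R (gcell M Qb N N2) (hit_prob (glam L g w n))
  (@grank M Qb N N2) (@gbelow M Qb N N2) (@gweight R M Qb N N2)
  (hit_prob01 glam_nonneg) (@grank_inj M Qb N N2) (@gbelow_rank M Qb N N2).

Hypothesis L0 : 0 < L.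
Hypothesis g_lip : forall x y, `|g y - g x| <= L * `|y - x|.
Hypothesis mw : measurable_fun setT w.
Hypothesis wM : forall x, `|w x| <= M%:R.
Hypothesis N0 : (0 < N)%N.
Hypothesis N20 : (0 < N2)%N.
Hypothesis Qg : forall x, 0 <= x <= 1 -> L - Qb%:R <= g x.
Hypothesis n0 : (0 < n)%N.
Hypothesis nN : (2 * n <= N)%N.

Local Notation K := (gcell M Qb N N2).
Local Notation cs := (@cellset R L w M Qb N N2).
Local Notation W := (gwin L g Qb N).
Local Notation lam := (@glam R L g w M Qb N N2 n).
Local Notation bel := (@gbelow M Qb N N2).
Local Notation C1 := (expR (L + 2^-1)).
Implicit Types (c : K).

(** Meaningful for cells of positive intensity; [(0, 0)] is a default value. *)
Definition gpoint c : R * R := xget (0, 0) (cs c `&` W).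

Lemma gpointP c : 0 < lam c -> cs c (gpoint c) /\ W (gpoint c).
Proof.
move=> /glam_gt0_point[z hz]; rewrite /gpoint.
by case: xgetP => [z' _ []|/(_ z)].
Qed.

(** Instance of [void_variance] with [A1 = 16 C1 sqrt n], [A2 = 4 r A1] and [A3 = 32 exp 1 / r]. In
    [A1 A2] the factor 1024 is 16 times 16 times 4, in [2 A3 A1] it is 2 times 32 times 16. *)
Lemma gsieve_variance (r : R) : 0 < r <= 1 -> 4 <= r * (L * N%:R) ->
  Ex (@cprob R gsieve) (fun o => (sbrac o - Ex (@cprob R gsieve) (@sbrac R gsieve)) ^+ 2) <=
  M%:R ^+ 4 * (1024 * C1 * (C1 + 2 * expR 1)) * (n%:R * r + Num.sqrt n%:R / r).
Proof.
(* If two cells at distance at least [4 rho] have a common cell below them, one of the two is at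
   least [2 rho] away from it; the width of a cell uses up one [rho]. *)
move=> /andP[r0 r1] rL; pose rho := r / 4.
have rho0 : 0 < rho by rewrite divr_gt0.
have rho1 : rho <= 1 by rewrite /rho; lra.
have LN : 0 < L * N%:R by rewrite mulr_gt0 // ltr0n.
have width : (L * N%:R)^-1 <= rho.
  by rewrite -[leLHS]mul1r ler_pdivrMr // /rho; lra.
pose reach c := side_reach L g w n rho (- 1) c || side_reach L g w n rho 1 c.
pose near c c' := `|(gpoint c).1 - (gpoint c').1| < r.
pose s := Num.sqrt n%:R : R.
have np : (0 : R) < n%:R by rewrite ltr0n.
have s0 : 0 < s by rewrite sqrtr_gt0.
have ss : s ^+ 2 = n%:R by rewrite sqr_sqrtr // ltW.
have C10 : 0 < C1 by rewrite expR_gt0.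
have wid c z : 0 < lam c -> cs c z -> `|(gpoint c).1 - z.1| <= rho.
  move=> lc zc; have [pc _] := gpointP lc.
  exact: le_trans (cellset_width L0 N0 pc zc) width.
have reachP c c' z' : 0 < lam c -> c' \in bel c -> cs c' z' -> W z' ->
    2 * rho <= `|(gpoint c).1 - z'.1| -> reach c.
  move=> lc cc' zc' zW' far; rewrite /reach.
  have [le|gt] := leP z'.1 (gpoint c).1; apply/orP; [left|right]; apply/asboolP => z zc zW.
    apply: (reach_left L0 g_lip mw wM N0 N20 Qg n0 nN rho0 cc' zc zW zc' zW').
    move: far (wid _ _ lc zc); rewrite ger0_norm ?subr_ge0 //.
    by rewrite ler_norml => ? /andP[? ?]; lra.
  apply: (reach_right L0 g_lip mw wM N0 N20 Qg n0 nN rho0 cc' zc zW zc' zW').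
  move: far (wid _ _ lc zc); rewrite distrC ger0_norm ?subr_ge0 ?(ltW gt) //.
  by rewrite ler_norml => ? /andP[? ?]; lra.
have overlap c c' : 0 < lam c -> 0 < lam c' -> 0 < mass lam (bel c :&: bel c') ->
    [|| near c c', reach c | reach c'].
  move=> lc lc' h.
  have [d /andP[dc dc'] ld] : exists2 d, (d \in bel c) && (d \in bel c') & 0 < lam d.
    apply: contraPP h => no; apply/negP; rewrite -leNgt; apply: sumr_le0 => d.
    rewrite inE => hd; rewrite leNgt; apply/negP => ld; apply: no.
    by exists d.
  have [dz dW] := gpointP ld.
  have [nr|far] := ltP `|(gpoint c).1 - (gpoint c').1| r; first by rewrite /near nr.
  apply/orP; right; apply/orP.
  have [f1|f1] := leP (2 * rho) `|(gpoint c).1 - (gpoint d).1|.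
    by left; apply: reachP dz dW f1.
  right; apply: (reachP _ _ _ lc' dc' dz dW).
  have := ler_distD (gpoint d).1 (gpoint c).1 (gpoint c').1.
  rewrite (distrC (gpoint d).1); move: f1 far; rewrite /rho.
  move: `|_ - _| `|_ - _| `|_ - _| => x1 x2 x3; lra.
have unit1 : measurable [set x : R | 0 <= x <= 1] by exact: measurable_unit.
pose u c := lam c * expR (- (mass lam (bel c) / 2)).
have sum1 : \sum_c u c <= 16 * C1 * s * 1.
  apply: (base_sum L0 g_lip mw wM N0 N20 Qg n0 nN (Q := predT) unit1).
    by rewrite mu_unit.
  by move=> c z _ _ [[]].
have sum2 c : 0 < lam c -> \sum_(c' | near c c') u c' <= 16 * C1 * s * (4 * r).
  (* [near] compares representatives, so a point of a near cell may be further away by one cell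
     width; a half-width of [2 r] covers this. *)
  move=> lc; pose J := `[(gpoint c).1 - 2 * r, (gpoint c).1 + 2 * r]%classic.
  (* Cells of zero intensity contribute nothing, and their representative need not lie in them. *)
  pose Q c' := near c c' && (0 < lam c').
  have -> : \sum_(c' | near c c') u c' = \sum_(c' | Q c') u c'.
    rewrite (bigID (fun c' => 0 < lam c')) /= [X in _ + X]big1 ?addr0 // => c' /andP[_ l].
    have -> : u c' = 0; last by [].
    have l0 : lam c' = 0 by apply/eqP; rewrite eq_le glam_nonneg andbT leNgt.
    by rewrite /u l0 mul0r.
  apply: (base_sum L0 g_lip mw wM N0 N20 Qg n0 nN (J := J)).
  - exact: measurable_itv.
  - rewrite lebesgue_measure_itv /= lte_fin ifT; last by lra.
    by rewrite -EFinD lee_fin; lra.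
  - move=> c' z /andP[nr lc'] zc zW; rewrite /J /= in_itv /=.
    have := wid _ _ lc' zc; move: nr; rewrite /near ltr_norml ler_norml /rho.
    by move=> /andP[? ?] /andP[? ?]; apply/andP; split; lra.
have sum3 : \sum_(c | reach c) u c <= 2 * (4 * expR 1 / rho).
  have nl : `|- 1 : R| = 1 by rewrite normrN1.
  have hl : \sum_(c | side_reach L g w n rho (- 1) c) u c <= 4 * expR 1 / rho.
    exact: side_reach_sum nl.
  have hr : \sum_(c | side_reach L g w n rho 1 c) u c <= 4 * expR 1 / rho.
    exact: side_reach_sum (normr1 _).
  have u0 c : 0 <= u c by rewrite mulr_ge0 ?glam_nonneg ?expR_ge0.
  apply: (@le_trans _ _ (\sum_(c | side_reach L g w n rho (- 1) c) u c +
                         \sum_(c | side_reach L g w n rho 1 c) u c)).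
    rewrite [leLHS]big_mkcond [X in _ <= X + _]big_mkcond [X in _ <= _ + X]big_mkcond /=.
    rewrite -big_split /=; apply: ler_sum => c _; have := u0 c; rewrite /reach.
    by do 2 case: side_reach => //=; lra.
  by have := lerD hl hr; rewrite /u; lra.
pose a c := gweight R c ^+ 2 * (hit_prob lam c * (1 - hit_prob lam c)).
have a0 c : 0 <= a c <= M%:R ^+ 2 * lam c.
  have /andP[p0 p1] := hit_prob01 glam_nonneg c.
  have pl := hit_prob_le lam c.
  have q0 : 0 <= hit_prob lam c * (1 - hit_prob lam c) by rewrite mulr_ge0 // subr_ge0.
  rewrite mulr_ge0 ?sqr_ge0 //= ler_pM ?sqr_ge0 //.
    by rewrite -real_normK ?num_real // lerXn2r ?nnegrE ?ler0n // gweight_bound.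
  by apply: le_trans pl; rewrite ler_piMr // gerBl.
have A20 : 0 <= 16 * C1 * s * (4 * r).
  by rewrite !mulr_ge0 ?(ltW C10) ?(ltW s0) ?(ltW r0).
have k0 : 0 <= M%:R ^+ 2 :> R by rewrite sqr_ge0.
have H0 o : sbrac (o : {ffun cell gsieve -> bool}) = \sum_c a c * (voidb (bel c) o)%:R.
  apply: eq_bigr => c _; rewrite /scoef exprMn opened_sqr /a /=.
  have -> : (opened c o : bool) = voidb (bel c) o by [].
  by ring.
have := void_variance glam_nonneg a0 overlap A20 sum1 sum2 sum3 H0.
move=> /le_trans; apply.
rewrite -/s -ss /rho; have e0 := expR_gt0 (1 : R).
set e := expR 1 in e0 *; set C := expR _ in C10 *.
have x0 : 0 <= s ^+ 2 * r by rewrite mulr_ge0 ?sqr_ge0 // ltW.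
have y0 : 0 <= s / r by rewrite divr_ge0 // ltW.
have -> : (M%:R ^+ 2) ^+ 2 * (16 * C * s * 1 * (16 * C * s * (4 * r)) +
    2 * (2 * (4 * e / (r / 4)) * (16 * C * s * 1))) =
    M%:R ^+ 4 * (1024 * C * (C * (s ^+ 2 * r) + e * (s / r))) :> R.
  by field; rewrite gt_eqF.
have C0 := ltW C10; have e0' := ltW e0.
have key : 0 <= 1024 * C * (C * (s / r) + e * (s / r) + 2 * (e * (s ^+ 2 * r))).
  have h1 : 0 <= 1024 * C by rewrite mulr_ge0 ?ler0n.
  apply: mulr_ge0 h1 _; apply: addr_ge0.
    by apply: addr_ge0; apply: mulr_ge0.
  by apply: mulr_ge0; [rewrite ler0n|exact: mulr_ge0].
rewrite -[leRHS]mulrA; apply: ler_wpM2l; first by apply: exprn_ge0.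
rewrite -subr_ge0; apply: (le_trans key).
by rewrite le_eqVlt; apply/orP; left; apply/eqP; ring.
Qed.

End GridSieve.

(** * Poisson counts and cell occupation *)

Section PoissonCounts.
Context {d d' : measure_display} {T : measurableType d} {E : measurableType d'}
  {R : realType}.
Variables (P : probability T R) (S : set E) (Lam : set E -> \bar R) (Z : nat -> T -> E).
Hypothesis ppp : is_poisson_process P S Lam Z.
Hypothesis Lam0 : forall B, measurable B -> (0 <= Lam B)%E.
Implicit Types (B : set E) (t : T).

Local Notation count := (point_count (R := R) Z).

Lemma measurable_count B : measurable B -> measurable_fun setT (count B).
Proof.
move=> mB; apply: ge0_emeasurable_sum => j; first by move=> t _ _; rewrite lee_fin.
move=> _; apply/measurable_EFinP.
by apply: measurableT_comp; [exact: measurable_indic|exact: ppp_measurable ppp j].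
Qed.

Lemma count_ge_partial B t (J : nat) :
  (\sum_(0 <= j < J) (\1_B (Z j t) : R)%:E <= count B t)%E.
Proof. by apply: nneseries_lim_ge => j _; rewrite lee_fin. Qed.

Lemma count_eq0 B t : count B t = 0%E <-> forall j, ~ B (Z j t).
Proof.
split=> [h j Bj|h].
  have := count_ge_partial B t j.+1; rewrite h big_nat_recr //= indicE mem_set //.
  have s0 : (0 <= \sum_(0 <= i < j) (\1_B (Z i t) : R)%:E)%E.
    by apply: sume_ge0 => i _; rewrite lee_fin.
  move=> /(le_trans _) h1; have := h1 1%E.
  by rewrite -[X in (X <= _)%E]add0e leeD2r // => /(_ isT); rewrite lee_fin ler10.
by apply: eseries0 => j _ _; rewrite indicE memNset.
Qed.

(** The count runs over indices, so coinciding points with different indices count separately. *)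
Lemma count_le1_inj B t j j' : count B t = 0%E \/ count B t = 1%E ->
  B (Z j t) -> B (Z j' t) -> j = j'.
Proof.
wlog lt : j j' / (j < j')%N.
  move=> H h Bj Bj'; have [l|l|//] := ltngtP j j'; first exact: H.
  by apply/esym; apply: H.
move=> h Bj Bj'; exfalso.
case: h => h; first by have /count_eq0 := h => /(_ j).
have := count_ge_partial B t j'.+1; rewrite h big_nat_recr //= indicE mem_set //.
have s1 : (1%E <= \sum_(0 <= i < j') (\1_B (Z i t) : R)%:E)%E.
  rewrite (bigD1_seq j) ?mem_index_iota ?iota_uniq //= indicE mem_set //.
  by rewrite leeDl // sume_ge0 // => i _; rewrite lee_fin.
move=> /(le_trans _) h1; have := h1 (1 + 1)%E; rewrite leeD2r // => /(_ isT).
by rewrite -EFinD lee_fin gerDl ler10.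
Qed.

Lemma poisson_void B : measurable B -> (Lam B < +oo)%E ->
  P [set t | count B t = 0%E] = (expR (- fine (Lam B)))%:E.
Proof.
move=> mB fB; have := ppp_poisson ppp mB fB 0; rewrite /= => ->.
have l0 : 0 <= fine (Lam B) by rewrite fine_ge0 // Lam0.
rewrite /poisson_prob; case: ifPn => l.
  rewrite esum_set1 ?lee_fin ?poisson_pmf_ge0 //.
  by rewrite /poisson_pmf l expr0 fact0 invr1 !mul1r.
have -> : fine (Lam B) = 0 by apply/eqP; rewrite eq_le l0 andbT leNgt.
by rewrite oppr0 expR0 diracE mem_set.
Qed.

Lemma poisson_one B : measurable B -> (Lam B < +oo)%E ->
  P [set t | count B t = 1%E] = (fine (Lam B) * expR (- fine (Lam B)))%:E.
Proof.
move=> mB fB; have := ppp_poisson ppp mB fB 1; rewrite /= => ->.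
have l0 : 0 <= fine (Lam B) by rewrite fine_ge0 // Lam0.
rewrite /poisson_prob; case: ifPn => l.
  rewrite esum_set1 ?lee_fin ?poisson_pmf_ge0 //.
  by rewrite /poisson_pmf l expr1 factS fact0 muln1 invr1 mulr1.
have -> : fine (Lam B) = 0 by apply/eqP; rewrite eq_le l0 andbT leNgt.
by rewrite mul0r diracE memNset.
Qed.

Lemma measurable_count_eq B (x : \bar R) : measurable B -> measurable [set t | count B t = x].
Proof.
move=> mB; rewrite -[X in measurable X]setTI.
exact: (measurable_count mB measurableT (emeasurable_set1 x)).
Qed.

(** [1 - (1 + l) exp (- l) <= 1 - (1 + l) (1 - l) = l^2]. *)
Lemma poisson_two B : measurable B -> (Lam B < +oo)%E ->
  (P (~` [set t | count B t = 0%E \/ count B t = 1%E]) <= (fine (Lam B) ^+ 2)%:E)%E.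
Proof.
move=> mB fB; have m0 := measurable_count_eq 0%E mB; have m1 := measurable_count_eq 1%E mB.
have -> : [set t | count B t = 0%E \/ count B t = 1%E] =
    [set t | count B t = 0%E] `|` [set t | count B t = 1%E] by [].
rewrite probability_setC; last exact: measurableU.
have -> : P ([set t | count B t = 0%E] `|` [set t | count B t = 1%E]) =
  (expR (- fine (Lam B)) + fine (Lam B) * expR (- fine (Lam B)))%:E.
  rewrite measureU //; last first.
    rewrite -subset0 => t [/= -> e].
    by have := congr1 fine e => /= /eqP; rewrite eq_sym oner_eq0.
  by rewrite EFinD -poisson_void // -poisson_one.
rewrite -EFinB lee_fin; set l := fine _.
have l0 : 0 <= l by rewrite fine_ge0 // Lam0.
have := expR_ge1Dx (- l); have := expR_ge0 (- l); nra.
Qed.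

Section CellLaw.
Variables (K : finType) (cs : K -> set E).
Hypothesis mcs : forall c, measurable (cs c).
Hypothesis tcs : trivIset setT cs.
Hypothesis fcs : forall c, (Lam (cs c) < +oo)%E.

Definition occupied t : {ffun K -> bool} := [ffun c => `[< exists j, cs c (Z j t) >]].

Lemma occupiedE t c : occupied t c = ~~ `[< count (cs c) t = 0%E >].
Proof.
rewrite ffunE; apply/asboolP/asboolPn; last first.
  by move=> h; apply: contrapT => no; apply: h; apply/count_eq0 => j cj; apply: no; exists j.
by move=> [j cj] /count_eq0 /(_ j).
Qed.

(** A configuration asks each cell for a zero or a nonzero count; independence of the counts of
    disjoint cells factorizes its probability. Cells are enumerated to match the indexing by
    ordinals in the definition of the process. *)
Lemma occupied_law (o : {ffun K -> bool}) :
  measurable [set t | occupied t = o] /\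
  P [set t | occupied t = o] = (bmass (hit_prob (fun c => fine (Lam (cs c)))) o)%:E.
Proof.
pose B (i : 'I_#|K|) := cs (enum_val i).
pose A (i : 'I_#|K|) : set (\bar R) := if o (enum_val i) then ~` [set 0%E] else [set 0%E].
have mA i : measurable (A i).
  rewrite /A; case: ifP => _; last exact: emeasurable_set1.
  by apply: measurableC; exact: emeasurable_set1.
have tB : trivIset setT B.
  by move=> i j _ _ h; apply: enum_val_inj; apply: tcs.
have AE t c : (if o c then ~` [set 0%E] else [set 0%E] : set (\bar R)) (count (cs c) t) <->
    occupied t c = o c.
  rewrite occupiedE; case: (o c) => /=; split.
  - by move=> h; apply/negP => /asboolP.
  - by move=> /negP h e; apply: h; apply/asboolP.
  - by move=> h; apply/negbF/asboolP.
  - by move=> /negbFE/asboolP.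
have eqset : [set t | occupied t = o] = [set t | forall i, A i (count (B i) t)].
  apply/seteqP; split => t /=.
    by move=> e i; apply: (AE t (enum_val i)).2; rewrite e.
  move=> h; apply/ffunP => c; apply: (AE t c).1.
  by have := h (enum_rank c); rewrite /A /B enum_rankK.
split.
  rewrite eqset.
  have -> : [set t | forall i, A i (count (B i) t)] = \bigcap_(i in [set: 'I_#|K|]) [set t | A i (count (B i) t)].
    by apply/seteqP; split => t /= h i; [move=> _; exact: h|exact: h].
  apply: fin_bigcap_measurable => // i _.
  rewrite -[X in measurable X]setTI.
  exact: (measurable_count (mcs _) measurableT (mA i)).
rewrite eqset (ppp_independent ppp) //; last by move=> i; exact: mcs.
rewrite /bmass -prodEFin (reindex (@enum_val K predT)) /=; last first.
  by apply: onW_bij; exact: enum_val_bij.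
apply: eq_bigr => i _; rewrite /A /B.
set c := enum_val i; rewrite /hit_prob subKr.
case: (o c) => /=; last by rewrite -poisson_void.
have -> : [set t | (~` [set 0%E]) (count (cs c) t)] = ~` [set t | count (cs c) t = 0%E] by [].
rewrite probability_setC; last exact: measurable_count_eq.
by rewrite [X in (1 - X)%E]poisson_void.
Qed.

End CellLaw.

End PoissonCounts.

(** * The boundary intensity in terms of areas *)

Section Intensity.
Variable R : realType.
Local Notation mu := (@lebesgue_measure R).
Local Notation mu2 := (mu \x mu)%E.
Variables (L : R) (g : R -> R) (n : nat).
Hypothesis L0 : 0 < L.
Hypothesis g_lip : forall x y, `|g y - g x| <= L * `|y - x|.
Implicit Types (B : set (R * R)).

Lemma stripE : @strip R = [set z | 0 <= z.1 <= 1].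
Proof.
rewrite /strip; apply/seteqP; split => z /=; first by move=> [].
by rewrite in_itv.
Qed.

Lemma intensityE B : measurable B ->
  intensity_measure (boundary_intensity n g) B =
  (n%:R%:E * mu2 (B `&` (strip `&` epi g)))%E.
Proof.
move=> mB; rewrite /intensity_measure /boundary_intensity.
have me := measurable_epi L0 g_lip.
have mS : measurable (@strip R) by rewrite stripE; exact: measurable_01.
have mBS : measurable (B `&` strip) by exact: measurableI.
under eq_integral do rewrite EFinM.
rewrite ge0_integralZl //; last first.
  by apply/measurable_EFinP; apply: measurable_funTS; exact: measurable_indic.
rewrite integral_indic //; congr (_ * mu2 _)%E.
by rewrite setIC setIA.
Qed.

Lemma intensity_ge0 B : measurable B ->
  (0 <= intensity_measure (boundary_intensity n g) B)%E.
Proof. by move=> mB; rewrite intensityE // mule_ge0 // lee_fin. Qed.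

Variables (Qb N : nat).
Hypothesis N0 : (0 < N)%N.

Lemma intensity_box B : measurable B -> B `<=` gbox L Qb N ->
  intensity_measure (boundary_intensity n g) B = (n%:R * garea L g Qb N B)%:E.
Proof.
move=> mB Bb; rewrite intensityE // EFinM; congr (_ * _)%E.
rewrite /garea -areaE //; [|exact: measurable_gwin|exact: mu2_gwin].
congr (mu2 _); apply/seteqP; split => z [Bz].
  by move=> [_ ez]; split => //; split => //; exact: Bb.
by move=> [bz ez]; split => //; split => //; rewrite stripE; case: bz.
Qed.

End Intensity.

(** * Deterministic comparison of the estimator with the sieve *)

Section MleBounds.
Variable R : realType.
Variables (L : R) (g : R -> R) (x y : nat -> R).
Hypothesis L0 : 0 < L.
Hypothesis g_lip : forall x y, `|g y - g x| <= L * `|y - x|.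
Hypothesis hy : forall j, g (x j) <= y j.

Local Notation m := (mle L x y).
Local Notation cones s := (range (fun j => y j + L * `|s - x j|)).

Let cone_ge s j : g s <= y j + L * `|s - x j|.
Proof.
have := g_lip (x j) s; rewrite ler_norml => /andP[_]; have := hy j; lra.
Qed.

Let lbm s : has_lbound (cones s).
Proof. by exists (g s) => _ [j _ <-]; exact: cone_ge. Qed.

Let nem s : cones s !=set0.
Proof. by exists (y 0 + L * `|s - x 0|), 0%N. Qed.

Lemma mle_ge s : g s <= m s.
Proof. by apply: lb_le_inf => // _ [j _ <-]; exact: cone_ge. Qed.

Lemma mle_le s j : m s <= y j + L * `|s - x j|.
Proof. by apply: ge_inf => //; exists j. Qed.

Lemma mle_ltP s u : m s < u -> exists j, y j + L * `|s - x j| < u.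
Proof. by move=> h; have [_ [j _ <-] hj] := inf_lt (nem s) h; exists j. Qed.

Lemma mle_lipschitz s s' : `|m s' - m s| <= L * `|s' - s|.
Proof.
have aux u v : m u <= m v + L * `|u - v|.
  rewrite -lerBlDr; apply: lb_le_inf => // _ [j _ <-]; rewrite lerBlDr.
  apply: le_trans (mle_le u j) _; rewrite -addrA -mulrDr lerD2l ler_wpM2l ?(ltW L0) //.
  by rewrite [leRHS]addrC; exact: ler_distD.

rewrite ler_norml; have := aux s s'; have := aux s' s; rewrite (distrC s s').
by move=> h1 h2; apply/andP; split; lra.
Qed.

End MleBounds.

(** * Good point configurations *)

Section Configuration.
Variable R : realType.
Local Notation mu := (@lebesgue_measure R).
Local Notation mu2 := (mu \x mu)%E.
Variables (L : R) (g w : R -> R) (M Qb N N2 : nat) (x y : nat -> R).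
Hypothesis L0 : 0 < L.
Hypothesis g_lip : forall x y, `|g y - g x| <= L * `|y - x|.
Hypothesis mw : measurable_fun setT w.
Hypothesis wM : forall x, `|w x| <= M%:R.
Hypothesis N0 : (0 < N)%N.
Hypothesis N20 : (0 < N2)%N.
Hypothesis Qg : forall x, 0 <= x <= 1 -> L - Qb%:R <= g x.

Local Notation K := (gcell M Qb N N2).
Local Notation cs := (@cellset R L w M Qb N N2).
Local Notation box := (gbox L Qb N).
Local Notation ar := (garea L g Qb N).
Local Notation bel := (@gbelow M Qb N N2).
Local Notation m := (mle L x y).
Local Notation gw := (@gweight R M Qb N N2).
Local Notation pt j := (x j, y j).

(** With at most one point per strip, the order of the cells decides the order of their points. The
    low point bounds the MLE by [Qb - L - 1] on the unit interval, which keeps the region between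
    [g] and the MLE inside the box. *)
Record good_config : Prop := GoodConfig {
  config_unit : forall j, 0 <= x j <= 1;
  config_epi : forall j, g (x j) <= y j;
  config_pstrip : forall (i : 'I_(gm Qb N)) j j',
    pstrip L i (pt j) -> pstrip L i (pt j') -> j = j';
  config_qstrip : forall (i : 'I_(gm Qb N)) j j',
    qstrip L i (pt j) -> qstrip L i (pt j') -> j = j';
  config_low : exists j, y j <= Qb%:R - 2 * L - 1 }.

Hypothesis good : good_config.
Let hx := config_unit good.
Let hy := config_epi good.
Let hp := config_pstrip good.
Let hq := config_qstrip good.

Definition config_occ : {ffun K -> bool} := [ffun c => `[< exists j, cs c (pt j) >]].
Local Notation beta := config_occ.

Let Np : (0 : R) < N%:R. Proof. by rewrite ltr0n. Qed.

Lemma occP c : reflect (exists j, cs c (pt j)) (beta c).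
Proof. by rewrite ffunE; exact: asboolP. Qed.

Lemma mle_bound s : 0 <= s <= 1 -> m s <= Qb%:R - L - 1.
Proof.
move=> /andP[s0 s1]; have [j yj] := config_low good.
have /andP[x0 x1] := hx j.
have : `|s - x j| <= 1 by rewrite ler_norml; apply/andP; split; lra.
rewrite -(ler_pM2l L0) mulr1; have := mle_le g_lip hy s j; lra.
Qed.

Lemma ucell_mono (u u' : R) (i i' : nat) : u' < u -> ucell u i -> ucell u' i' -> (i' <= i)%N.
Proof.
move=> uu /andP[_ a] /andP[b _]; rewrite -ltnS -(ltr_nat R).
exact: le_lt_trans b (lt_trans uu a).
Qed.

Lemma ucell_sep (u u' : R) (i i' : nat) : (i' < i)%N -> ucell u i -> ucell u' i' -> u' < u.
Proof.
move=> ii /andP[a _] /andP[_ b]; apply: (lt_le_trans b); apply: le_trans a.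
by rewrite ler_nat.
Qed.

Lemma config_cell_inj c j j' : cs c (pt j) -> cs c (pt j') -> j = j'.
Proof. by move=> cj cj'; apply: (@hp c.1.1); [exact: (cellset_pstrip cj)|exact: (cellset_pstrip cj')]. Qed.

(** The larger of [L u] and [- L u] is [L |u|]: the open cone is an open quadrant in cone
    coordinates. *)
Lemma cone_below (z : R * R) j :
  (pu L Qb N (pt j) < pu L Qb N z) && (qu L Qb N (pt j) < qu L Qb N z) =
  (y j + L * `|z.1 - x j| < z.2).
Proof.
rewrite /pu /qu !ltr_pM2r // !ltrD2r /=.
apply/andP/idP => [[h1 h2]|].
  have [h|h] := ler0P (z.1 - x j); lra.
move=> h.
have h1 : L * (z.1 - x j) <= L * `|z.1 - x j| by rewrite ler_wpM2l ?ler_norm // (ltW L0).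
have h2 : L * (x j - z.1) <= L * `|z.1 - x j| by rewrite distrC ler_wpM2l ?ler_norm // (ltW L0).
by split; lra.
Qed.

Lemma config_pos j : 0 <= pu L Qb N (pt j) /\ 0 <= qu L Qb N (pt j).
Proof.
have := Qg (hx j); have := hy j; have /andP[x0 x1] := hx j => h1 h2.
have Lx : L * x j <= L by rewrite ler_piMr ?(ltW L0).
have Lx0 : 0 <= L * x j by rewrite mulr_ge0 ?(ltW L0).
by split; rewrite mulr_ge0 ?(ltW Np) //=; lra.
Qed.

Lemma cone_below_cell c z j : cs c z -> y j + L * `|z.1 - x j| < z.2 ->
  exists c', [/\ cs c' (pt j), beta c', (c'.1.1 <= c.1.1)%N & (c'.1.2 <= c.1.2)%N].
Proof.
move=> cz; rewrite -cone_below => /andP[pj qj].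
have [p0 q0] := config_pos j.
have [_ /andP[_ zp] /andP[_ zq]] := cellset_box cz.
have bj : box (pt j).
  split; [exact: hx|rewrite p0 /=|rewrite q0 /=].
    exact: lt_trans pj zp.
  exact: lt_trans qj zq.
have [c' c'j] := gbox_cell wM N20 bj.
exists c'; case: (cz) => _ z1 z2 _; case: (c'j) => _ j1 j2 _; split => //.
- by apply/occP; exists j.
- exact: ucell_mono pj z1 j1.
- exact: ucell_mono qj z2 j2.
Qed.

Lemma cell_below_cone c c' z j : cs c z -> cs c' (pt j) ->
  (c'.1.1 < c.1.1)%N -> (c'.1.2 < c.1.2)%N -> m z.1 < z.2.
Proof.
move=> cz cj l1 l2; apply: le_lt_trans (mle_le g_lip hy z.1 j) _.
rewrite -cone_below; case: cz => _ z1 z2 _; case: cj => _ j1 j2 _.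
by rewrite (ucell_sep l1 z1 j1) (ucell_sep l2 z2 j2).
Qed.

(** [gbelow] allows one equal index, which does not compare points. On a good configuration distinct
    points never share a strip, so weak inequalities of indices are strict and agree with those of
    the coordinates. *)
Lemma boundary_opened c j : cs c (pt j) -> (m (x j) == y j) = voidb (bel c) beta.
Proof.
move=> cj.
have mj : m (x j) <= y j by have := mle_le g_lip hy (x j) j; rewrite subrr normr0 mulr0 addr0.
apply/idP/idP => [/eqP e|].
  apply/forall_inP => c' c'c; apply/negP => /occP[j' cj'].
  suff : m (x j) < y j by rewrite e ltxx.
  move: c'c; rewrite inE => /and3P[l1 l2 ne].
  have ne12 : j != j'.
    apply: contra ne => /eqP jj; rewrite jj in cj.
    by rewrite (cellset_inj cj cj').
  apply: (@cell_below_cone c c' (pt j) j') => //.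
    rewrite ltn_neqAle l1 andbT; apply: contra ne12 => /eqP e1; apply/eqP.
    apply: (@hp c.1.1); first exact: (cellset_pstrip cj).
    by rewrite -(val_inj e1); exact: (cellset_pstrip cj').
  rewrite ltn_neqAle l2 andbT; apply: contra ne12 => /eqP e1; apply/eqP.
  apply: (@hq c.1.2); first exact: (cellset_qstrip cj).
  by rewrite -(val_inj e1); exact: (cellset_qstrip cj').
move=> /forall_inP void; rewrite eq_le mj leNgt /=; apply/negP => lt.
have [j' lj'] := mle_ltP lt.
have [c' [cj' bc' l1 l2]] := cone_below_cell cj lj'.
have := void c'; rewrite bc' inE l1 l2 /= => /(_ _)/negP; apply => //.
apply/eqP => e; have jj : j' = j.
  by apply: (@hp c.1.1); [rewrite -e; exact: (cellset_pstrip cj')|exact: (cellset_pstrip cj)].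
move: lj'; rewrite jj subrr normr0 mulr0 addr0 ltxx //.
Qed.

Lemma boundary_box j : m (x j) = y j -> box (pt j).
Proof.
move=> e; have [p0 q0] := config_pos j; have /andP[x0 x1] := hx j.
have := mle_bound (hx j); rewrite e => yj.
have Lx : L * x j <= L by rewrite ler_piMr ?(ltW L0).
have Lx0 : 0 <= L * x j by rewrite mulr_ge0 ?(ltW L0).
split; [exact: hx|rewrite p0 /=|rewrite q0 /=]; rewrite gmE ltr_pM2r //=; lra.
Qed.

Definition cell_point c : nat := xget 0%N [set j | cs c (pt j)].

Lemma cell_pointP c : beta c -> cs c (pt (cell_point c)).
Proof. by move=> /occP[j cj]; exact: (@xgetI _ 0%N [set j | cs c (pt j)] j). Qed.

(** Points outside the box are not on the graph and an occupied cell holds a single point, so the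
    partial sums are constant once the indices of all cell points are passed. *)
Lemma boundary_sumE (f : R -> R) :
  boundary_sum L f x y = \sum_c (voidb (bel c) beta)%:R * (beta c)%:R * f (x (cell_point c)).
Proof.
pose J := (\max_c cell_point c).+1.
apply: norm_lim_near_cst; exists J => // k /= Jk.
have J0 c : (cell_point c < k)%N by apply: leq_trans Jk; rewrite ltnS leq_bigmax.
transitivity (\sum_(0 <= j < k) \sum_c (`[< cs c (pt j) >] && voidb (bel c) beta)%:R * f (x j)).
  apply: eq_bigr => j _.
  have [bj|nbj] := pselect (box (pt j)).
    have [c cj] := gbox_cell wM N20 bj.
    rewrite (bigD1 c) //= big1 ?addr0; last first.
      move=> c' ne; rewrite (_ : `[< _ >] = false) ?mul0r //.
      by apply/asboolPn => cj'; move/eqP: ne; apply; exact: cellset_inj cj' cj.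
    by rewrite asboolT //= (boundary_opened cj).
  rewrite big1 => [|c _]; last first.
    by rewrite asboolF ?mul0r // => /cellset_box.
  by case: eqP => [/boundary_box//|_]; rewrite mul0r.
rewrite exchange_big /=; apply: eq_bigr => c _.
case: (boolP (beta c)) => [bc|nbc]; last first.
  rewrite mulr0 mul0r big1 // => j _; rewrite asboolF ?mul0r // => cj.
  by move/negP: nbc; apply; apply/occP; exists j.
have cp := cell_pointP bc.
rewrite (bigD1_seq (cell_point c)) ?mem_index_iota ?iota_uniq //=.
rewrite asboolT //= mulr1 big1 ?addr0 // => j ne.
rewrite asboolF ?mul0r // => cj; move/eqP: ne; apply; exact: config_cell_inj cj cp.
Qed.

Lemma boundary_sum_close (f : R -> R) (v : K -> R) (eta : R) :
  (forall c z, cs c z -> `|f z.1 - v c| <= eta) ->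
  `|boundary_sum L f x y - \sum_c (voidb (bel c) beta)%:R * v c * (beta c)%:R| <=
    eta * \sum_c (beta c)%:R.
Proof.
move=> H; rewrite boundary_sumE -sumrB; apply: le_trans (ler_norm_sum _ _ _) _.
rewrite mulr_sumr; apply: ler_sum => c _.
case: (boolP (beta c)) => [bc|nbc]; last by rewrite !mulr0 !mul0r subrr normr0.
have := H _ _ (cell_pointP bc) => /= h; rewrite !mulr1 -mulrBr normrM.
have e0 := le_trans (normr_ge0 _) h.
by case: voidb; rewrite ?normr1 ?normr0 ?mul1r ?mul0r.
Qed.

End Configuration.

Section ClosedRegion.
Variable R : realType.
Local Notation mu := (@lebesgue_measure R).
Local Notation mu2 := (mu \x mu)%E.
Implicit Types (f : R -> R) (J : set R).

(** Closed at the top to match void cones: cones are open, so that of a point on the graph of the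
    MLE is void. *)
Definition cregion f1 f2 J : set (R * R) := [set z | J z.1 /\ f1 z.1 <= z.2 <= f2 z.1].

Lemma measurable_cregion f1 f2 J : measurable J ->
  measurable_fun setT f1 -> measurable_fun setT f2 -> measurable (cregion f1 f2 J).
Proof.
move=> mJ m1 m2.
have -> : cregion f1 f2 J = (fst @^-1` J) `&` ([set z | f1 z.1 <= z.2] `&` [set z | z.2 <= f2 z.1]).
  apply/seteqP; split => z; first by move=> [? /andP[]].
  by move=> [? [? ?]]; split => //; apply/andP.
apply: measurableI.
  by rewrite -[X in measurable X]setTI; apply: measurable_fst.
by apply: measurableI; apply: measurable_leset => //; exact: measurableT_comp.
Qed.

Lemma mu2_cregion f1 f2 J : measurable J ->
  measurable_fun setT f1 -> measurable_fun setT f2 ->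
  (forall x, J x -> f1 x <= f2 x) ->
  mu2 (cregion f1 f2 J) = (\int[mu]_(x in J) (f2 x - f1 x)%:E)%E.
Proof.
move=> mJ m1 m2 f12; rewrite /product_measure1 [RHS]integral_mkcond.
apply: eq_integral => x _; rewrite /= patchE.
case: ifPn => [/set_mem Jx|/negP nJx].
  have -> : xsection (cregion f1 f2 J) x = `[f1 x, f2 x]%classic.
    apply/seteqP; split => y; rewrite /xsection /= inE /cregion /= in_itv /=.
      by move=> [].
    by move=> h; split.
  rewrite lebesgue_measure_itv /= lte_fin.
  by case: ltP => // h; have -> : f2 x - f1 x = 0 by have := f12 _ Jx; lra.
have -> : xsection (cregion f1 f2 J) x = set0; last by rewrite measure0.
rewrite -subset0 => y; rewrite /xsection /= inE /cregion /= => -[Jx _].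
by apply: nJx; rewrite inE.
Qed.

End ClosedRegion.

Section BoundedIntegrable.
Variable R : realType.
Local Notation mu := (@lebesgue_measure R).

Lemma unitE : [set s : R | 0 <= s <= 1] = `[0, 1]%classic.
Proof. by apply/seteqP; split => x /=; rewrite in_itv. Qed.

Lemma bounded_integrable (J : set R) (f : R -> R) (b : R) :
  measurable J -> J `<=` [set s | 0 <= s <= 1] -> measurable_fun setT f ->
  (forall s, 0 <= s <= 1 -> `|f s| <= b) -> mu.-integrable J (EFin \o f).
Proof.
move=> mJ J01 mf fb; apply: measurable_bounded_integrable => //.
- apply: (@le_lt_trans _ _ (mu [set s | 0 <= s <= 1])).
    by apply: le_measure; rewrite ?inE //; exact: measurable_unit.
  by rewrite mu_unit ltry.
- exact: measurable_funTS.
exists b; split; first exact: num_real.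
by move=> M bM s Js; rewrite /= (le_trans (fb _ (J01 _ Js))) // ltW.
Qed.

Lemma Rintegral_bigsetU (I : finType) (F : I -> set R) (f : R -> R) :
  (forall i, measurable (F i)) -> trivIset setT F -> measurable_fun setT f ->
  (forall i, mu.-integrable (F i) (EFin \o f)) ->
  \int[mu]_(x in \big[setU/set0]_(i <- index_enum I) F i) f x =
  \sum_(i : I) \int[mu]_(x in F i) f x.
Proof.
move=> mF tF mf iF; rewrite /Rintegral integral_bigsetU_EFin //.
- rewrite -sum_fine // => i _.
  by apply: (integrable_fin_num _ (iF i)); exact: mF.
- exact: index_enum_uniq.
- by move=> i j _ _; exact: tF.
- by apply: measurable_funTS; apply/measurable_EFinP.
Qed.

End BoundedIntegrable.

Lemma norm_sub_level (R : realFieldType) (u b k e : R) :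
  k <= u + b -> u + b < k + e -> `|u - (- b + k)| <= e.
Proof. by move=> h1 h2; rewrite ler_norml; apply/andP; split; lra. Qed.

(** * Area between the boundary and the MLE *)

Section ConfigurationArea.
Variable R : realType.
Local Notation mu := (@lebesgue_measure R).
Local Notation mu2 := (mu \x mu)%E.
Variables (L : R) (g w : R -> R) (M Qb N N2 : nat) (x y : nat -> R).
Hypothesis L0 : 0 < L.
Hypothesis g_lip : forall x y, `|g y - g x| <= L * `|y - x|.
Hypothesis mw : measurable_fun setT w.
Hypothesis wM : forall x, `|w x| <= M%:R.
Hypothesis N0 : (0 < N)%N.
Hypothesis N20 : (0 < N2)%N.
Hypothesis Qg : forall x, 0 <= x <= 1 -> L - Qb%:R <= g x.
Hypothesis good : good_config L g Qb N x y.

Local Notation K := (gcell M Qb N N2).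
Local Notation cs := (@cellset R L w M Qb N N2).
Local Notation box := (gbox L Qb N).
Local Notation W := (gwin L g Qb N).
Local Notation ar := (garea L g Qb N).
Local Notation bel := (@gbelow M Qb N N2).
Local Notation m := (mle L x y).
Local Notation gw := (@gweight R M Qb N N2).
Local Notation beta := (config_occ L w M Qb N N2 x y).
Local Notation I01 := [set s : R | 0 <= s <= 1].

Let mW : measurable W. Proof. exact: measurable_gwin. Qed.
Let fW : (mu2 W < +oo)%E. Proof. exact: mu2_gwin. Qed.
Let mcs c : measurable (cs c). Proof. exact: measurable_cellset. Qed.
Let tcs : trivIset setT cs. Proof. exact: trivIset_cellset. Qed.
Let Np : (0 : R) < N%:R. Proof. by rewrite ltr0n. Qed.
Let mg : measurable_fun setT g. Proof. exact: (measurable_g L0 g_lip). Qed.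
Let hy := config_epi good.
Let m_lip : forall x y, `|m y - m x| <= L * `|y - x|.
Proof. by move=> s s'; exact: (mle_lipschitz L0 g_lip hy). Qed.
Let mm : measurable_fun setT m. Proof. exact: (measurable_g L0 m_lip). Qed.
Let gm_le s : g s <= m s. Proof. exact: (mle_ge g_lip hy). Qed.

Definition under_mle : set (R * R) := cregion g m I01.
(* Cells sharing a strip with an occupied cell: for these the comparison of cells
   does not decide that of points. *)
Definition dirty (c : K) := [exists c' : K, beta c' && ((c'.1.1 == c.1.1) || (c'.1.2 == c.1.2))].
Local Notation U := under_mle.

Let mU : measurable U.
Proof. by apply: measurable_cregion => //; exact: measurable_unit. Qed.

Lemma under_mle_box : U `<=` W.
Proof.
move=> z [z01 /andP[z1 z2]]; split => //.
have zm := le_trans z2 (mle_bound L0 g_lip good z01); have gz := le_trans (Qg z01) z1.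
move/andP: (z01) => [s0 s1].
have Lx : L * z.1 <= L by rewrite ler_piMr ?(ltW L0).
have Lx0 : 0 <= L * z.1 by rewrite mulr_ge0 ?(ltW L0).
by split => //; rewrite gmE /pu /qu ltr_pM2r // pmulr_lge0 //; apply/andP; split; lra.
Qed.

(** No occupied cell shares a strip with [c], so occupied cells below [c] have both indices strictly
    smaller, and their points lie in the cone of every point of [c]. *)
Lemma under_mle_clean c z : ~~ dirty c -> cs c z -> W z ->
  U z <-> voidb (bel c) beta.
Proof.
rewrite negb_exists => /forallP cl cz [[z01 _ _] ez]; split.
  move=> [_ /andP[_ zm]]; apply/forall_inP => c'; rewrite inE => /and3P[l1 l2 _].
  apply/negP => bc'; have := cl c'; rewrite bc' /= negb_or => /andP[n1 n2].
  have /occP[j cj] := bc'.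
  have := cell_below_cone L0 g_lip N0 good cz cj.
  rewrite !ltn_neqAle l1 l2 !andbT n1 n2 => /(_ isT isT).
  by rewrite ltNge zm.
move=> /forall_inP void; split => //; apply/andP; split => //.
rewrite leNgt; apply/negP => lt; have [j lj] := mle_ltP lt.
have [c' [cj' bc' l1 l2]] := cone_below_cell L0 wM N0 N20 Qg good cz lj.
have := void c'; rewrite bc' inE l1 l2 /= => /(_ _)/negP; apply => //.
have := cl c'; rewrite bc' negb_or => /andP[n1 n2]; apply: contra n1 => /eqP ->.
by [].
Qed.

Lemma under_mle_cell c : ~~ dirty c ->
  ar (U `&` cs c) = (voidb (bel c) beta)%:R * ar (cs c).
Proof.
move=> cl; case: (boolP (voidb (bel c) beta)) => v; rewrite ?mul1r ?mul0r /garea /area.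
  congr (fine (mu2 _)); apply/seteqP; split => z; first by move=> [[]].
  by move=> [cz Wz]; split => //; split => //; apply/(under_mle_clean cl cz Wz).
rewrite (_ : _ `&` _ = set0) ?measure0 //.
rewrite -subset0 => z [[Uz cz] Wz]; move/negP: v; apply.
exact/(under_mle_clean cl cz Wz).
Qed.

Lemma pstrip_area (i : 'I_(gm Qb N)) : \sum_(c : K | c.1.1 == i) ar (cs c) <= N%:R^-1.
Proof.
rewrite /garea -area_bigsetU //; apply: le_trans (garea_pstrip L0 g_lip N0 i).
apply: le_garea => //; first by exact: measurable_bigsetU.
  exact: measurable_pstrip.
by move=> z [bz _]; have [c /eqP <- cz] := bigsetUP bz; exact: cellset_pstrip cz.
Qed.

Lemma qstrip_area (i : 'I_(gm Qb N)) : \sum_(c : K | c.1.2 == i) ar (cs c) <= N%:R^-1.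
Proof.
rewrite /garea -area_bigsetU //; apply: le_trans (garea_qstrip L0 g_lip N0 i).
apply: le_garea => //; first by exact: measurable_bigsetU.
  exact: measurable_qstrip.
by move=> z [bz _]; have [c /eqP <- cz] := bigsetUP bz; exact: cellset_qstrip cz.
Qed.

(** Each occupied cell spoils one strip in each direction, of area at most [1 / N]; the double sum
    counts every dirty cell at least once. *)
Lemma dirty_area : \sum_(c | dirty c) ar (cs c) <= 2 * (\sum_(c : K) (beta c)%:R) / N%:R.
Proof.
have a0 c : 0 <= ar (cs c) by exact: garea_ge0.
apply: (@le_trans _ _ (\sum_(c' : K) (beta c')%:R *
  (\sum_(c : K | c.1.1 == c'.1.1) ar (cs c) + \sum_(c : K | c.1.2 == c'.1.2) ar (cs c)))).
  have -> : \sum_(c' : K) (beta c')%:R *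
      (\sum_(c : K | c.1.1 == c'.1.1) ar (cs c) + \sum_(c : K | c.1.2 == c'.1.2) ar (cs c)) =
    \sum_(c : K) \sum_(c' : K) (beta c')%:R * ((c.1.1 == c'.1.1)%:R + (c.1.2 == c'.1.2)%:R) * ar (cs c).
    rewrite exchange_big; apply: eq_bigr => c' _; under eq_bigr do rewrite -mulrA.
    rewrite -mulr_sumr; congr (_ * _).
    rewrite big_mkcond [X in _ + X]big_mkcond /= -big_split; apply: eq_bigr => c _ /=.
    by do 2 case: eqP => _; rewrite ?addr0 ?add0r ?mul1r ?mul0r // mulrDl mul1r.
  rewrite big_mkcond; apply: ler_sum => c _.
  have t0 c' : 0 <= (beta c')%:R * ((c.1.1 == c'.1.1)%:R + (c.1.2 == c'.1.2)%:R) * ar (cs c).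
    by rewrite mulr_ge0 // mulr_ge0 ?ler0n // addr_ge0 ?ler0n.
  case: ifP => [|_]; last by rewrite sumr_ge0.
  move=> /existsP[c' /andP[bc' e]].
  rewrite (bigD1 c') //= bc' mul1r; apply: (@le_trans _ _ (((c.1.1 == c'.1.1)%:R + (c.1.2 == c'.1.2)%:R) * ar (cs c))); last first.
    by rewrite lerDl sumr_ge0.
  rewrite ler_peMl // !(eq_sym (c.1).1) !(eq_sym (c.1).2).
  by move: e; do 2 case: eqP => //= _; rewrite ?addr0 ?add0r // lerDl.
have -> : 2 * (\sum_(c : K) (beta c)%:R) / N%:R = \sum_(c : K) (beta c)%:R * (N%:R^-1 + N%:R^-1) :> R.
  by rewrite -mulr_suml; ring.
apply: ler_sum => c _; rewrite ler_wpM2l ?ler0n //.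
by apply: lerD; [exact: pstrip_area|exact: qstrip_area].
Qed.

Lemma under_mle_area (v : K -> R) : (forall c, `|v c| <= M%:R) ->
  `|\sum_c v c * ar (U `&` cs c) - \sum_c (voidb (bel c) beta)%:R * v c * ar (cs c)| <=
  M%:R * (2 * (\sum_(c : K) (beta c)%:R) / N%:R).
Proof.
move=> vM; apply: le_trans (ler_wpM2l _ dirty_area); last exact: ler0n.
rewrite -sumrB; apply: le_trans (ler_norm_sum _ _ _) _.
rewrite mulr_sumr [leRHS]big_mkcond; apply: ler_sum => c _.
case: ifPn => [_|cl]; last first.
  by rewrite under_mle_cell // mulrCA mulrA subrr normr0.
rewrite -mulrA mulrCA -mulrBr normrM; apply: ler_pM => //.
have h1 : ar (U `&` cs c) <= ar (cs c).
  by apply: le_garea => //; [exact: measurableI|move=> z [[]]].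
have h2 := garea_ge0 L g Qb N (cs c); have h3 := garea_ge0 L g Qb N (U `&` cs c).
case: voidb; rewrite ?mul1r ?mul0r; last by rewrite subr0 ger0_norm.
by rewrite distrC ger0_norm ?subr_ge0 // gerBl.
Qed.

(** Level sets of the rounded weight, which split the integral against a merely measurable [w] along
    the third index of the cells. *)
Definition wlevel (a : 'I_(gl M N2)) : set R := I01 `&` [set s | ucell ((w s + M%:R) * N2%:R) a].

Let mlev a : measurable (wlevel a).
Proof.
apply: measurableI; first exact: measurable_unit.
have mwu : measurable_fun setT (fun s => (w s + M%:R) * N2%:R).
  by apply: measurable_funM => //; apply: measurable_funD.
rewrite (_ : [set s | _] = [set s | (a : nat)%:R <= (w s + M%:R) * N2%:R] `&`
    [set s | (w s + M%:R) * N2%:R < a.+1%:R]); last first.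
  by apply/seteqP; split => s /=; [move/andP|move=> h; apply/andP].
by apply: measurableI; [apply: measurable_leset|apply: measurable_ltset].
Qed.

Let tlev : trivIset setT wlevel.
Proof. by move=> a a' _ _ [s [[_ h1] [_ h2]]]; apply/val_inj/(ucell_inj h1 h2). Qed.

Let levE : \big[setU/set0]_(a <- index_enum 'I_(gl M N2)) wlevel a = I01.
Proof.
apply/seteqP; split => s; first by move=> bs; have [a _ []] := bigsetUP bs.
move=> s01; have [a ha] := wu_cell wM N20 (s, 0).
by apply: (@bigsetU_sup _ _ predT wlevel a).
Qed.

Lemma wlevel_area a : \int[mu]_(s in wlevel a) (m s - g s) =
  \sum_(c : K | c.2 == a) ar (U `&` cs c).
Proof.
have mc : measurable (cregion g m (wlevel a)) by exact: measurable_cregion.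
have sub : cregion g m (wlevel a) `<=` U by move=> z [[z01 _] zz].
rewrite /Rintegral -mu2_cregion //.
have -> : fine (mu2 (cregion g m (wlevel a))) = ar (cregion g m (wlevel a)).
  rewrite /garea /area setIidl //; exact: subset_trans sub under_mle_box.
rewrite /garea (area_partition mW fW mc mcs tcs); last first.
  by move=> z _ [bz _]; exact: (gbox_cell wM N20 bz).
rewrite [RHS]big_mkcond; apply: eq_bigr => c _.
case: eqP => [<-|ne]; rewrite /area.
  congr (fine (mu2 _)); apply/seteqP; split => z [[Uz cz] Wz]; do !split => //; try by case: Uz => [[]].
  by case: cz.
rewrite (_ : _ `&` _ = set0) ?measure0 //.
rewrite -subset0 => z [[[[_ h] _] [_ _ _ h']] _]; apply: ne.
exact/val_inj/(ucell_inj h' h).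
Qed.

Let mle_gap s : 0 <= s <= 1 -> 0 <= m s - g s <= 2 * Qb%:R.
Proof.
move=> s01; have := gm_le s; have := mle_bound L0 g_lip good s01; have := Qg s01.
have l0 := L0; move=> h1 h2 h3; apply/andP; split; first by lra.
by move: h1 h2 l0; move: (m s) (g s) => a b; lra.
Qed.

(** The first error comes from rounding [w] to precision [1 / N2] over a total area of at most
    [2 Qb], the second from the dirty cells, with weights at most [M]. *)
Lemma functional_close :
  `|functional w m - functional w g - \sum_c (voidb (bel c) beta)%:R * gw c * ar (cs c)| <=
  2 * Qb%:R / N2%:R + M%:R * (2 * (\sum_(c : K) (beta c)%:R) / N%:R).
Proof.
have n2 : (0 : R) < N2%:R by rewrite ltr0n.
have mI : measurable I01 by exact: measurable_unit.
have mh : measurable_fun setT (fun s => m s - g s) by exact: measurable_funB.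
have [gb gbP] : exists gb, forall s, 0 <= s <= 1 -> `|g s| <= gb.
  exists (`|g 0| + L) => s /andP[s0 s1].
  have := g_lip 0 s; rewrite subr0 (ger0_norm s0) => h.
  have Ls : L * s <= L by rewrite ler_piMr ?(ltW L0).
  have -> : g s = g 0 + (g s - g 0) by ring.
  apply: le_trans (ler_normD _ _) _; lra.
have hb s : 0 <= s <= 1 -> `|m s - g s| <= 2 * Qb%:R.
  by move=> s01; have /andP[h1 h2] := mle_gap s01; rewrite ger0_norm.
have mb s : 0 <= s <= 1 -> `|m s| <= 2 * Qb%:R + gb.
  move=> s01; have -> : m s = (m s - g s) + g s by ring.
  by apply: le_trans (ler_normD _ _) _; apply: lerD; [exact: hb|exact: gbP].
have int J (f : R -> R) b : measurable J -> J `<=` I01 -> measurable_fun setT f ->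
    (forall s, 0 <= s <= 1 -> `|f s| <= b) -> mu.-integrable J (EFin \o f).
  by move=> mJ J01 mf fb; exact: bounded_integrable mJ J01 mf fb.
have intw J (f : R -> R) b : measurable J -> J `<=` I01 -> measurable_fun setT f ->
    (forall s, 0 <= s <= 1 -> `|f s| <= b) -> mu.-integrable J (EFin \o (fun s => f s * w s)).
  move=> mJ J01 mf fb; apply: (int _ _ (b * M%:R)) => //; first exact: measurable_funM.
  by move=> s s01; rewrite normrM; apply: ler_pM => //; exact: fb.
have sI a : wlevel a `<=` I01 by move=> s [].
have -> : functional w m - functional w g = \int[mu]_(s in I01) ((m s - g s) * w s).
  rewrite /functional -unitE -RintegralB //; last 2 first.
  - exact: intw mb.
  - exact: intw gbP.
  by apply: eq_Rintegral => s _; rewrite mulrBl.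
rewrite -levE Rintegral_bigsetU //; last 2 first.
- exact: measurable_funM.
- by move=> a; exact: intw (hb).
have key a : `|\int[mu]_(s in wlevel a) ((m s - g s) * w s) -
    (- M%:R + (a : nat)%:R / N2%:R) * \int[mu]_(s in wlevel a) (m s - g s)| <=
    N2%:R^-1 * \int[mu]_(s in wlevel a) (m s - g s).
  set v := - M%:R + _.
  have ih : mu.-integrable (wlevel a) (EFin \o (fun s => m s - g s)) by exact: int (hb).
  have i1 : mu.-integrable (wlevel a) (EFin \o (fun s => (m s - g s) * w s)) by exact: intw (hb).
  have i2 : mu.-integrable (wlevel a) (EFin \o (fun s => v * (m s - g s))).
    apply: (int _ _ (`|v| * (2 * Qb%:R))) => //; first exact: measurable_funM.
    by move=> s s01; rewrite normrM ler_wpM2l // hb.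
  have e1 : \int[mu]_(s in wlevel a) ((m s - g s) * w s - v * (m s - g s)) =
      \int[mu]_(s in wlevel a) ((m s - g s) * w s) - v * \int[mu]_(s in wlevel a) (m s - g s).
    rewrite -(_ : \int[mu]_(s in wlevel a) (v * (m s - g s)) = v * \int[mu]_(s in wlevel a) (m s - g s)).
      by apply: RintegralB => //; exact: mlev.
    by apply: RintegralZl ih; exact: mlev.
  have i3 : mu.-integrable (wlevel a) (EFin \o (fun s => (m s - g s) * w s - v * (m s - g s))).
    by apply: eq_integrable (integrableB _ i1 i2); first [exact: mlev|move=> s _; rewrite /= EFinB].
  have i4 : mu.-integrable (wlevel a) (EFin \o (fun s => N2%:R^-1 * (m s - g s))).
    apply: (int _ _ (`|N2%:R^-1| * (2 * Qb%:R))) => //; first exact: measurable_funM.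
    by move=> s s01; rewrite normrM ler_wpM2l // hb.
  have e2 : \int[mu]_(s in wlevel a) (N2%:R^-1 * (m s - g s)) =
      N2%:R^-1 * \int[mu]_(s in wlevel a) (m s - g s) by apply: RintegralZl ih; exact: mlev.
  rewrite -e1 -e2; apply: le_trans (le_normr_Rintegral _ i3) _; first exact: mlev.
  apply: le_Rintegral (integrable_norm i3) i4 _; first exact: mlev.
  move=> s [s01]; rewrite /ucell /= -natr1 => /andP[h1 h2].
  rewrite -ler_pdivrMr // in h1; rewrite -ltr_pdivlMr // mulrDl mul1r in h2.
  have -> : (m s - g s) * w s - v * (m s - g s) = (m s - g s) * (w s - v) by ring.
  have /andP[h0 _] := mle_gap s01; rewrite normrM ger0_norm // mulrC ler_wpM2r //.
  exact: norm_sub_level h1 h2.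
have areas a : \int[mu]_(s in wlevel a) (m s - g s) = \sum_(c : K | c.2 == a) ar (U `&` cs c).
  exact: wlevel_area.
have total (v : 'I_(gl M N2) -> R) : \sum_a v a * \int[mu]_(s in wlevel a) (m s - g s) =
    \sum_(c : K) v c.2 * ar (U `&` cs c).
  rewrite (partition_big (fun c : K => c.2) predT) //=; apply: eq_bigr => a _.
  by rewrite areas mulr_sumr; apply: eq_bigr => c /eqP ->.
have cl := under_mle_area (@gweight_bound R M Qb N N2 N20).
apply: le_trans (ler_distD (\sum_(c : K) gw c * ar (U `&` cs c)) _ _) _.
apply: lerD; last exact: cl.
rewrite -(total (fun a => - M%:R + (a : nat)%:R / N2%:R)) -sumrB.
apply: le_trans (ler_norm_sum _ _ _) _.
apply: (@le_trans _ _ (\sum_a N2%:R^-1 * \int[mu]_(s in wlevel a) (m s - g s))).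
  by apply: ler_sum => a _; exact: key.
rewrite (total (fun=> N2%:R^-1)) -mulr_sumr [leRHS]mulrC.
apply: ler_wpM2l; first by rewrite invr_ge0 (ltW n2).
have := @sum_garea_cell R L g w M Qb N N2 L0 g_lip mw N0; apply: le_trans.
apply: ler_sum => c _.
by apply: le_garea => //; [exact: measurableI|move=> z [[]]].
Qed.

End ConfigurationArea.

(** * Pathwise error between the estimator and the sieve *)

Section ConfigurationSieve.
Variable R : realType.
Local Notation mu := (@lebesgue_measure R).
Local Notation mu2 := (mu \x mu)%E.
Variables (L : R) (g w : R -> R) (M Qb N N2 n : nat).
Hypothesis L0 : 0 < L.
Hypothesis g_lip : forall x y, `|g y - g x| <= L * `|y - x|.
Hypothesis mw : measurable_fun setT w.
Hypothesis wM : forall x, `|w x| <= M%:R.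
Hypothesis N0 : (0 < N)%N.
Hypothesis N20 : (0 < N2)%N.
Hypothesis Qg : forall x, 0 <= x <= 1 -> L - Qb%:R <= g x.
Hypothesis n0 : (0 < n)%N.

Local Notation K := (gcell M Qb N N2).
Local Notation cs := (@cellset R L w M Qb N N2).
Local Notation ar := (garea L g Qb N).
Local Notation bel := (@gbelow M Qb N N2).
Local Notation gw := (@gweight R M Qb N N2).
Local Notation S := (gsieve L g w M Qb N N2 n).
Local Notation lam := (@glam R L g w M Qb N N2 n).

Let Np : (0 : R) < N%:R. Proof. by rewrite ltr0n. Qed.
Let np : (0 : R) < n%:R. Proof. by rewrite ltr0n. Qed.

(** One factor is at most [n / N]; the other sums to at most the intensity of the box. *)
Lemma glam_sqr_sum : \sum_(c : K) lam c ^+ 2 <= n%:R ^+ 2 * (2 * Qb%:R) / N%:R.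
Proof.
apply: (@le_trans _ _ (\sum_(c : K) n%:R ^+ 2 * (N%:R^-1 * ar (cs c)))).
  apply: ler_sum => c _; rewrite /glam exprMn ler_wpM2l ?sqr_ge0 // expr2.
  by rewrite ler_wpM2r ?garea_ge0 //; exact: garea_cell.
rewrite -!mulr_sumr -mulrA ler_wpM2l ?sqr_ge0 // mulrC.
by rewrite ler_wpM2r ?invr_ge0 ?(ltW Np) //; exact: sum_garea_cell.
Qed.

Lemma gsieve_comp : \sum_c @cweight R S c ^+ 2 * @cprob R S c ^+ 2 <=
  M%:R ^+ 2 * (n%:R ^+ 2 * (2 * Qb%:R) / N%:R).
Proof.
apply: le_trans (ler_wpM2l (sqr_ge0 _) glam_sqr_sum); rewrite mulr_sumr.
apply: ler_sum => c _ /=; have l0 : forall c, 0 <= lam c by move=> c'; exact: glam_nonneg.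
have /andP[p0 p1] := hit_prob01 l0 c.
apply: ler_pM; rewrite ?sqr_ge0 //.
  by rewrite -real_normK ?num_real // lerXn2r ?nnegrE ?ler0n //; exact: gweight_bound.
by rewrite lerXn2r ?nnegrE ?l0 //; exact: hit_prob_le.
Qed.

Variables (x y : nat -> R).
Hypothesis good : good_config L g Qb N x y.
Local Notation m := (mle L x y).
Local Notation beta := (config_occ L w M Qb N N2 x y).
Local Notation total := (\sum_(c : K) (beta c)%:R).

Lemma quad_close : `|boundary_sum L (fun s => w s ^+ 2) x y - squad (beta : {ffun cell S -> bool})| <=
  2 * M%:R / N2%:R * total.
Proof.
apply: (boundary_sum_close L0 g_lip wM N0 N20 Qg good) => c z cz.
have -> : w z.1 ^+ 2 - @cweight R S c ^+ 2 = (w z.1 - gw c) * (w z.1 + gw c) by rewrite /=; ring.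
rewrite normrM mulrC; apply: ler_pM => //; last exact: gweight_close cz.
apply: le_trans (ler_normD _ _) _.
by rewrite mulr_natl mulr2n; apply: lerD => //; exact: gweight_bound.
Qed.

(** The errors are, in order, that of the functional, that of replacing intensities by hit
    probabilities in the compensator, and that of rounding the weights at the points. *)
Lemma smart_close :
  `|n%:R * (theta_mle n L w x y - functional w g) + smart (beta : {ffun cell S -> bool})| <=
  n%:R * (2 * Qb%:R / N2%:R + M%:R * (2 * total / N%:R)) +
  M%:R * (n%:R ^+ 2 * (2 * Qb%:R) / N%:R) + N2%:R^-1 * total.
Proof.
have f1 := functional_close L0 g_lip mw wM N0 N20 Qg good.
have f2 : `|boundary_sum L w x y - \sum_c (voidb (bel c) beta)%:R * gw c * (beta c)%:R| <= N2%:R^-1 * total.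
  by apply: (boundary_sum_close L0 g_lip wM N0 N20 Qg good) => c z cz; exact: gweight_close cz.
have f3 : `|n%:R * (\sum_c (voidb (bel c) beta)%:R * gw c * ar (cs c)) -
    \sum_c (voidb (bel c) beta)%:R * gw c * hit_prob lam c| <= M%:R * (n%:R ^+ 2 * (2 * Qb%:R) / N%:R).
  apply: le_trans (ler_wpM2l _ glam_sqr_sum); last exact: ler0n.
  rewrite mulr_sumr -sumrB mulr_sumr; apply: le_trans (ler_norm_sum _ _ _) _.
  have l0 : forall c, 0 <= lam c by move=> c'; exact: glam_nonneg.
  apply: ler_sum => c _; rewrite mulrCA -mulrBr normrM.
  apply: ler_pM => //.
    rewrite normrM -[leRHS]mul1r; apply: ler_pM => //; last exact: gweight_bound.
    by case: voidb; rewrite ?normr1 ?normr0.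
  have := lam_sub_hit_prob l0 c; have := hit_prob_le lam c; rewrite -/(glam L g w n c).
  by move=> h1 h2; rewrite ger0_norm // subr_ge0.
have sE : smart (beta : {ffun cell S -> bool}) = \sum_c (voidb (bel c) beta)%:R * gw c * (beta c)%:R -
    \sum_c (voidb (bel c) beta)%:R * gw c * hit_prob lam c.
  by rewrite /smart /martingale -sumrB; apply: eq_bigr => c _; rewrite /scoef mulrBr.
rewrite sE /theta_mle.
move: f1 f2 f3; move: (functional w m) (functional w g) (boundary_sum _ _ _ _) => a b s.
move: (\sum_c (voidb (bel c) beta)%:R * gw c * ar (cs c)) => u1.
move: (\sum_c (voidb (bel c) beta)%:R * gw c * (beta c)%:R) => u2.
move: (\sum_c (voidb (bel c) beta)%:R * gw c * hit_prob lam c) => u3 f1 f2 f3.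
have -> : n%:R * (a - n%:R^-1 * s - b) + (u2 - u3) =
    n%:R * (a - b - u1) + (n%:R * u1 - u3) - (s - u2) by field; rewrite gt_eqF.
apply: le_trans (ler_normB _ _) _; apply: lerD f2.
apply: le_trans (ler_normD _ _) _; apply: lerD f3.
by rewrite normrM ger0_norm ?ler0n // ler_wpM2l ?ler0n.
Qed.

End ConfigurationSieve.

(** * Probability of bad configurations *)

Lemma probability_bigsetU_le d (T : measurableType d) (R : realType) (P : probability T R)
    (I : finType) (F : I -> set T) : (forall i, measurable (F i)) ->
  (P (\big[setU/set0]_i F i) <= \sum_i P (F i))%E.
Proof.
move=> mF; elim: (index_enum I) => [|i r IH]; first by rewrite !big_nil measure0.
rewrite !big_cons; apply: le_trans (measureU2 _ _ _) _; first exact: mF.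
  exact: bigsetU_measurable.
by rewrite leeD2l.
Qed.

Section PoissonConfiguration.
Context {d : measure_display} {T : measurableType d} {R : realType}.
Local Notation mu := (@lebesgue_measure R).
Local Notation mu2 := (mu \x mu)%E.
Variables (P : probability T R) (X Y : nat -> T -> R).
Variables (L : R) (g w : R -> R) (M Qb N N2 n : nat).
Hypothesis L0 : 0 < L.
Hypothesis g_lip : forall x y, `|g y - g x| <= L * `|y - x|.
Hypothesis mw : measurable_fun setT w.
Hypothesis wM : forall x, `|w x| <= M%:R.
Hypothesis N0 : (0 < N)%N.
Hypothesis N20 : (0 < N2)%N.
Hypothesis Qg : forall x, 0 <= x <= 1 -> L - Qb%:R <= g x.
Hypothesis n0 : (0 < n)%N.

Local Notation Lam := (intensity_measure (boundary_intensity n g)).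
Local Notation Z := (fun j t => (X j t, Y j t)).
Hypothesis ppp : is_poisson_process P strip Lam Z.

Local Notation K := (gcell M Qb N N2).
Local Notation cs := (@cellset R L w M Qb N N2).
Local Notation ar := (garea L g Qb N).
Local Notation S := (gsieve L g w M Qb N N2 n).
Local Notation lam := (@glam R L g w M Qb N N2 n).
Local Notation count := (point_count (R := R) Z).

Definition grid_occ (t : T) : {ffun cell S -> bool} := occupied Z cs t.

Let Np : (0 : R) < N%:R. Proof. by rewrite ltr0n. Qed.
Let np : (0 : R) < n%:R. Proof. by rewrite ltr0n. Qed.
Let Lam0 B : measurable B -> (0 <= Lam B)%E.
Proof. by move=> mB; exact: (intensity_ge0 n L0 g_lip). Qed.
Let LamE B : measurable B -> B `<=` gbox L Qb N -> Lam B = (n%:R * ar B)%:E.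
Proof. by move=> mB Bb; exact: (intensity_box n L0 g_lip N0). Qed.
Let mcs c : measurable (cs c). Proof. exact: measurable_cellset. Qed.
Let Lcs c : Lam (cs c) = (lam c)%:E.
Proof. by rewrite LamE //; exact: cellset_box. Qed.

Lemma grid_law : sieve_law P grid_occ.
Proof.
have fcs c : (Lam (cs c) < +oo)%E by rewrite Lcs ltry.
have tcs : trivIset setT cs by exact: trivIset_cellset.
have law o := occupied_law ppp Lam0 mcs tcs fcs o.
have lamE : (fun c => fine (Lam (cs c))) = lam.
  by apply/funext => c; rewrite Lcs.
split=> o; first exact: (law o).1.
by have := (law o).2; rewrite lamE.
Qed.

(** The mean number of occupied cells is at most the intensity of the box, a bound independent of
    the mesh. *)
Lemma grid_occ_markov (k : R) : 0 < k ->
  (P [set t | (k <= \sum_(c : K) (grid_occ t c)%:R)%R] <= (n%:R * (2 * Qb%:R) / k)%:E)%E.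
Proof.
move=> k0.
have := beta_event grid_law (fun o => (k <= \sum_c (o c)%:R)%R); rewrite /= => ->.
have l0 : forall c, 0 <= lam c by move=> c; exact: glam_nonneg.
rewrite lee_fin; apply: le_trans (Ex_markov _ _ k0) _.
- exact: hit_prob01 l0.
- by move=> o; rewrite sumr_ge0.
rewrite ler_pM2r ?invr_gt0 // Ex_sum.
have e1 c : Ex (@cprob R S) (fun o => (o c)%:R) = @cprob R S c.
  have := @Ex_coord R K (@cprob R S) c (fun=> 1) (fun _ _ => erefl).
  under eq_fun do rewrite mul1r.
  by move=> ->; under eq_fun do rewrite mul1r; rewrite Ex_cst.
under eq_bigr do rewrite e1.
apply: (@le_trans _ _ (\sum_(c : K) lam c)); first by apply: ler_sum => c _; exact: hit_prob_le.
rewrite /glam -mulr_sumr ler_pM2l //.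
exact: sum_garea_cell.
Qed.

Variables (Gb : R) (Rb : nat).
Hypothesis gGb : forall s, 0 <= s <= 1 -> g s <= Gb.
Hypothesis Rb0 : (0 < Rb)%N.
Local Notation tau := (Qb%:R - 2 * L - 1 - Gb).
Hypothesis tau0 : 0 < tau.

Definition gstrip (b : bool) (i : 'I_(gm Qb N)) : set (R * R) :=
  if b then pstrip L i else qstrip L i.
(** A point less than [tau] above [g] lies below [Gb + tau = Qb - 2 L - 1], the height asked of the
    low point of a good configuration. *)
Definition low_region : set (R * R) := region g (fun s => g s + tau) [set s | 0 <= s <= 1].

Let mstrip b i : measurable (gstrip b i).
Proof. by case: b; [exact: measurable_pstrip|exact: measurable_qstrip]. Qed.

Let Lstrip b i : Lam (gstrip b i) = (n%:R * ar (gstrip b i))%:E.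
Proof. by apply: LamE => //; case: b => z []. Qed.

Let mlow : measurable low_region.
Proof.
have mg := measurable_g L0 g_lip.
by apply: measurable_region => //; [exact: measurable_unit|exact: measurable_funD].
Qed.

Let Llow : Lam low_region = (n%:R * tau)%:E.
Proof.
rewrite (intensityE n L0 g_lip mlow) EFinM; congr (_ * _)%E.
rewrite setIidl; last first.
  by move=> z [z01 /andP[z1 _]]; split => //; rewrite stripE.
have mg := measurable_g L0 g_lip.
by rewrite (mu2_region_cst (@measurable_unit R) mg (ltW tau0)) mu_unit mule1.
Qed.

Let mepi : measurable (epi g). Proof. exact: (measurable_epi L0 g_lip). Qed.

Let Lepi : Lam (~` epi g) = 0%E.
Proof.
rewrite (intensityE n L0 g_lip); last exact: measurableC.
rewrite (_ : _ `&` _ = set0) ?measure0 ?mule0 //.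
by rewrite -subset0 => z [nz [_ /nz]].
Qed.

Definition crowded (u : bool * 'I_(gm Qb N)) : set T :=
  ~` [set t | count (gstrip u.1 u.2) t = 0%E \/ count (gstrip u.1 u.2) t = 1%E].

Definition bad_event : set T :=
  (\big[setU/set0]_(u : bool * 'I_(gm Qb N)) crowded u) `|` ((~` [set t | count (~` epi g) t = 0%E]) `|`
  ([set t | count low_region t = 0%E] `|` [set t | ((Rb%:R : R) <= \sum_(c : K) (grid_occ t c)%:R)%R])).

Let mcrowded u : measurable (crowded u).
Proof.
apply: measurableC; apply: measurableU; exact: (measurable_count_eq ppp).
Qed.

Let mbelow : measurable (~` [set t | count (~` epi g) t = 0%E]).
Proof.
by apply: measurableC; apply: (measurable_count_eq ppp); exact: measurableC.
Qed.

Let mmiss : measurable [set t | count low_region t = 0%E].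
Proof. exact: (measurable_count_eq ppp). Qed.

Let mocc : measurable [set t | ((Rb%:R : R) <= \sum_(c : K) (grid_occ t c)%:R)%R].
Proof. exact: (beta_event_measurable grid_law (fun o => ((Rb%:R : R) <= \sum_c (o c)%:R)%R)). Qed.

Lemma measurable_bad : measurable bad_event.
Proof.
apply: measurableU; first by apply: bigsetU_measurable => u _; exact: mcrowded.
by apply: measurableU => //; apply: measurableU.
Qed.

(** Each of the [4 Qb N] strips is crowded with probability at most [(n / N)^2], and almost surely
    no point falls below [g]. The last two terms are the void probability of [low_region] and
    Markov's inequality for the occupied cells. *)
Lemma bad_event_le : (P bad_event <= (4 * Qb%:R * n%:R ^+ 2 / N%:R +
  (expR (- (n%:R * tau)) + n%:R * (2 * Qb%:R) / Rb%:R))%:E)%E.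
Proof.
have m3 := measurableU _ _ mmiss mocc.
have m2 := measurableU _ _ mbelow m3.
have mc : measurable (\big[setU/set0]_(u : bool * 'I_(gm Qb N)) crowded u) by apply: bigsetU_measurable => u _; exact: mcrowded.
apply: le_trans (measureU2 _ mc m2) _.
rewrite [X in (_ <= X)%E]EFinD; apply: leeD.
  apply: le_trans (probability_bigsetU_le P mcrowded) _.
  apply: (@le_trans _ _ (\sum_(u : bool * 'I_(gm Qb N)) ((n%:R / N%:R) ^+ 2 : R)%:E)%E).
    apply: lee_sum => u _; apply: le_trans (poisson_two ppp Lam0 (mstrip u.1 u.2) _) _.
      by rewrite Lstrip ltry.
    have a0 := garea_ge0 L g Qb N (gstrip u.1 u.2).
    rewrite Lstrip lee_fin /= lerXn2r ?nnegrE ?divr_ge0 ?ler0n ?mulr_ge0 //.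
    rewrite ler_pM2l //; case: u.1; [exact: garea_pstrip|exact: garea_qstrip].
  rewrite sumEFin lee_fin sumr_const card_prod card_bool card_ord.
  rewrite -[leLHS]mulr_natr natrM gmE expr_div_n le_eqVlt; apply/orP; left; apply/eqP.
  by field; rewrite gt_eqF.
apply: le_trans (measureU2 _ mbelow m3) _.
rewrite -[X in (_ <= X)%E]add0e; apply: leeD.
  rewrite [X in (X <= _)%E]probability_setC; last by apply: (measurable_count_eq ppp); exact: measurableC.
  rewrite [X in (1 - X)%E](poisson_void ppp Lam0); last 2 first.
  - exact: measurableC.
  - by rewrite Lepi ltry.
  by rewrite Lepi /= oppr0 expR0 subee.
apply: le_trans (measureU2 _ mmiss mocc) _.
rewrite EFinD; apply: leeD; last by apply: grid_occ_markov; rewrite ltr0n.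
by rewrite [X in (X <= _)%E](poisson_void ppp Lam0) // Llow ?ltry.
Qed.

Lemma good_event t : ~ bad_event t ->
  good_config L g Qb N (X^~ t) (Y^~ t) /\ \sum_(c : K) (grid_occ t c)%:R <= Rb%:R :> R.
Proof.
move=> nb; have nc u : ~ crowded u t.
  by move=> cu; apply: nb; left; apply: (@bigsetU_sup _ _ predT crowded u).
have nbel : count (~` epi g) t = 0%E by apply: contrapT => h; apply: nb; right; left.
have nmiss : count low_region t <> 0%E by move=> h; apply: nb; right; right; left.
have nocc : ~ ((Rb%:R : R) <= \sum_(c : K) (grid_occ t c)%:R :> R)%R.
  by move=> h; apply: nb; right; right; right.
split; last by move/negP: nocc; rewrite -ltNge => /ltW.
have hx j : 0 <= X j t <= 1 by have := ppp_range ppp j t; rewrite stripE.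
have str b i j j' : gstrip b i (X j t, Y j t) -> gstrip b i (X j' t, Y j' t) -> j = j'.
  have := nc (b, i); rewrite /crowded /= => /contrapT h.
  exact: count_le1_inj h.
split => //.
- move=> j; have := (count_eq0 _ _ _).1 nbel j; rewrite /epi /= => /contrapT; exact.
- exact: (str true).
- exact: (str false).
have [j lj] : exists j, low_region (X j t, Y j t).
  apply: contrapT => no; apply: nmiss; apply/count_eq0 => j lj; apply: no; by exists j.
exists j; case: lj => _ /= /andP[_]; have := gGb (hx j); lra.
Qed.

Variable kappa : R.
Hypothesis kbad : 4 * Qb%:R * n%:R ^+ 2 / N%:R +
  (expR (- (n%:R * tau)) + n%:R * (2 * Qb%:R) / Rb%:R) <= kappa.
Hypothesis kmart : n%:R * (2 * Qb%:R / N2%:R + M%:R * (2 * Rb%:R / N%:R)) +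
  M%:R * (n%:R ^+ 2 * (2 * Qb%:R) / N%:R) + N2%:R^-1 * Rb%:R <= kappa.
Hypothesis kquad : 2 * M%:R / N2%:R * Rb%:R <= kappa.
Hypothesis kcomp : M%:R ^+ 2 * (n%:R ^+ 2 * (2 * Qb%:R) / N%:R) <= kappa.

Lemma poisson_approximation :
  approximation P grid_occ (~` bad_event)
    (fun t => n%:R * (theta_mle n L w (X^~ t) (Y^~ t) - functional w g))
    (fun t => boundary_sum L (fun s => w s ^+ 2) (X^~ t) (Y^~ t)) kappa.
Proof.
have n2p : (0 : R) < N2%:R by rewrite ltr0n.
split.
- exact: grid_law.
- by apply: measurableC; exact: measurable_bad.
- by rewrite setCK; apply: le_trans bad_event_le _; rewrite lee_fin.
- move=> t /good_event[gc occ].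
  apply: le_trans (smart_close L0 g_lip mw wM N0 N20 Qg n0 gc) _.
  apply: le_trans kmart.
  apply: lerD; last by apply: ler_wpM2l occ; rewrite invr_ge0 ltW.
  rewrite lerD2r; apply: ler_wpM2l; first exact: ler0n.
  rewrite lerD2l; apply: ler_wpM2l; first exact: ler0n.
  rewrite ler_pM2r ?invr_gt0 //; apply: ler_wpM2l => //; exact: occ.
- move=> t /good_event[gc occ].
  apply: le_trans (quad_close n L0 g_lip wM N0 N20 Qg gc) _.
  apply: le_trans kquad; apply: ler_wpM2l; last exact: occ.
  by rewrite divr_ge0 ?mulr_ge0 ?ler0n.
by apply: le_trans kcomp; exact: gsieve_comp.
Qed.

End PoissonConfiguration.

(** * Measurability of the estimator *)

Section MeasurableLimits.
Context {d : measure_display} {T : measurableType d} {R : realType}.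
Implicit Types (h : nat -> T -> R).

Lemma measurable_glue (D : set T) (f : T -> R) : measurable D ->
  measurable_fun D f -> measurable_fun (~` D) f -> measurable_fun setT f.
Proof.
move=> mD f1 f2; rewrite -(setUv D).
by apply/measurable_funU => //; exact: measurableC.
Qed.

(* [inf] is [0] on the event where the sequence is unbounded below. *)
Lemma measurable_inf_range h : (forall j, measurable_fun setT (h j)) ->
  measurable_fun setT (fun t => inf (range (h ^~ t))).
Proof.
move=> mh; pose D := \bigcup_(k : nat) \bigcap_(j : nat) [set t | - k%:R <= h j t].
have DE t : D t <-> has_lbound (range (h ^~ t)).
  split=> [[k _ hk]|[b hb]].
    by exists (- k%:R) => _ [j _ <-]; exact: hk.
  exists (Num.truncn (- b)).+1 => // j _ /=; rewrite lerNl.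
  have h1 : - h j t <= - b by rewrite lerN2; apply: hb; exists j.
  by apply: le_trans h1 (ltW _); exact: truncnS_gt.
have mD : measurable D.
  apply: bigcup_measurable => k _; apply: bigcap_measurable => // j _.
  exact: measurable_leset.
apply: (measurable_glue mD).
  have := @measurable_fun_infs _ _ _ D h 0 (fun t Dt => (DE t).1 Dt)
    (fun j => measurable_funTS (mh j)).
  apply: eq_measurable_fun => t _; rewrite /infs /sdrop; congr inf.
  by apply/seteqP; split => _ [j _ <-]; exists j.
apply: (@eq_measurable_fun _ _ _ _ _ (cst (0 : R))); last exact: measurable_cst.
move=> t /set_mem nD; rewrite /inf sup_out ?oppr0 // => -[_ [b hb]].
apply: nD; apply/DE; exists (- b) => _ [j _ <-]; rewrite lerNl.
by apply: hb; exists (h j t) => //; exists j.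
Qed.

(** A countable family of precisions makes the event of convergence measurable. *)
Lemma cvgnP_cauchy (u : nat -> R) :
  cvgn u <-> forall k : nat, exists n, forall m, (n <= m)%N -> `|u m - u n| <= k.+1%:R^-1.
Proof.
split=> [cu k|H].
  have : 0 < k.+1%:R^-1 :> R by rewrite invr_gt0 ltr0n.
  move: (k.+1%:R^-1) => e e0; have k0 : 0 < e / 2 by rewrite divr_gt0.
  have /cvgrPdist_le/(_ _ k0)[n _ hn] := cu.
  exists n => m nm; move: (hn n (leqnn n)) (hn m nm) => /=.
  move: (lim _) (u m) (u n) => a b c; rewrite /= !ler_norml => /andP[? ?] /andP[? ?]; apply/andP; split; lra.
apply: cauchy_cvg; apply: cauchy_exP => e e0.
have [n hn] := H (Num.truncn e^-1); exists (u n); exists n => // m /= nm.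
rewrite /ball /= distrC; apply: le_lt_trans (hn _ nm) _.
by rewrite invf_plt ?posrE ?ltr0n //; exact: truncnS_gt.
Qed.

(* [limn] is a constant on the event where the sequence diverges. *)
Lemma measurable_limn h : (forall j, measurable_fun setT (h j)) ->
  measurable_fun setT (fun t => limn (h ^~ t)).
Proof.
move=> mh.
pose D := \bigcap_(k : nat) \bigcup_(n : nat) \bigcap_(m in [set m | (n <= m)%N])
  [set t | `|h m t - h n t| <= k.+1%:R^-1].
have DE t : D t <-> cvgn (h ^~ t).
  rewrite cvgnP_cauchy; split=> [H k|H k _].
    by have [n _ hn] := H k I; exists n => m; exact: hn.
  by have [n hn] := H k; exists n => // m; exact: hn.
have mD : measurable D.
  apply: bigcap_measurable => // k _; apply: bigcup_measurable => n _.
  apply: bigcap_measurable => [|m _]; first by exists n => /=.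
  apply: measurable_leset => //; apply: measurableT_comp => //.
  exact: measurable_funB.
apply: (measurable_glue mD).
  apply: (@measurable_fun_cvg _ _ _ D h); first by move=> j; apply: measurable_funTS.
  by move=> t /DE.
apply: (@eq_measurable_fun _ _ _ _ _ (cst (point : R))); last exact: measurable_cst.
by move=> t /set_mem nD; rewrite dvgP // => /DE.
Qed.

End MeasurableLimits.

Section MeasurableEstimator.
Context {d : measure_display} {T : measurableType d} {R : realType}.
Local Notation mu := (@lebesgue_measure R).
Variables (X Y : nat -> T -> R) (L : R) (w : R -> R) (n : nat).
Hypothesis mX : forall j, measurable_fun setT (X j).
Hypothesis mY : forall j, measurable_fun setT (Y j).
Hypothesis mw : measurable_fun setT w.

(** Sample and abscissa are both functions of an auxiliary variable: this covers the MLE at its own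
    data points as well as joint measurability in the two. *)
Lemma measurable_mle d' (T' : measurableType d') (u : T' -> T) (s : T' -> R) :
  measurable_fun setT u -> measurable_fun setT s ->
  measurable_fun setT (fun t => mle L (X ^~ (u t)) (Y ^~ (u t)) (s t)).
Proof.
move=> mu ms; apply: (measurable_inf_range (h := fun j t => Y j (u t) + L * `|s t - X j (u t)|)) => j.
apply: measurable_funD; first exact: measurableT_comp (mY j) mu.
apply: measurable_funM => //; apply: measurableT_comp => //.
by apply: measurable_funB => //; exact: measurableT_comp (mX j) mu.
Qed.

Lemma measurable_boundary_sum (f : R -> R) : measurable_fun setT f ->
  measurable_fun setT (fun t => boundary_sum L f (X ^~ t) (Y ^~ t)).
Proof.
move=> mf; apply: (measurable_limn (h := fun k t => series (fun j =>
  (mle L (X ^~ t) (Y ^~ t) (X j t) == Y j t)%:R * f (X j t)) k)) => k.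
apply: measurable_sum => j.
apply: measurable_funM; last exact: measurableT_comp mf (mX j).
have mm : measurable_fun setT (fun t => mle L (X ^~ t) (Y ^~ t) (X j t)).
  exact: (measurable_mle (u := id)).
rewrite (_ : (fun t => _) = \1_([set t | mle L (X ^~ t) (Y ^~ t) (X j t) <= Y j t] `&`
    [set t | Y j t <= mle L (X ^~ t) (Y ^~ t) (X j t)])).
  by apply: measurable_indic; apply: measurableI; apply: measurable_leset.
apply/funext => t; rewrite indicE; congr (nat_of_bool _)%:R.
apply/eqP/idP => [e|/set_mem[/= h1 h2]]; last by apply: le_anti; rewrite h1 h2.
by apply/mem_set; rewrite /= e; split.
Qed.

(** Tonelli's theorem is applied to the positive and the negative part separately, as no bound on
    the MLE is available for an arbitrary sample. *)
Lemma measurable_functional_mle :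
  measurable_fun setT (fun t => functional w (mle L (X ^~ t) (Y ^~ t))).
Proof.
pose k (z : T * R) : \bar R := (mle L (X ^~ z.1) (Y ^~ z.1) z.2 * w z.2 * \1_(`[0, 1]%classic) z.2)%:E.
have mk : measurable_fun setT k.
  apply/measurable_EFinP; apply: measurable_funM.
    apply: measurable_funM; first exact: (measurable_mle (u := fst) (s := snd)).
    exact: measurableT_comp mw measurable_snd.
  by apply: measurableT_comp measurable_snd; apply: measurable_indic.
have e t : functional w (mle L (X ^~ t) (Y ^~ t)) =
    fine (fubini_F mu k^\+ t - fubini_F mu k^\- t)%E.
  rewrite /functional /Rintegral integral_mkcond integralE.
  have kt s : ((fun s => (mle L (X ^~ t) (Y ^~ t) s * w s)%:E) \_ `[0, 1]%classic) s = k (t, s).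
    rewrite patchE /k indicE /=.
    by case: (s \in _); rewrite ?mulr1 ?mulr0.
  congr (fine (_ - _)%E); apply: eq_integral => s _.
    by rewrite !funeposE kt.
  by rewrite !funenegE kt.
rewrite (_ : (fun t => _) = fine \o (fun t => fubini_F mu k^\+ t - fubini_F mu k^\- t)%E); last first.
  by apply/funext => t; rewrite e.
apply: measurableT_comp; first exact: fine_measurable.
apply: emeasurable_funB.
  by apply: measurable_fun_fubini_tonelli_F => //; exact: measurable_funepos.
by apply: measurable_fun_fubini_tonelli_F => //; exact: measurable_funeneg.
Qed.

Lemma measurable_theta_mle :
  measurable_fun setT (fun t => theta_mle n L w (X ^~ t) (Y ^~ t)).
Proof.
apply: measurable_funB; first exact: measurable_functional_mle.
by apply: measurable_funM => //; exact: measurable_boundary_sum.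
Qed.

End MeasurableEstimator.

(** * Second moment and normal quantile *)

Section SecondMoment.
Context {d : measure_display} {T : measurableType d} {R : realType}.
Variable P : probability T R.

Lemma Lfun2_sqr (f : T -> R) : measurable_fun setT f ->
  (\int[P]_t (f t ^+ 2)%:E < +oo)%E -> f \in Lfun P 2%:E.
Proof.
move=> mf fin; rewrite inE; apply/andP; split; rewrite inE /= //.
rewrite /finite_norm unlock /Lnorm; apply: poweR_lty.
apply: le_lt_trans fin; rewrite le_eqVlt; apply/orP; left; apply/eqP.
by apply: eq_integral => t _; rewrite /= powR_mulrn // real_normK ?num_real.
Qed.

(** If the right-hand side is infinite the bound is trivial; otherwise [f - a] is square integrable,
    and its variance, equal to that of [f], is at most its second moment. *)
Lemma variance_le_sqr (f : T -> R) (a : R) : measurable_fun setT f ->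
  (variance P f <= \int[P]_t ((f t - a) ^+ 2)%:E)%E.
Proof.
move=> mf; pose h := (f \- cst a)%R.
have [fin|] := ltP (\int[P]_t ((f t - a) ^+ 2)%:E)%E +oo%E; last first.
  by move=> /(le_trans _); apply; exact: leey.
have mh : measurable_fun setT h by exact: measurable_funB.
have hL : h \in Lfun P 2%:E by exact: Lfun2_sqr.
have -> : f = (h \+ cst a)%R by apply/funext => t; rewrite /h /= subrK.
rewrite varianceD_cst_r // varianceE //.
apply: (@le_trans _ _ (expectation P (h ^+ 2)%R)); first by rewrite geeDl // oppe_le0 sqre_ge0.
rewrite unlock le_eqVlt; apply/orP; left; apply/eqP.
by apply: eq_integral => t _; rewrite /h /= addrK.
Qed.

End SecondMoment.

Section NormalQuantile.
Variable R : realType.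

Lemma ncdf_ivt (p : R) : 0 < p < 1 -> exists q, ncdf q = p.
Proof.
move=> /andP[p0 p1].
have [a pa] : exists a : R, ncdf a < p.
  have : \forall x \near -oo%R, ncdf (x : R) < p by apply: (cvgr_lt _ (@ncdf_cvgNy R)); exact: p0.
  by move=> [b [_ hb]]; exists (b - 1); apply: hb; rewrite ltrBlDr ltrDl.
have [b pb] : exists b : R, p < ncdf b.
  have : \forall x \near +oo%R, p < ncdf (x : R) by apply: (cvgr_gt _ (@ncdf_cvgy R)); exact: p1.
  by move=> [c [_ hc]]; exists (c + 1); apply: hc; rewrite ltrDl.
have ab : a <= b by rewrite leNgt; apply/negP => /ncdf_lt; move: pa pb; lra.
have cab : {within `[a, b], continuous (@ncdf R)} by apply: continuous_subspaceT => x; exact: continuous_ncdf.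
have h := ltW (lt_trans pa pb).
have [|q _ qE] := @IVT _ _ _ _ p ab cab; last by exists q.
by rewrite (min_idPl h) (max_idPr h) !ltW.
Qed.

(** [ncdf] is continuous and strictly increasing, so the set defining the quantile is a closed
    half-line whose end is the solution. *)
Lemma quantile_normal (p : R) : 0 < p < 1 -> ncdf (quantile (normal_prob 0 1) p) = p.
Proof.
move=> p01; have [q qp] := ncdf_ivt p01.
suff -> : quantile (normal_prob 0 1) p = q by [].
rewrite /quantile.
have -> : [set q0 : R | (p%:E <= normal_prob 0 1 `]-oo, q0]%classic)%E] = `[q, +oo[%classic.
  apply/seteqP; split => x; rewrite /= in_itv /= andbT ncdfE lee_fin -qp.
    by move=> h; rewrite leNgt; apply/negP => /ncdf_lt; lra.
  exact: ncdf_le.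
by apply: inf_itv.
Qed.

Lemma quantile_normal_gt0 (p : R) : 2^-1 < p < 1 -> 0 < quantile (normal_prob 0 1) p.
Proof.
move=> /andP[p2 p1]; have := @quantile_normal p; set q := quantile _ _.
have -> : 0 < p < 1 by lra.
move=> /(_ isT) qp; rewrite ltNge; apply/negP => /ncdf_le; rewrite qp.
by have := ncdfN (0 : R); rewrite oppr0; lra.
Qed.

End NormalQuantile.

Lemma nat_above (R : realType) (a : R) : exists2 k : nat, (0 < k)%N & a <= k%:R.
Proof. by exists (Num.truncn a).+1 => //; exact/ltW/truncnS_gt. Qed.

Lemma ler_div_swap (R : realFieldType) (a b k : R) : 0 < b -> 0 < k -> a / b <= k -> a / k <= b.
Proof. by move=> b0 k0; rewrite !ler_pdivrMr // mulrC. Qed.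

(** * Choice of the grid *)

Section GridChoice.
Context {d : measure_display} {T : measurableType d} {R : realType}.
Variables (P : probability T R) (X Y : nat -> T -> R).
Variables (L : R) (g w : R -> R) (Gb : R) (M n : nat).
Hypothesis L0 : 0 < L.
Hypothesis g_lip : forall x y, `|g y - g x| <= L * `|y - x|.
Hypothesis gGb : forall x, 0 <= x <= 1 -> `|g x| <= Gb.
Hypothesis mw : measurable_fun setT w.
Hypothesis wM : forall x, `|w x| <= M%:R.
Hypothesis n0 : (0 < n)%N.
Hypothesis ppp : is_poisson_process P strip
  (intensity_measure (boundary_intensity n g)) (fun j t => (X j t, Y j t)).

(** The box size [Qb] comes first, then the bound [Rb] on occupied cells, then the mesh [N] and the
    weight resolution [K], which make the error terms small. The constant in the variance bound
    depends neither on [n] nor on [kappa]. *)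
Lemma exists_approximation (kappa : R) : 0 < kappa ->
  exists (S : sieve R) (beta : T -> {ffun cell S -> bool}) (G : set T),
  [/\ approximation P beta G
        (fun t => n%:R * (theta_mle n L w (X^~ t) (Y^~ t) - functional w g))
        (fun t => boundary_sum L (fun s => w s ^+ 2) (X^~ t) (Y^~ t)) kappa,
      forall c, `|@cweight _ S c| <= M%:R &
      Ex (@cprob R S) (fun o => (sbrac o - Ex (@cprob R S) (@sbrac R S)) ^+ 2) <=
        M%:R ^+ 4 * (1024 * expR (L + 2^-1) * (expR (L + 2^-1) + 2 * expR 1)) * 2 *
        (Num.sqrt n%:R * Num.sqrt (Num.sqrt n%:R))].
Proof.
move=> k0; have l0 := L0; have np : (0 : R) < n%:R by rewrite ltr0n.
have np1 : (1 : R) <= n%:R by rewrite ler1n.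
pose k4 := kappa / 4; have k40 : 0 < k4 by rewrite divr_gt0.
have G0 : 0 <= Gb by apply: le_trans (gGb (x := 0) _) => //; rewrite lexx ler01.
(* Ensures [tau >= 1 / k4], hence [exp (- n tau) <= k4], and that the bottom of the box is below
   [g - L]. *)
have [Qb Qb0 QbP] := nat_above (2 * L + 1 + 2 * Gb + k4^-1).
have ik0 : 0 < k4^-1 by rewrite invr_gt0.
have Qg x : 0 <= x <= 1 -> L - Qb%:R <= g x.
  by move=> /gGb; rewrite ler_norml => /andP[h _]; lra.
have gG x : 0 <= x <= 1 -> g x <= Gb by move=> /gGb; rewrite ler_norml => /andP[].
have tau : k4^-1 <= Qb%:R - 2 * L - 1 - Gb by lra.
have tau0 := lt_le_trans ik0 tau.
have expk : expR (- (n%:R * (Qb%:R - 2 * L - 1 - Gb))) <= k4.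
  rewrite expRN; set u := n%:R * _.
  have u1 : k4^-1 <= expR u.
    apply: (@le_trans _ _ (1 + u)); last exact: expR_ge1Dx.
    apply: (le_trans tau); rewrite /u; move: tau0; set t := _ - Gb => t0.
    have : 1 * t <= n%:R * t by rewrite ler_pM2r.
    by lra.
  by rewrite -[leRHS]invrK lef_pV2 ?posrE ?expR_gt0.
have [Rb Rb0 RbP] := nat_above (n%:R * (2 * Qb%:R) / k4).
(* [r = n^(-1/4)] balances [n r] and [sqrt n / r], both then equal to [n^(3/4)]. *)
pose r := (Num.sqrt (Num.sqrt n%:R))^-1 : R.
have s1 : 1 <= Num.sqrt (Num.sqrt n%:R) :> R.
  by rewrite -[leLHS](@sqrtr1 R) ler_sqrt ?sqrtr_ge0 // -[leLHS](@sqrtr1 R) ler_sqrt ?ler0n.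
have r0 : 0 < r by rewrite invr_gt0 (lt_le_trans ltr01).
have r1 : r <= 1 by rewrite invf_le1 // (lt_le_trans ltr01).
(* These bounds on [N] control in turn the crowded strips, the dirty area, the compensator error,
   the sum in [approx_comp], and the cell width relative to [r]. *)
have [m1 _ m1P] := nat_above (4 * Qb%:R * n%:R ^+ 2 / k4).
have [m2 _ m2P] := nat_above (n%:R * M%:R * (2 * Rb%:R) / k4).
have [m3 _ m3P] := nat_above (M%:R * (n%:R ^+ 2 * (2 * Qb%:R)) / k4).
have [m4 _ m4P] := nat_above (M%:R ^+ 2 * (n%:R ^+ 2 * (2 * Qb%:R)) / kappa).
have [m5 _ m5P] := nat_above (4 / (r * L)).
pose N := (m1 + m2 + m3 + m4 + m5 + 2 * n)%N.
have N0 : (0 < N)%N by rewrite /N; clear -n0; lia.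
have Np : (0 : R) < N%:R by rewrite ltr0n.
have mN m : (m <= N)%N -> m%:R <= N%:R :> R by rewrite ler_nat.
have N1 : 4 * Qb%:R * n%:R ^+ 2 / N%:R <= k4.
  by apply: ler_div_swap => //; apply: le_trans m1P _; apply: mN; rewrite /N; clear; lia.
have N2 : n%:R * M%:R * (2 * Rb%:R) / N%:R <= k4.
  by apply: ler_div_swap => //; apply: le_trans m2P _; apply: mN; rewrite /N; clear; lia.
have N3 : M%:R * (n%:R ^+ 2 * (2 * Qb%:R)) / N%:R <= k4.
  by apply: ler_div_swap => //; apply: le_trans m3P _; apply: mN; rewrite /N; clear; lia.
have N4 : M%:R ^+ 2 * (n%:R ^+ 2 * (2 * Qb%:R)) / N%:R <= kappa.
  by apply: ler_div_swap => //; apply: le_trans m4P _; apply: mN; rewrite /N; clear; lia.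
have N5 : 4 <= r * (L * N%:R).
  rewrite mulrA mulrC -ler_pdivrMr ?mulr_gt0 //; apply: le_trans m5P _; apply: mN; rewrite /N; clear; lia.
have nN : (2 * n <= N)%N by rewrite /N; clear; lia.
(* These bounds on the weight resolution control the rounding in the area, at the points, and in the
   squared weights. *)
have [p1 _ p1P] := nat_above (n%:R * (2 * Qb%:R) / k4).
have [p2 p20 p2P] := nat_above (Rb%:R / k4).
have [p3 _ p3P] := nat_above (2 * M%:R * Rb%:R / kappa).
pose K := (p1 + p2 + p3)%N.
have K0 : (0 < K)%N by rewrite /K; clear -p20; lia.
have Kp : (0 : R) < K%:R by rewrite ltr0n.
have mK m : (m <= K)%N -> m%:R <= K%:R :> R by rewrite ler_nat.
have K1 : n%:R * (2 * Qb%:R) / K%:R <= k4.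
  by apply: ler_div_swap => //; apply: le_trans p1P _; apply: mK; rewrite /K; clear; lia.
have K2 : Rb%:R / K%:R <= k4.
  by apply: ler_div_swap => //; apply: le_trans p2P _; apply: mK; rewrite /K; clear; lia.
have K3 : 2 * M%:R * Rb%:R / K%:R <= kappa.
  by apply: ler_div_swap => //; apply: le_trans p3P _; apply: mK; rewrite /K; clear; lia.
have Rk : n%:R * (2 * Qb%:R) / Rb%:R <= k4.
  by apply: ler_div_swap => //; rewrite ltr0n.
have k4E : kappa = k4 + k4 + k4 + k4 by rewrite /k4; field.
exists (gsieve L g w M Qb N K n), (grid_occ X Y L g w M Qb N K n),
  (~` bad_event X Y L g w M Qb N K n Gb Rb); split.
- apply: (poisson_approximation L0 g_lip mw wM N0 K0 Qg n0 ppp gG Rb0 tau0).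
  + by move: N1 expk Rk; rewrite k4E; move: (_ / _) (expR _) (_ / _) => a b c; lra.
  + have -> : n%:R * (2 * Qb%:R / K%:R + M%:R * (2 * Rb%:R / N%:R)) +
        M%:R * (n%:R ^+ 2 * (2 * Qb%:R) / N%:R) + K%:R^-1 * Rb%:R =
      n%:R * (2 * Qb%:R) / K%:R + n%:R * M%:R * (2 * Rb%:R) / N%:R +
      M%:R * (n%:R ^+ 2 * (2 * Qb%:R)) / N%:R + Rb%:R / K%:R :> R by ring.
    by rewrite k4E; do 3 (apply: lerD => //).
  + by rewrite -mulrA [_^-1 * _]mulrC mulrA.
  + by rewrite mulrA.
- move=> c; exact: gweight_bound.
have r01 : 0 < r <= 1 by rewrite r0 r1.
apply: le_trans (gsieve_variance L0 g_lip mw wM N0 K0 Qg n0 nN r01 N5) _.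
rewrite -[leRHS]mulrA le_eqVlt; apply/orP; left; apply/eqP; congr (_ * _).
rewrite /r invrK; set s := Num.sqrt (Num.sqrt n%:R).
have ss : Num.sqrt n%:R = s ^+ 2 :> R by rewrite sqr_sqrtr // sqrtr_ge0.
have sn : n%:R = s ^+ 4 :> R by rewrite (exprM s 2 2) -ss sqr_sqrtr // ler0n.
rewrite [X in X / s]sn ss; have s0 : s != 0 by rewrite gt_eqF // (lt_le_trans ltr01).
by field.
Qed.

End GridChoice.

(** * Reduction to functions on the whole line *)

Section UnitInterval.
Variable R : realType.
Local Notation mu := (@lebesgue_measure R).
Implicit Types (L : R) (f g h w : R -> R) (x y : nat -> R).

(** Projection onto the unit interval; being 1-Lipschitz, it extends [g] to the line with the same
    constant. *)
Definition clamp (s : R) : R := Num.max 0 (Num.min 1 s).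

Lemma clamp01 s : 0 <= clamp s <= 1.
Proof. by rewrite /clamp le_max lexx /= ge_max ler01 ge_min lexx. Qed.

Lemma clamp_id s : 0 <= s <= 1 -> clamp s = s.
Proof. by move=> /andP[s0 s1]; rewrite /clamp (min_idPr s1) (max_idPr s0). Qed.

Lemma clamp_lipschitz s s' : `|clamp s' - clamp s| <= `|s' - s|.
Proof.
rewrite ler_norml /clamp; have h1 := ler_norm (s' - s); have h2 := ler_norm (s - s').
rewrite distrC in h2; move: `|_| h1 h2 => a h1 h2.
case: (leP 1 s) => ?; case: (leP 1 s') => ?; rewrite ?(max_idPr ler01); try lra.
- by case: (leP 0 s') => ?; lra.
- by case: (leP 0 s) => ?; lra.
by case: (leP 0 s) => ?; case: (leP 0 s') => ?; lra.
Qed.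

Lemma lipschitz_clamp L g : 0 < L -> lipschitz_class L g ->
  forall s s', `|g (clamp s') - g (clamp s)| <= L * `|s' - s|.
Proof.
move=> L0 gl s s'; apply: (@le_trans _ _ (L * `|clamp s' - clamp s|)).
  by apply: gl; rewrite in_itv /= clamp01.
by rewrite ler_wpM2l ?(ltW L0) ?clamp_lipschitz.
Qed.

Lemma functional_ext w w' h h' : (forall s, 0 <= s <= 1 -> h s * w s = h' s * w' s) ->
  functional w h = functional w' h'.
Proof.
move=> e; apply: eq_Rintegral => s; rewrite inE /= in_itv /=; exact: e.
Qed.

Lemma boundary_sum_ext L f f' x y : (forall j, f (x j) = f' (x j)) ->
  boundary_sum L f x y = boundary_sum L f' x y.
Proof.
move=> e; rewrite /boundary_sum; congr (lim (series _ @ \oo)).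
by apply/funext => j; rewrite e.
Qed.

Lemma intensity_measure_ext n g g' : (forall s, 0 <= s <= 1 -> g s = g' s) ->
  intensity_measure (boundary_intensity n g) = intensity_measure (boundary_intensity n g').
Proof.
move=> e; apply/funext => B; apply: eq_integral => z /set_mem[_ [z01 _]].
move: z01; rewrite /= in_itv /= => z01; rewrite /boundary_intensity !indicE.
congr ((_ * (nat_of_bool _)%:R)%:E); apply/idP/idP => /set_mem /= h; apply/mem_set => /=.
  by rewrite -e.
by rewrite e.
Qed.

Lemma confidence_intervalE (n : nat) L w alpha x y (theta : R) : (0 < n)%N ->
  confidence_interval n L w alpha x y theta <->
  `|n%:R * (theta_mle n L w x y - theta)| <=
    quantile (normal_prob 0 1) (1 - alpha / 2) *
    Num.sqrt (boundary_sum L (fun s => w s ^+ 2) x y).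
Proof.
move=> n0; have np : (0 : R) < n%:R by rewrite ltr0n.
rewrite /confidence_interval /sigma_hat sqrtrM ?invr_ge0 ?sqr_ge0 //.
rewrite -exprVn sqrtr_sqr ger0_norm ?invr_ge0 ?(ltW np) //.
move: (theta_mle _ _ _ _ _) (quantile _ _) (Num.sqrt _) => a q s.
rewrite /= in_itv /= normrM (gtr0_norm np) -ler_pdivlMl // mulrA [n%:R^-1 * q]mulrC -mulrA mulrC.
by rewrite ler_norml; split => /andP[h1 h2]; apply/andP; split; lra.
Qed.

End UnitInterval.

Section VarianceScale.
Context {d : measure_display} {T : measurableType d} {R : realType}.
Variable P : probability T R.

Lemma powR_scale (n : nat) : (0 < n)%N ->
  n%:R ^+ 2 * n%:R `^ (- (3 / 2)) = Num.sqrt n%:R :> R.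
Proof.
move=> n0; have np : (0 : R) < n%:R by rewrite ltr0n.
rewrite -powR_mulrn ?ler0n // -powRD; last by rewrite (gt_eqF np) implybT.
by rewrite -powR12_sqrt ?ler0n //; congr (_ `^ _); field.
Qed.

(** [fine] of an infinite variance is 0, which the positive lower bound excludes. The variance is
    then at most the second moment about [a], and multiplying [n^(-3/2)] by [n^2] gives [sqrt n]. *)
Lemma second_moment_lower (f : T -> R) (n : nat) (a c : R) : (0 < n)%N -> 0 < c ->
  measurable_fun setT f ->
  c <= `|fine (variance P f) / n%:R `^ (- (3 / 2))| ->
  ((c * Num.sqrt n%:R)%:E <= \int[P]_t ((n%:R * (f t - a)) ^+ 2)%:E)%E.
Proof.
move=> n0 c0 mf; have np : (0 : R) < n%:R by rewrite ltr0n.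
have r0 : 0 < n%:R `^ (- (3 / 2)) :> R by rewrite powR_gt0.
have v0 : 0 <= fine (variance P f) by rewrite fine_ge0 // variance_ge0.
rewrite ger0_norm ?divr_ge0 ?(ltW r0) // ler_pdivlMr // => h.
have fV : variance P f \is a fin_num.
  move: h v0 (variance_ge0 P f); case: (variance P f) => //= h _ _.
  by have := lt_le_trans (mulr_gt0 c0 r0) h; rewrite ltxx.
have le := variance_le_sqr P a mf.
have -> : (\int[P]_t ((n%:R * (f t - a)) ^+ 2)%:E = (n%:R ^+ 2)%:E * \int[P]_t ((f t - a) ^+ 2)%:E)%E.
  rewrite -ge0_integralZl //.
  - by apply: eq_integral => t _; rewrite exprMn EFinM.
  - by apply/measurable_EFinP; apply: measurable_funX; exact: measurable_funB.
  - by move=> t _; rewrite lee_fin sqr_ge0.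
apply: (@le_trans _ _ ((n%:R ^+ 2)%:E * variance P f)%E).
  rewrite -(fineK fV) -EFinM lee_fin -(powR_scale n0) mulrCA.
  by rewrite ler_wpM2l ?sqr_ge0.
by apply: lee_wpmul2l => //; rewrite lee_fin sqr_ge0.
Qed.

End VarianceScale.

(** * Asymptotic coverage of the confidence interval *)

Theorem corollary3p6 (R : realType) (L : R) (g w : R -> R) (alpha : R)
    (d : nat -> measure_display) (T : forall n, measurableType (d n))
    (P : forall n, probability (T n) R)
    (X Y : forall n, nat -> T n -> R) :
  0 < L ->
  lipschitz_class L g ->
  measurable_fun (`[0, 1] : set R) w ->
  (exists M, forall x, x \in `[0, 1] -> `|w x| <= M) ->
  0 < alpha < 1 ->
  (forall n, (0 < n)%N ->
     is_poisson_process (P n) strip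
       (intensity_measure (boundary_intensity n g))
       (fun j t => (X n j t, Y n j t))) ->
  asymp
    (fun n => fine (variance (P n) (fun t =>
       theta_mle n L w (fun j => X n j t) (fun j => Y n j t))))
    (fun n => n%:R `^ (- (3 / 2))) ->
  P n [set t | confidence_interval n L w alpha
                 (fun j => X n j t) (fun j => Y n j t) (functional w g)]
    @[n --> \oo] --> (1 - alpha)%:E.
Proof.
move=> L0 gl mw [M0 wM0] a01 ppp [_ [c c0 lower]].
(* The model sees only the unit interval: extending [g] by clamping and [w] by 0 changes neither the
   intensity nor the estimators. *)
pose gc s := g (clamp s).
have gcE s : 0 <= s <= 1 -> gc s = g s by move=> h; rewrite /gc clamp_id.
have gc_lip : forall x y, `|gc y - gc x| <= L * `|y - x| by exact: lipschitz_clamp.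
have gGb x : 0 <= x <= 1 -> `|gc x| <= `|gc 0| + L.
  move=> /andP[x0 x1]; have -> : gc x = gc 0 + (gc x - gc 0) by ring.
  apply: le_trans (ler_normD _ _) _; rewrite lerD2l.
  apply: le_trans (gc_lip 0 x) _; rewrite subr0 ger0_norm //.
  by rewrite ler_piMr ?(ltW L0).
pose w1 := w \_ `[0, 1]%classic.
have w1E s : 0 <= s <= 1 -> w1 s = w s.
  by move=> h; rewrite /w1 patchE ifT // inE /= in_itv.
have mw1 : measurable_fun setT w1 by apply/(measurable_restrictT _ _).1.
have [M _ MP] := nat_above M0.
have wM x : `|w1 x| <= M%:R.
  rewrite /w1 patchE; case: ifPn => [/set_mem h|_]; last by rewrite normr0.
  by apply: le_trans (wM0 _ _) MP.
have pppc n : (0 < n)%N -> is_poisson_process (P n) strip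
    (intensity_measure (boundary_intensity n gc)) (fun j t => (X n j t, Y n j t)).
  by move=> n0; rewrite (intensity_measure_ext n gcE); exact: ppp.
have X01 n j t : (0 < n)%N -> 0 <= X n j t <= 1.
  by move=> n0; have := ppp_range (ppp _ n0) j t; rewrite stripE.
have mX n j : (0 < n)%N -> measurable_fun setT (X n j).
  by move=> n0; exact: measurableT_comp measurable_fst (ppp_measurable (ppp _ n0) j).
have mY n j : (0 < n)%N -> measurable_fun setT (Y n j).
  by move=> n0; exact: measurableT_comp measurable_snd (ppp_measurable (ppp _ n0) j).
have thE n t : (0 < n)%N ->
    theta_mle n L w (X n ^~ t) (Y n ^~ t) = theta_mle n L w1 (X n ^~ t) (Y n ^~ t).
  move=> n0; rewrite /theta_mle; congr (_ - _ * _).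
    by apply: functional_ext => s /w1E ->.
  by apply: boundary_sum_ext => j; rewrite w1E ?X01.
have bsE n t : (0 < n)%N -> boundary_sum L (fun s => w s ^+ 2) (X n ^~ t) (Y n ^~ t) =
    boundary_sum L (fun s => w1 s ^+ 2) (X n ^~ t) (Y n ^~ t).
  by move=> n0; apply: boundary_sum_ext => j; rewrite w1E ?X01.
have fE : functional w g = functional w1 gc.
  by apply: functional_ext => s s01; rewrite w1E ?gcE.
pose q := quantile (normal_prob 0 1) (1 - alpha / 2) : R.
have q0 : 0 < q by apply: quantile_normal_gt0; move: a01; lra.
have qE : ncdf q = 1 - alpha / 2 by apply: quantile_normal; move: a01; lra.
have -> : 1 - alpha = 2 * ncdf q - 1 by rewrite qE; field.
pose Z n t := n%:R * (theta_mle n L w1 (X n ^~ t) (Y n ^~ t) - functional w1 gc).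
pose Q n t := boundary_sum L (fun s => w1 s ^+ 2) (X n ^~ t) (Y n ^~ t).
have mth n : (0 < n)%N -> measurable_fun setT (fun t => theta_mle n L w1 (X n ^~ t) (Y n ^~ t)).
  by move=> n0; apply: measurable_theta_mle => // j; [exact: mX|exact: mY].
have C0 : 0 <= M%:R ^+ 4 * (1024 * expR (L + 2^-1) * (expR (L + 2^-1) + 2 * expR 1)) * 2 :> R.
  apply: mulr_ge0; last exact: ler0n.
  apply: mulr_ge0; first by apply: exprn_ge0; exact: ler0n.
  apply: mulr_ge0; first by apply: mulr_ge0; [exact: ler0n|exact: expR_ge0].
  apply: addr_ge0; first exact: expR_ge0.
  by apply: mulr_ge0; [exact: ler0n|exact: expR_ge0].
have mZ n : (0 < n)%N -> measurable_fun setT (Z n).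
  by move=> n0; apply: measurable_funM => //; apply: measurable_funB => //; exact: mth.
have mQ n : (0 < n)%N -> measurable_fun setT (Q n).
  move=> n0; apply: measurable_boundary_sum; last exact: measurable_funX.
    by move=> j; exact: mX.
  by move=> j; exact: mY.
have second n : (0 < n)%N -> ((c * Num.sqrt n%:R)%:E <= \int[P n]_t (Z n t ^+ 2)%:E)%E.
  move=> n0; apply: second_moment_lower => //; first exact: mth.
  have := lower n n0; congr (c <= `|fine (variance _ _) / _|).
  by apply/funext => t; exact: thE.
have limit := studentized_limit (ler0n R M) c0 C0 q0 mZ mQ second
  (fun n kappa n0 k0 => exists_approximation L0 gc_lip gGb mw1 wM n0 (pppc n n0) k0).
(* The events agree for [n >= 1]; the model says nothing about [n = 0]. *)
apply: cvg_trans limit; apply: near_eq_cvg; exists 1%N => // n /= n0.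
congr (P n _); apply/seteqP; split => t /=.
  by move=> h; apply/(confidence_intervalE _ _ _ _ _ _ n0); rewrite thE // bsE // fE.
by move=> /(confidence_intervalE _ _ _ _ _ _ n0); rewrite thE // bsE // fE.
Qed.
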